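(* Let $\beta_b>1$, $\beta_g>0$, $d>4\beta_b$, and let $(\varepsilon_n)_{n\ge1}$ be a fixed deterministic positive sequence with $\varepsilon_n\asymp n^{-a_\star}$, where $a_\star=\frac{d-4\beta_b}{d(d+4)}$. Let $\Theta(\beta_b,\beta_g,d)$ be the model class, $\widetilde\sigma^2_{n,\mathrm{LR}}$ the feasible witness estimator with screening constants $\kappa,v_0,c_0$ and bandwidth $\varepsilon_n$, and $\widetilde\sigma^2_{n,\mathrm{HOIF}}$, $\mathcal T$, $\widehat\sigma^2_{n,\mathrm{sharp}}$ and $\beta_g^\star$ be as defined in the context. (1) The constants $\kappa,v_0,c_0>0$ can be chosen (independently of $n$ and $\theta$) so that there is a constant $C<\infty$, not depending on $n$ or $\theta$, with $$\sup_{\theta\in\Theta(\beta_b,\beta_g,d)}\mathbb E_\theta\bigl(\widetilde\sigma^2_{n,\mathrm{LR}}-\sigma^2\bigr)^2\le C\,n^{-4(\beta_b+1)/(d+4)} .$$ This holds for every $\beta_g>0$. (2) Let $\kappa,v_0,c_0$ be chosen as in (1). Suppose in addition that, whenever $\beta_g>\beta_g^\star$, there is a constant $C_0$ not depending on $n$ or $\theta$ such that $$\sup_{\theta\in\Theta(\beta_b,\beta_g,d)}\mathbb E_\theta\Bigl[\bigl\{\mathbb E_\theta(\widetilde\sigma^2_{n,\mathrm{HOIF}}\mid\mathcal T)-\sigma^2\bigr\}^2\Bigr]\le C_0n^{-8\beta_b/(d+4\beta_b)},\qquad \sup_{\theta\in\Theta(\beta_b,\beta_g,d)}\mathbb E_\theta\Bigl[\operatorname{Var}_\theta(\widetilde\sigma^2_{n,\mathrm{HOIF}}\mid\mathcal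 T)\Bigr]\le C_0n^{-8\beta_b/(d+4\beta_b)} .$$ Then there is a constant $C<\infty$, not depending on $n$ or $\theta$, such that for all sufficiently large $n$ $$\sup_{\theta\in\Theta(\beta_b,\beta_g,d)}\mathbb E_\theta\bigl(\widehat\sigma^2_{n,\mathrm{sharp}}-\sigma^2\bigr)^2\le\begin{cases}C\,n^{-8\beta_b/(d+4\beta_b)},&\beta_g>\beta_g^\star,\\ C\,n^{-4(\beta_b+1)/(d+4)},&0<\beta_g\le\beta_g^\star.\end{cases}$$
   Context: **Hölder balls.** Fix an open set $U\subset\mathbb R^d$ containing $[0,1]^d$. For $s>0$ put $\ell_s=\lceil s\rceil-1$, $\alpha_s=s-\ell_s\in(0,1]$, and $\|g\|_{C^s(U)}=\sum_{|\nu|\le\ell_s}\|\partial^\nu g\|_{L^\infty(U)}+\max_{|\nu|=\ell_s}\sup_{x\ne y\in U}\frac{|\partial^\nu g(x)-\partial^\nu g(y)|}{\|x-y\|^{\alpha_s}}$ (so for integer $s$, $C^s$ means $C^{s-1,1}$). Let $\mathcal H^s(L;U)=\{g:U\to\mathbb R:\|g\|_{C^s(U)}\le L\}$. **Model.** Fix $0<\underline p<1<\overline p<\infty$, $L\ge1$, $0<\underline v\le\overline v<\infty$, $M_4>\overline v^{2}$. A parameter is $\theta=(p,f,\sigma^2,Q)$ with $p$ a density on $[0,1]^d$, $f$ a regression function, $\sigma^2>0$, $Q=(Q_x)_{x\in[0,1]^d}$ a Markov kernel. $\Theta(\beta_b,\beta_g,d)$ is the set of $\theta$ with: (i) $p$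 is the restriction to $[0,1]^d$ of a function in $\mathcal H^{\beta_g}(L;U)$ and $\underline p\le p\le\overline p$ on $[0,1]^d$; (ii) $f$ is the restriction to $[0,1]^d$ of a function in $\mathcal H^{\beta_b}(L;U)$; (iii) for $p(x)dx$-a.e. $x$, $\int u\,Q_x(du)=0$, $\int u^2Q_x(du)=\sigma^2$, $\int u^4Q_x(du)\le M_4$, with $\underline v\le\sigma^2\le\overline v$. One observes $n$ i.i.d. copies $(X_i,Y_i)$ with $X_i\sim p$, $Y_i=f(X_i)+\varepsilon_i$, $\varepsilon_i\mid X_i=x\sim Q_x$. $\mathbb E_\theta$ is expectation under $\theta$. Constants may depend on the model-class constants, $d,\beta_b,\beta_g,\lambda_0$, the screening parameters, the polynomial basis and the constants implicit in $\varepsilon_n\asymp n^{-a_\star}$. **Partition.** Fix $\lambda_0>0$; $r_n=\max\{0,\operatorname{round}(\log_2(n/\lambda_0))\}$, $J_n=2^{r_n}$, $H_n=J_n^{-1/d}$. Choose nonnegative integers $s_{n,1},\dots,s_{n,d}$ with sum $r_n$, pairwise differing by at most one; split coordinate $j$ of $[0,1]^d$ into $2^{s_{n,j}}$ equal intervals. The resulting partition $\mathcal Q_n$ has $J_n$ axis-aligned rectangular cells of volume $J_n^{-1}$ (boundaries assigned by a fixed half-open convention). Write $\overline Q=b_Q+A_Q[0,1]^d$ with $A_Q$ diagonal, and for $X_i\in Q$ let $U_i=A_Q^{-1}(X_i-b_Q)\in[0,1]^d$. **Cell quantities.** $\ell=\lceil\beta_b\rceil-1$, $q=\binom{d+\ell}{\ell}$;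 $\psi=(\psi_1,\dots,\psi_q)^\top$ is a fixed basis of polynomials on $\mathbb R^d$ of total degree at most $\ell$. For a cell $Q$: $I_Q=\{i:X_i\in Q\}=\{i_1<\dots<i_{N_Q}\}$, $\Phi_Q\in\mathbb R^{N_Q\times q}$ has rows $\psi(U_{i_r})^\top$, $Y_Q=(Y_{i_1},\dots,Y_{i_{N_Q}})^\top$, $G_Q=\Phi_Q^\top\Phi_Q$, and, when $G_Q$ is invertible, $P_Q=\Phi_QG_Q^{-1}\Phi_Q^\top$, $R_Q=I_{N_Q}-P_Q$. For a pair $e=(i,j)\subset I_Q$ of distinct indices with $i=i_r,j=i_s$, $d_e=e_r-e_s\in\mathbb R^{N_Q}$ (difference of standard basis vectors). **Feasible witness estimator.** For constants $\kappa,v_0>0$, on cells with $\lambda_{\min}(G_Q/N_Q)\ge\kappa$ let $\mathcal E_Q(\varepsilon_n)=\{(i,j)\subset I_Q:\|U_i-U_j\|_\infty\le\varepsilon_n,\ d_e^\top R_Qd_e\ge v_0\}$ (unordered pairs). Let $\mathcal T_n(\varepsilon_n)$ be the set of cells $Q$ with $N_Q=q+2$, $\lambda_{\min}(G_Q/N_Q)\ge\kappa$ and $\mathcal E_Q(\varepsilon_n)\neq\varnothing$. For such $Q$ let $e_Q$ be the lexicographically first pair of $\mathcal E_Q(\varepsilon_n)$ and $\widetilde{\mathbf a}_Q=R_Qd_{e_Q}/\sqrt{d_{e_Q}^\top R_Qd_{e_Q}}$. For $c_0>0$, define $\widetilde\sigma^2_{n,\mathrm{LR}}=|\mathcal T_n(\varepsilon_n)|^{-1}\sum_{Q\in\mathcal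 T_n(\varepsilon_n)}(\widetilde{\mathbf a}_Q^\top Y_Q)^2$ if $|\mathcal T_n(\varepsilon_n)|\ge c_0n\varepsilon_n^d$, and $\widetilde\sigma^2_{n,\mathrm{LR}}=(\underline v+\overline v)/2$ otherwise. **HOIF estimator and combined estimator.** $\beta_g^\star=\dfrac{\beta_b(1-4\beta_b/d)}{1+2\beta_b/d+8(\beta_b/d)^2}$. $\widetilde\sigma^2_{n,\mathrm{HOIF}}$ is a given estimator (a real-valued statistic of the sample), and $\mathcal T$ is the training subsample used in its construction, the training and estimation subsample sizes being fixed positive proportions of $n$; it is the higher-order influence function estimator of Robins, Li, Tchetgen Tchetgen and van der Vaart (2008, Theorems 4.5–4.6) for the expected conditional covariance, specialized to $A=Y$, both conditional-mean nuisances equal to $f$, $H_1=1$, $H_2=H_3=-Y$, $H_4=Y^2$. For the purposes of the statement it is a given estimator about which only the two displayed moment bounds are assumed. With $\operatorname{clip}_{[a,b]}(z)=\min\{b,\max\{a,z\}\}$, let $\widehat\sigma^2_{n,\mathrm{HOIF}}=\operatorname{clip}_{[\underline v,\overline v]}(\widetilde\sigma^2_{n,\mathrm{HOIF}})$ and $\widehat\sigma^2_{n,\mathrm{sharp}}=\widehat\sigma^2_{n,\mathrm{HOIF}}$ if $\beta_g>\beta_g^\star$, and $\widehat\sigma^2_{n,\mathrm{sharp}}=\widetilde\sigma^2_{n,\mathrm{LR}}$ if $0<\beta_g\le\beta_g^\star$. *)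

(* Defs.v *)
From HB Require Import structures.
From mathcomp Require Import all_boot all_order all_algebra.
(* Importing mpoly in full clashes with the notations of MathComp-Analysis. *)
From mathcomp Require Import (canonicals, coercions) mpoly.
From mathcomp Require Import all_classical all_reals all_analysis.
From mathcomp Require Import measurable_realfun.

Set Implicit Arguments.
Unset Strict Implicit.
Unset Printing Implicit Defensive.

Import Order.TTheory GRing.Theory Num.Theory.
Import numFieldNormedType.Exports.

Local Open Scope classical_set_scope.
Local Open Scope ring_scope.

(* absz is harmless, since ceil(s) - 1 >= 0 for s > 0. *)
Definition ell (R : realType) (s : R) : nat := absz (Num.ceil s - 1).

Section Holder.
Context {R : realType} {d : nat}.
Implicit Types (g : 'rV[R]_d -> R) (U : set 'rV[R]_d) (w : seq 'I_d).

Definition enorm (x : 'rV[R]_d) : R := Num.sqrt (\sum_i x 0 i ^+ 2).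

(* Iterated partial derivatives: w = [:: i_1; ...; i_k] gives
   d_(i_1) ... d_(i_k) g. *)
Definition wpartial w g : 'rV[R]_d -> R :=
  foldr (fun i h => fun x => 'D_(delta_mx 0 i) h x) g w.

Definition mpartial (nu : mpoly.multinom d) g : 'rV[R]_d -> R :=
  wpartial (flatten [seq nseq (nu i) i | i <- enum 'I_d]) g.

(* g is k times continuously differentiable on U.  The operator 'D_v is total,
   so the existence of the derivatives has to be required separately. *)
Definition Ck_on U (k : nat) g : Prop :=
  forall w, (size w <= k)%N ->
    (forall x, U x -> {for x, continuous (wpartial w g)}) /\
    ((size w < k)%N -> forall i x, U x ->
       derivable (wpartial w g) x (delta_mx 0 i)).

(* The derivatives of a C^k function being continuous and U open, their
   L^oo(U) norms are suprema.  mpoly.bmultinom d k is the finite type of the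
   multi-indices of total degree < k. *)
Definition holder_norm U (s : R) g : \bar R :=
  (\sum_(nu : mpoly.bmultinom d (ell s).+1)
     ereal_sup [set `|mpartial nu g x|%:E | x in U]
   + \big[maxe/-oo]_(nu : mpoly.bmultinom d (ell s).+1
                      | mpoly.mdeg nu == ell s)
       ereal_sup [set (`|mpartial nu g xy.1 - mpartial nu g xy.2|
                       / enorm (xy.1 - xy.2) `^ (s - (ell s)%:R))%:E
                 | xy in [set xy | [/\ U xy.1, U xy.2 & xy.1 != xy.2]]])%E.

Definition holder_ball U (s L : R) : set ('rV[R]_d -> R) :=
  [set g | Ck_on U (ell s) g /\ (holder_norm U s g <= L%:E)%E].

End Holder.

Section iid.
Context {dT : measure_display} {T : measurableType dT} {R : realType}.

Definition cons_pair n (x : T * n.-tuple T) : n.+1.-tuple T :=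
  [the n.+1.-tuple T of x.1 :: x.2].

Lemma measurable_cons_pair n : measurable_fun [set: _] (@cons_pair n).
Proof. exact: measurable_cons. Qed.

HB.instance Definition _ n := isMeasurableFun.Build _ _ _ _ (@cons_pair n)
  (@measurable_cons_pair n).

Fixpoint iid (P : probability T R) n : probability (n.-tuple T) R :=
  match n with
  | 0 => dirac [tuple]
  | n'.+1 => distribution (P \x iid P n')%E (@cons_pair n')
  end.

End iid.

Definition unit_cube (R : realType) d (x : d.-tuple R) : Prop :=
  forall j, 0 <= tnth x j <= 1.

(* measurableTypeR R and R are convertible types whose (identical) Borel
   sigma-algebras are packaged differently. *)
Definition from_measurableTypeR (R : realType) : measurableTypeR R -> R :=
  idfun.

HB.instance Definition _ (R : realType) :=
  @isMeasurableFun.Build _ _ _ _ (@from_measurableTypeR R)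
    (@measurable_id _ _ setT).

(* Lebesgue measure on [0,1]^d, as the d-fold product of the Lebesgue measure
   on [0,1] *)
Definition lebesgue_cube (R : realType) d : probability (d.-tuple R) R :=
  iid (distribution (uniform_prob (@ltr01 R)) (@from_measurableTypeR R)) d.

Definition row_of (R : realType) d (x : d.-tuple R) : 'rV[R]_d :=
  \row_j tnth x j.

(* theta = (p, f, sigma^2, Q).  The functions p, f and the kernel Q are given
   on the whole of R^d, but only their restrictions to the cube matter. *)
Record param (R : realType) (d : nat) := Param {
  dens : {mfun d.-tuple R >-> R};
  reg : {mfun d.-tuple R >-> R};
  nvar : R;
  noise : R.-pker (d.-tuple R) ~> R;
  dens_ge0 : forall x, 0 <= dens x;
  dens_int1 : (\int[lebesgue_cube R d]_x (dens x)%:E = 1)%E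
}.

Section laws.
Context {R : realType} {d : nat}.
Variable th : param R d.
Local Open Scope ereal_scope.

Definition design_law (A : set (d.-tuple R)) : \bar R :=
  \int[lebesgue_cube R d]_(x in A) (dens th x)%:E.

Let mdens : measurable_fun [set: d.-tuple R] (EFin \o dens th).
Proof. exact/measurable_EFinP. Qed.

Let design0 : design_law set0 = 0.
Proof. by rewrite /design_law integral_set0. Qed.

Let design_ge0 A : 0 <= design_law A.
Proof. by apply: integral_ge0 => x _; rewrite lee_fin dens_ge0. Qed.

Let design_sigma_additive : semi_sigma_additive design_law.
Proof.
move=> F mF tF mUF; rewrite /design_law; apply: cvg_toP.
  apply: ereal_nondecreasing_is_cvgn => m n mn.
  by apply: lee_sum_nneg_natr => // k _ _; exact: design_ge0.
rewrite ge0_integral_bigcup//=.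
- exact: measurable_funTS.
- by move=> x _; rewrite lee_fin dens_ge0.
Qed.

HB.instance Definition _ := isMeasure.Build _ _ _ design_law
  design0 design_ge0 design_sigma_additive.

Let design_setT : design_law [set: _] = 1.
Proof. exact: dens_int1. Qed.

HB.instance Definition _ := Measure_isProbability.Build _ _ _ design_law
  design_setT.

(* law of (X, eps), where X ~ p(x) dx and eps | X = x ~ Q_x *)
Definition joint_law (A : set (d.-tuple R * R)) : \bar R :=
  \int[design_law]_x noise th x (xsection A x).

Let mxsec A : measurable A ->
  measurable_fun [set: d.-tuple R] (fun x => noise th x (xsection A x)).
Proof.
by move=> mA; apply: measurable_fun_xsection_finite_kernel; rewrite inE.
Qed.

Let joint0 : joint_law set0 = 0.
Proof.
by rewrite /joint_law integral0_eq// => x _; rewrite xsection0 measure0.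
Qed.

Let joint_ge0 A : 0 <= joint_law A.
Proof. by apply: integral_ge0 => x _; exact: measure_ge0. Qed.

Let joint_sigma_additive : semi_sigma_additive joint_law.
Proof.
move=> F mF tF mUF; rewrite /joint_law.
rewrite [X in _ --> X](_ : _ = \sum_(n <oo) joint_law (F n)); last first.
  rewrite -integral_nneseries//; last by move=> n; exact: mxsec.
  apply: eq_integral => x _.
  rewrite xsection_bigcup measure_semi_bigcup//.
  - by move=> n; exact: measurable_xsection.
  - exact: trivIset_xsection.
  - by rewrite -xsection_bigcup; exact: measurable_xsection.
by apply: is_cvg_nneseries => n _ _; exact: joint_ge0.
Qed.

HB.instance Definition _ := isMeasure.Build _ _ _ joint_law
  joint0 joint_ge0 joint_sigma_additive.

Let joint_setT : joint_law [set: _] = 1.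
Proof.
rewrite /joint_law (eq_integral (cst 1)); last first.
  move=> x _; rewrite -(@prob_kernel _ _ _ _ _ (noise th) x).
  by congr (noise th x _); apply/seteqP; split => y //= _; exact/xsectionP.
by rewrite integral_cst// mul1e; exact: design_setT.
Qed.

HB.instance Definition _ := Measure_isProbability.Build _ _ _ joint_law
  joint_setT.

Definition obs_of (xu : d.-tuple R * R) : d.-tuple R * R :=
  (xu.1, reg th xu.1 + xu.2)%R.

Lemma measurable_obs_of : measurable_fun [set: _] obs_of.
Proof.
apply: measurable_fun_pair => //=.
apply: measurable_funD => //.
exact: (measurableT_comp (f := reg th)).
Qed.

HB.instance Definition _ := isMeasurableFun.Build _ _ _ _ obs_of
  measurable_obs_of.

Definition obs_law : probability (d.-tuple R * R)%type R :=
  distribution joint_law obs_of.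

Definition sample_law n : probability (n.-tuple (d.-tuple R * R)) R :=
  iid obs_law n.

End laws.

Section model_class.
Context {R : realType} {d : nat}.

Definition Theta (U : set 'rV[R]_d) (L plo phi vlo vhi M4 bb bg : R) :
    set (param R d) :=
  [set th |
    [/\ exists2 g, holder_ball U bg L g &
          forall x, unit_cube x -> dens th x = g (row_of x),
        forall x, unit_cube x -> plo <= dens th x <= phi,
        exists2 g, holder_ball U bb L g &
          forall x, unit_cube x -> reg th x = g (row_of x),
        vlo <= nvar th <= vhi &
        {ae design_law th, forall x,
          [/\ (\int[noise th x]_u u%:E = 0)%E,
              (\int[noise th x]_u (u ^+ 2)%:E = (nvar th)%:E)%E &
              (\int[noise th x]_u (u ^+ 4)%:E <= M4%:E)%E]}]].

Definition sample n := n.-tuple (d.-tuple R * R).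

Definition mse n (T : sample n -> R) (th : param R d) : \bar R :=
  (\int[sample_law th n]_z ((T z - nvar th) ^+ 2)%:E)%E.

End model_class.

Section conditioning.
Context {dT : measure_display} {T : measurableType dT} {R : realType}.
Variables (P : probability T R) (G : set (set T)).

(* g is a version of E(h | G) *)
Definition is_condexp (h g : T -> R) : Prop :=
  [/\ P.-integrable [set: T] (EFin \o h),
      P.-integrable [set: T] (EFin \o g),
      forall B : set R, measurable B -> G (g @^-1` B) &
      forall A, G A ->
        (\int[P]_(x in A) (g x)%:E = \int[P]_(x in A) (h x)%:E)%E].

(* v is a version of Var(h | G) *)
Definition is_condvar (h v : T -> R) : Prop :=
  exists2 m, is_condexp h m & is_condexp (fun x => (h x - m x) ^+ 2) v.

End conditioning.

Definition subsample_sigma dT (T : measurableType dT) n (S : {set 'I_n}) :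
    set (set (n.-tuple T)) :=
  <<s \bigcup_(i in [set` S])
        preimage_set_system setT (fun z : n.-tuple T => tnth z i) measurable >>.

(* The sizes are fixed proportions of n up to rounding to an integer. *)
Definition sample_split (R : realType) (train est : forall n, {set 'I_n}) :
    Prop :=
  (forall n i, i \in train n -> i \notin est n) /\
  exists rtrain rest : R, [/\ 0 < rtrain, 0 < rest &
    forall n, `|#|train n|%:R - rtrain * n%:R| < 1 /\
              `|#|est n|%:R - rest * n%:R| < 1].

Section partition.
Context {R : realType}.

(* max {0, round (log_2 (n / lambda0))}, ties being rounded upwards *)
Definition log_cells (lambda0 : R) (n : nat) : nat :=
  absz (Num.max 0 (Num.floor (ln (n%:R / lambda0) / ln 2 + 2^-1))).

(* s n j is the number of times coordinate j is halved at sample size n *)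
Definition balanced_splits d (lambda0 : R) (s : nat -> 'I_d -> nat) : Prop :=
  forall n, (0 < n)%N ->
    (\sum_j s n j)%N = log_cells lambda0 n /\
    forall i j, (s n i <= (s n j).+1)%N.

Context {d : nat}.
Variable s : 'I_d -> nat.

Definition cell := {dffun forall j : 'I_d, 'I_(2 ^ s j)}.

Variable Q : cell.

(* the diagonal of A_Q, and b_Q *)
Definition cell_side (j : 'I_d) : R := (2 ^ s j)%:R^-1.
Definition cell_corner (j : 'I_d) : R := (Q j)%:R * cell_side j.

(* The edges are half-open on the right, the last one in each coordinate being
   closed at 1. *)
Definition in_cell (x : d.-tuple R) : bool :=
  [forall j, (cell_corner j <= tnth x j) &&
    ((tnth x j < cell_corner j + cell_side j) ||
     (((Q j).+1 == 2 ^ s j)%N && (tnth x j == 1)))].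

Definition local_coord (x : d.-tuple R) : 'rV[R]_d :=
  \row_j ((tnth x j - cell_corner j) / cell_side j).

End partition.

Definition num_poly (R : realType) (d : nat) (bb : R) : nat :=
  'C(d + ell bb, ell bb).

(* psi is a basis of the space of d-variate polynomials of total degree <= k;
   msize is the total degree plus one (and 0 for the null polynomial). *)
Definition poly_basis (R : realType) (d k q : nat)
    (psi : 'I_q -> mpoly.mpoly d R) : Prop :=
  (forall i, (mpoly.msize (psi i) <= k.+1)%N) /\
  forall p : mpoly.mpoly d R, (mpoly.msize p <= k.+1)%N ->
    exists! c : 'rV[R]_q, p = \sum_i c 0 i *: psi i.

Definition lambda_min (R : realType) q (A : 'M[R]_q) : R :=
  inf [set a | eigenvalue A a].

Section witness.
Context {R : realType} {d n q : nat}.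
Variables (psi : 'I_q -> mpoly.mpoly d R) (s : 'I_d -> nat).
Variables (kappa v0 eps : R) (z : sample (R := R) (d := d) n).

Section one_cell.
Variable Q : cell s.

Definition cell_idx : {set 'I_n} := finset (fun i => in_cell Q (tnth z i).1).
Notation N := #|cell_idx|.

(* enum_val lists cell_idx in increasing order: r : 'I_N stands for i_r. *)
Definition cell_U (r : 'I_N) : 'rV[R]_d :=
  local_coord Q (tnth z (enum_val r)).1.
Definition cell_Y : 'cV[R]_N := \col_r (tnth z (enum_val r)).2.
Definition cell_Phi : 'M[R]_(N, q) :=
  \matrix_(r, k) mpoly.meval (fun j => cell_U r 0 j) (psi k).
Definition cell_G : 'M[R]_q := cell_Phi^T *m cell_Phi.
Definition cell_P : 'M[R]_N := cell_Phi *m invmx cell_G *m cell_Phi^T.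
Definition cell_R : 'M[R]_N := 1%:M - cell_P.

Definition cell_d (e : 'I_N * 'I_N) : 'cV[R]_N :=
  delta_mx e.1 0 - delta_mx e.2 0.
Definition cell_form (e : 'I_N * 'I_N) : R :=
  ((cell_d e)^T *m cell_R *m cell_d e) 0 0.

Definition well_conditioned : bool :=
  kappa <= lambda_min (N%:R^-1 *: cell_G).

(* The unordered pairs of E_Q(eps) are represented by their ranks (r, r') with
   r < r', and listed in lexicographic order.  The norm of 'rV[R]_d is the sup
   norm. *)
Definition close_pairs : seq ('I_N * 'I_N) :=
  [seq e : 'I_N * 'I_N <- [seq (r, r') | r <- enum 'I_N, r' <- enum 'I_N] |
    [&& (e.1 < e.2)%N, `|cell_U e.1 - cell_U e.2| <= eps
      & v0 <= cell_form e]].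

Definition selected : bool :=
  [&& N == q.+2, well_conditioned & close_pairs != [::]].

Definition cell_weight (e : 'I_N * 'I_N) : 'cV[R]_N :=
  (Num.sqrt (cell_form e))^-1 *: (cell_R *m cell_d e).

Definition cell_term : R :=
  if close_pairs is e :: _ then (((cell_weight e)^T *m cell_Y) 0 0) ^+ 2 else 0.

End one_cell.

Definition selected_cells : {set cell s} := finset selected.

Definition lr_estimator (c0 vlo vhi : R) : R :=
  if c0 * n%:R * eps ^+ d <= #|selected_cells|%:R then
    #|selected_cells|%:R^-1 * \sum_(Q in selected_cells) cell_term Q
  else (vlo + vhi) / 2.

End witness.

Section combined.
Context {R : realType}.

Definition clip (a b x : R) : R := Num.min b (Num.max a x).

Definition beta_star (d : nat) (bb : R) : R :=
  bb * (1 - 4 * bb / d%:R) / (1 + 2 * bb / d%:R + 8 * (bb / d%:R) ^+ 2).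

Definition sharp_estimator (d : nat) (bb bg vlo vhi : R) (T : Type)
    (hoif lr : T -> R) (z : T) : R :=
  if beta_star d bb < bg then clip vlo vhi (hoif z) else lr z.

Definition a_star (d : nat) (bb : R) : R :=
  (d%:R - 4 * bb) / (d%:R * (d%:R + 4)).

(* c and c' are the constants implicit in eps_n = Theta(n^(-a)). *)
Definition asymp_pow (c c' a : R) (eps : nat -> R) : Prop :=
  forall n, (0 < n)%N ->
    0 < eps n /\ c * n%:R `^ (- a) <= eps n <= c' * n%:R `^ (- a).

End combined.

(* Main.v *)
Require Import Defs.
From HB Require Import structures.
From mathcomp Require Import all_boot all_order all_algebra.
From mathcomp Require Import (canonicals, coercions) mpoly.
From mathcomp Require Import all_classical all_reals all_analysis.
From mathcomp Require Import measurable_realfun.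
From mathcomp Require Import ring lra.

Set Implicit Arguments.
Unset Strict Implicit.
Unset Printing Implicit Defensive.

Import Order.TTheory GRing.Theory Num.Theory.
Import numFieldNormedType.Exports.

Local Open Scope classical_set_scope.
Local Open Scope ring_scope.

(** Part (2) follows from part (1) and from elementary facts.  Below the
   threshold the combined estimator is the witness estimator.  Above it,
   clipping to an interval that contains sigma^2 is a contraction
   ([clip_contraction]), and the risk of the given estimator is at most twice
   its mean conditional variance plus twice its mean squared conditional bias
   ([condvar_mse]).

   Part (1) is proved conditionally on the design points.  These determine the
   selected cells and the unit contrasts a_Q; write T for the number of selected
   cells and g_Q for the value of a_Q on the vector of the f(X_i).  Since a_Q
   annihilates the polynomials of degree at most ell, g_Q is the value of the
   contrast on the remainder of a Taylor expansion of f.  This remainder is of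
   order H^beta_b on a cell of side H ([holder_taylor]) and, in local
   coordinates, Lipschitz with a constant of the same order; as a_Q is up to
   normalization the residual of the difference of two points at distance
   eps, g_Q is of order H^beta_b eps ([pweight_bias]).  The error

     T^-1 sum_Q (a_Q^T Y_Q)^2 - sigma^2

   is a quadratic polynomial in the independent noises, and its conditional
   second moment ([noise_int_quad]) is at most
   max g_Q^4 + O(1/T), because contrasts of different cells have disjoint
   supports ([contrast_average_risk]).

   It remains to see that T is at least a constant times n eps^d, outside an
   event of probability O(1 / (n eps^d)).  Fix points of the cube at which a
   polynomial of degree at most ell is determined by its values, stably under
   small perturbations ([unisolvent]).  A cell containing exactly q+2 points, of
   which q are near these and the last two within eps of each other, is selected
   ([goodseq_selected]).  The mean number of such cells is of order n eps^d, and
   the counts in two different cells are so weakly dependent that the variance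
   is of the order of the mean; Chebyshev's inequality concludes
   ([occ_count_small], [occupied_cells]).  With eps of order n^(-a_star) both
   max g_Q^4 and 1 / (n eps^d) are of order n^(-4 (beta_b + 1) / (d + 4))
   ([risk_bound_rate]).

   One point is delicate.  The selection rule depends on the design points
   through eigenvalues and through the choice of a pair, and the integral in
   the risk is that of a nonnegative function whose measurability is not
   established.  Such an integral is the supremum of the integrals of smaller
   measurable functions, and each of these can be integrated over the noise
   first, at fixed design points ([integral_le_lower], [integral_sample_le]). *)


(** * Symmetric matrices and their smallest eigenvalue *)

Lemma le_of_eq disp (T : porderType disp) (x y : T) : x = y -> (x <= y)%O.
Proof. by move=> ->. Qed.

Section linear_algebra.
Context {R : realType}.
Implicit Types q n : nat.

Definition qform q (A : 'M[R]_q) (x y : 'rV[R]_q) : R := (x *m A *m y^T) 0 0.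

Definition sqn q (x : 'rV[R]_q) : R := \sum_i x 0 i ^+ 2.

Lemma sqn_ge0 q (x : 'rV[R]_q) : 0 <= sqn x.
Proof. by apply: sumr_ge0 => i _; exact: sqr_ge0. Qed.

Lemma sqnE q (x : 'rV[R]_q) : sqn x = qform 1%:M x x.
Proof. by rewrite /qform mulmx1 mxE; apply: eq_bigr => i _; rewrite !mxE. Qed.

Lemma sqn_eq0 q (x : 'rV[R]_q) : (sqn x == 0) = (x == 0).
Proof.
apply/eqP/eqP => [h|->]; last by rewrite /sqn big1// => i _; rewrite mxE expr0n.
apply/rowP => i; rewrite mxE; apply/eqP; rewrite -sqrf_eq0; apply/eqP.
by apply/(psumr_eq0P _ h) => // j _; exact: sqr_ge0.
Qed.

Lemma sqn0 q : sqn (0 : 'rV[R]_q) = 0.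
Proof. by apply/eqP; rewrite sqn_eq0. Qed.

Lemma qformE q (A : 'M[R]_q) (x y : 'rV[R]_q) :
  qform A x y = \sum_i \sum_j x 0 i * A i j * y 0 j.
Proof.
rewrite /qform mxE exchange_big/=; apply: eq_bigr => j _.
by rewrite !mxE mulr_suml; apply: eq_bigr => i _.
Qed.

Lemma qformDl q (A : 'M[R]_q) (a : R) x y z :
  qform A (x + a *: y) z = qform A x z + a * qform A y z.
Proof. by rewrite /qform !mulmxDl -!scalemxAl !mxE. Qed.

Lemma qformDr q (A : 'M[R]_q) (a : R) x y z :
  qform A z (x + a *: y) = qform A z x + a * qform A z y.
Proof. by rewrite /qform linearD linearZ/= mulmxDr -scalemxAr !mxE. Qed.

Lemma qformC q (A : 'M[R]_q) x y : A^T = A -> qform A x y = qform A y x.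
Proof.
move=> sA; rewrite !qformE exchange_big; apply: eq_bigr => i _; apply: eq_bigr => j _.
by rewrite -{1}sA mxE; ring.
Qed.

Lemma qformB q (A B : 'M[R]_q) x y : qform (A - B) x y = qform A x y - qform B x y.
Proof. by rewrite /qform mulmxBr mulmxBl !mxE. Qed.

Lemma qform_scalar q (a : R) (x : 'rV[R]_q) : qform a%:M x x = a * sqn x.
Proof. by rewrite sqnE /qform mul_mx_scalar mulmx1 -scalemxAl !mxE. Qed.

(** Cauchy-Schwarz, from the nonnegativity of the discriminant. *)
Lemma qform_CS q (A : 'M[R]_q) x y : A^T = A ->
  (forall x, 0 <= qform A x x) ->
  qform A x y ^+ 2 <= qform A x x * qform A y y.
Proof.
move=> sA pA.
have H t : 0 <= qform A x x + 2 * t * qform A x y + t ^+ 2 * qform A y y.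
  suff -> : qform A x x + 2 * t * qform A x y + t ^+ 2 * qform A y y
            = qform A (x + t *: y) (x + t *: y) by exact: pA.
  by rewrite qformDl !qformDr (qformC y x sA); ring.
have [y0|y0] := eqVneq (qform A y y) 0.
  rewrite y0 mulr0; have [->|b0] := eqVneq (qform A x y) 0; first by rewrite expr0n.
  have := H (- (1 + qform A x x) / (2 * qform A x y)).
  rewrite y0 mulr0 addr0.
  rewrite (_ : 2 * _ * _ = - (1 + qform A x x)); first lra.
  by field.
have yp : 0 < qform A y y by rewrite lt_def y0 pA.
have := H (- qform A x y / qform A y y).
rewrite (_ : _ + _ + _ = (qform A x x * qform A y y - qform A x y ^+ 2) / qform A y y).
  by rewrite pmulr_lge0 ?invr_gt0// subr_ge0.
by field.
Qed.

Lemma CS_sum (I : finType) (a b : I -> R) :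
  (\sum_i a i * b i) ^+ 2 <= (\sum_i a i ^+ 2) * (\sum_i b i ^+ 2).
Proof.
set A := \sum_i a i ^+ 2; set B := \sum_i b i ^+ 2; set C := \sum_i _.
have B0 : 0 <= B by apply: sumr_ge0 => i _; exact: sqr_ge0.
have E : \sum_i (a i * B - b i * C) ^+ 2 = B * (A * B - C ^+ 2).
  rewrite (_ : B * _ = A * B ^+ 2 + C * (- 2 * B * C) + B * C ^+ 2); last ring.
  rewrite /A {2}/C /B 3!mulr_suml -!big_split/=; apply: eq_bigr => i _.
  by rewrite -/B; ring.
have {}E : 0 <= B * (A * B - C ^+ 2).
  by rewrite -E; apply: sumr_ge0 => i _; exact: sqr_ge0.
have [b0|b0] := eqVneq B 0; last first.
  by move: E; rewrite pmulr_rge0 ?subr_ge0// lt_def b0.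
rewrite (_ : C = 0) ?expr0n ?b0 ?mulr0// /C big1// => i _.
have /eqP := (psumr_eq0P (fun i _ => sqr_ge0 (b i)) b0) i isT.
by rewrite sqrf_eq0 => /eqP ->; rewrite mulr0.
Qed.

Lemma sqr_le_norm (x y : R) : 0 <= y -> x ^+ 2 <= y ^+ 2 -> `|x| <= y.
Proof. by move=> y0; rewrite -(real_normK (num_real x)) ler_sqr ?nnegrE. Qed.

Lemma CS_qform1 q (x y : 'rV[R]_q) :
  (\sum_i x 0 i * y 0 i) ^+ 2 <= sqn x * sqn y.
Proof. exact: CS_sum. Qed.

Lemma sqn_mulmx q r (A : 'M[R]_(q, r)) (x : 'rV[R]_q) :
  sqn (x *m A) <= (\sum_i \sum_j A i j ^+ 2) * sqn x.
Proof.
rewrite /sqn exchange_big mulr_suml; apply: ler_sum => j _.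
by rewrite mxE mulrC; exact: CS_sum.
Qed.

(** The infimum [mu] of the Rayleigh quotient is an eigenvalue: otherwise
   [A - mu] would be a positive semidefinite invertible matrix, hence bounded
   below by a positive multiple of the identity. *)
Lemma rayleigh_min q (A : 'M[R]_q) : (0 < q)%N -> A^T = A ->
  exists2 mu, eigenvalue A mu & forall x, mu * sqn x <= qform A x x.
Proof.
move=> q0 sA.
pose S := [set qform A x x / sqn x | x in [set x | x != 0]].
pose K := \sum_i \sum_j A i j ^+ 2.
have K0 : 0 <= K by apply: sumr_ge0 => i _; apply: sumr_ge0 => j _; exact: sqr_ge0.
have sqp (x : 'rV[R]_q) : x != 0 -> 0 < sqn x.
  by move=> x0; rewrite lt_def sqn_eq0 x0 sqn_ge0.
have lbS : has_lbound S.
  exists (- (K + 1)) => _ [x /sqp x0 <-].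
  rewrite ler_pdivlMr//.
  have := CS_qform1 (x *m A) x.
  have -> : \sum_i (x *m A) 0 i * x 0 i = qform A x x.
    by rewrite /qform [RHS]mxE; apply: eq_bigr => i _; rewrite !mxE.
  move=> h; have {}h : qform A x x ^+ 2 <= K * sqn x ^+ 2.
    apply: (le_trans h); rewrite expr2 mulrA ler_pM2r//; exact: sqn_mulmx.
  have : `|qform A x x| <= (K + 1) * sqn x.
    apply: sqr_le_norm; first by rewrite mulr_ge0 ?sqn_ge0// addr_ge0.
    apply: (le_trans h); rewrite exprMn ler_wpM2r ?sqr_ge0//.
    by have := sqr_ge0 K; lra.
  by rewrite ler_norml mulNr => /andP[].
have S0 : S !=set0.
  exists (qform A (const_mx 1) (const_mx 1) / sqn (const_mx 1 : 'rV_q)) => /=.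
  exists (const_mx 1) => //; apply/eqP => /rowP/(_ (Ordinal q0)).
  by rewrite !mxE => /eqP; rewrite oner_eq0.
pose mu := inf S.
have muP x : mu * sqn x <= qform A x x.
  have [->|x0] := eqVneq x 0.
    by rewrite sqn0 mulr0 /qform !mul0mx mxE.
  by rewrite -ler_pdivlMr ?sqp//; apply: (ge_inf lbS); exists x.
exists mu => //.
have sB : (A - mu%:M)^T = A - mu%:M by rewrite linearB/= sA tr_scalar_mx.
have BE x : qform (A - mu%:M) x x = qform A x x - mu * sqn x.
  by rewrite qformB qform_scalar.
have pB x : 0 <= qform (A - mu%:M) x x by rewrite BE subr_ge0.
have [uB|] := boolP (A - mu%:M \in unitmx); last first.
  rewrite -row_free_unit -kermx_eq0 => /rowV0Pn[v vk v0].
  by apply/eigenvalueP; exists v => //; apply/eigenspaceP.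
pose M := \sum_i \sum_j (invmx (A - mu%:M)) i j ^+ 2 + 1.
have M0 : 0 < M.
  rewrite ltr_pwDr// sumr_ge0// => i _; apply: sumr_ge0 => j _; exact: sqr_ge0.
have H x : sqn x <= M * qform (A - mu%:M) x x.
  have [->|x0] := eqVneq x 0.
    by rewrite sqn0 mulr_ge0 ?pB ?(ltW M0).
  pose y := x *m invmx (A - mu%:M).
  have xE : x = y *m (A - mu%:M) by rewrite mulmxKV.
  have yxE : qform (A - mu%:M) y x = sqn x.
    by rewrite sqnE /qform -xE mulmx1.
  have h1 := qform_CS y x sB pB.
  have h2 : qform (A - mu%:M) y y <= M * sqn x.
    have -> : qform (A - mu%:M) y y = \sum_i x 0 i * y 0 i.
      by rewrite /qform -xE mxE; apply: eq_bigr => i _; rewrite !mxE.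
    apply: le_trans (ler_norm _) _; apply: sqr_le_norm.
      by rewrite mulr_ge0 ?sqn_ge0// ltW.
    apply: (le_trans (CS_qform1 _ _)); rewrite mulrC exprMn (expr2 (sqn x)) mulrA.
    rewrite ler_wpM2r ?sqn_ge0//; apply: (le_trans (sqn_mulmx _ _)).
    rewrite ler_wpM2r ?sqn_ge0// /M; set K' := (\sum_i _).
    have : 0 <= K' by rewrite sumr_ge0// => i _; apply: sumr_ge0 => j _; exact: sqr_ge0.
    by move=> k0; have := sqr_ge0 K'; lra.
  rewrite yxE expr2 in h1.
  have := le_trans h1 (ler_wpM2r (pB x) h2).
  rewrite (_ : M * _ * _ = M * qform (A - mu%:M) x x * sqn x); last ring.
  by rewrite ler_pM2r ?sqp.
suff : mu + M^-1 <= mu by rewrite gerDl leNgt invr_gt0 M0.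
apply: lb_le_inf => // _ [x /sqp x0 <-].
rewrite ler_pdivlMr// mulrDl -lerBrDl -BE.
by rewrite mulrC ler_pdivrMr// mulrC.
Qed.

(** By [rayleigh_min] the infimum in [lambda_min] is attained, so a lower bound
   on the spectrum is a lower bound on the quadratic form. *)
Lemma lambda_minP q (A : 'M[R]_q) (k : R) : (0 < q)%N -> A^T = A ->
  (k <= lambda_min A) <-> (forall x, k * sqn x <= qform A x x).
Proof.
move=> q0 sA; have [mu emu muP] := rayleigh_min q0 sA.
have lb : lbound [set a | eigenvalue A a] mu.
  move=> a /eigenvalueP[v vA v0].
  have := muP v; rewrite /qform vA -scalemxAl mxE.
  rewrite (_ : (v *m v^T) 0 0 = sqn v); last by rewrite sqnE /qform mulmx1.
  by rewrite ler_pM2r// lt_def sqn_eq0 v0 sqn_ge0.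
have -> : lambda_min A = mu.
  apply/eqP; rewrite eq_le; apply/andP; split.
    by apply: ge_inf => //; exists mu.
  by apply: lb_le_inf => //; exists mu.
split=> [kmu x|h]; first by apply: le_trans (muP x); rewrite ler_wpM2r ?sqn_ge0.
have /eigenvalueP[v vA v0] := emu.
have := h v; rewrite /qform vA -scalemxAl mxE.
rewrite (_ : (v *m v^T) 0 0 = sqn v); last by rewrite sqnE /qform mulmx1.
by rewrite ler_pM2r// lt_def sqn_eq0 v0 sqn_ge0.
Qed.

End linear_algebra.

(** * Multivariate polynomials as functions on the unit cube *)

Section polynomials.
Context {R : realType} {d : nat}.
Implicit Types (p : mpoly.mpoly d R) (u v : 'rV[R]_d) (i : 'I_d).

Definition peval p u : R := mpoly.meval (fun j => u 0 j) p.

Definition cube u : Prop := forall j, 0 <= u 0 j <= 1.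

(** Properties that pass to sums and products, such as being Lipschitz on the
   cube, need only be checked on the generators of the algebra. *)
Lemma mpoly_elim (P : mpoly.mpoly d R -> Prop) :
  (forall c, P (mpoly.mpolyC d c)) ->
  (forall i, P (mpoly.mpolyX R (mpoly.mnm1 i))) ->
  (forall p q, P p -> P q -> P (p + q)) ->
  (forall p q, P p -> P q -> P (p * q)) -> forall p, P p.
Proof.
move=> PC PX PD PM; elim/mpoly.mpolyind => [|c m p _ _ Pp].
  by have := PC 0; rewrite rmorph0.
apply: (PD) => //; rewrite -mpoly.mul_mpolyC; apply: (PM) => //.
rewrite mpoly.mpolyXE_id; apply: (big_ind P) => [||i _]; [exact: (PC 1)|exact: PM|].
move: (m i) => k; elim: k => [|k IH]; first by rewrite expr0; exact: (PC 1).
by rewrite exprS; exact: PM.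
Qed.

Lemma ler_coord u i : `|u 0 i| <= `|u|.
Proof.
rewrite [leRHS]/Num.norm/= mx_normrE.
exact: (le_bigmax _ (fun ij => `|u ij.1 ij.2|) (0, i)).
Qed.

Lemma norm_rV_le u (e : R) : 0 <= e -> (`|u| <= e) <-> (forall i, `|u 0 i| <= e).
Proof.
move=> e0; split=> [ue i|h]; first exact: le_trans (ler_coord u i) ue.
rewrite [leLHS]/Num.norm/= mx_normrE; apply: bigmax_le => // -[a b] _ /=.
by rewrite (ord1 a).
Qed.

Lemma peval_lipschitz p : exists2 C : R, 0 <= C &
  (forall u, cube u -> `|peval p u| <= C) /\
  (forall u v, cube u -> cube v -> `|peval p u - peval p v| <= C * `|u - v|).
Proof.
elim/mpoly_elim: p => [c|i|p q [C C0 [b l]] [D D0 [b' l']]|p q [C C0 [b l]] [D D0 [b' l']]].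
- exists `|c| => //; split=> [u _|u v _ _]; rewrite /peval !mpoly.mevalC//.
  by rewrite subrr normr0 mulr_ge0.
- exists 1 => //; split=> [u cu|u v _ _]; rewrite /peval !mpoly.mevalXU.
    by have /andP[? ?] := cu i; rewrite ger0_norm.
  by have := ler_coord (u - v) i; rewrite !mxE mul1r.
- exists (C + D); first exact: addr_ge0.
  split=> [u cu|u v cu cv]; rewrite /peval !mpoly.mevalD -!/(peval _ _).
    by apply: le_trans (ler_normD _ _) _; rewrite lerD ?b ?b'.
  rewrite opprD addrACA mulrDl; apply: le_trans (ler_normD _ _) _.
  by rewrite lerD ?l ?l'.
- exists (C * D + C * D); first by rewrite addr_ge0 ?mulr_ge0.
  split=> [u cu|u v cu cv]; rewrite /peval !mpoly.mevalM -!/(peval _ _).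
    rewrite normrM; apply: (le_trans (ler_pM _ _ (b _ cu) (b' _ cu))) => //.
    by rewrite lerDl mulr_ge0.
  rewrite (_ : _ - _ = peval p u * (peval q u - peval q v)
    + (peval p u - peval p v) * peval q v); last ring.
  rewrite [leRHS]mulrDl; apply: le_trans (ler_normD _ _) _; rewrite !normrM lerD//.
    by rewrite -mulrA ler_pM ?b ?l'.
  by rewrite mulrAC ler_pM ?b' ?l.
Qed.

Lemma is_derive_coord u i j :
  is_derive u (delta_mx 0 j : 'rV[R]_d) (fun x : 'rV_d => x 0 i) (i == j)%:R.
Proof.
have E : (fun h : R => h^-1 *: (((fun x : 'rV[R]_d => x 0 i) \o shift u) (h *: delta_mx 0 j)
     - u 0 i)) @ 0^' --> ((i == j)%:R : R).
  apply: (@cvg_trans _ (cst ((i == j)%:R : R) @ (0 : R)^')); last exact: cvg_cst.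
  apply: near_eq_cvg; near=> h.
  have h0 : h != 0 by near: h; exact: nbhs_dnbhs_neq.
  by rewrite /= !mxE eqxx/= addrK /cst/= scalerA mulVf// scale1r.
apply: DeriveDef; first by apply/cvg_ex; exists (i == j)%:R.
by apply: cvg_lim.
Unshelve. all: by end_near. Qed.

Lemma is_derive_peval p u j :
  is_derive u (delta_mx 0 j : 'rV[R]_d) (peval p) (peval (mpoly.mderiv j p) u).
Proof.
elim/mpoly_elim: p => [c|i|p q hp hq|p q hp hq].
- rewrite (_ : peval _ = cst c); last by apply/funext => x; rewrite /peval mpoly.mevalC.
  by rewrite mpoly.mderivC /peval mpoly.meval0; exact: is_derive_cst.
- rewrite (_ : peval _ = fun x : 'rV_d => x 0 i); last first.
    by apply/funext => x; rewrite /peval mpoly.mevalXU.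
  apply: is_derive_eq; first exact: is_derive_coord.
  rewrite mpoly.mderivX mpoly.mnm1E /peval mpoly.mevalZ.
  have [<-|ij] := eqVneq i j; last by rewrite mul0r.
  rewrite (_ : mpoly.mnm_sub _ _ = mpoly.mnm0); last first.
    by apply/mpoly.mnmP => k; rewrite mpoly.mnmBE subnn mpoly.mnm0E.
  by rewrite mpoly.mpolyX0 mpoly.meval1 mulr1.
- rewrite (_ : peval _ = peval p + peval q); last first.
    by apply/funext => x; rewrite /peval mpoly.mevalD.
  apply: is_derive_eq.
  by rewrite mpoly.mderivD /peval mpoly.mevalD.
- rewrite (_ : peval _ = (peval p : _ -> R^o) * peval q); last first.
    by apply/funext => x; rewrite /peval mpoly.mevalM.
  apply: is_derive_eq.
  rewrite mpoly.mderivM /peval mpoly.mevalD !mpoly.mevalM addrC.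
  by rewrite [_ *: _ in X in X + _]mulrC.
Qed.

Lemma is_derive_line (f : 'rV[R]_d -> R) u (v : 'rV[R]_d) (t D : R) :
  is_derive (u + t *: v) v f D -> is_derive t (1 : R) (fun s : R => f (u + s *: v)) D.
Proof.
move=> [df fD].
have E : (fun h : R => h^-1 *: (((fun s : R => f (u + s *: v)) \o shift t) (h *: 1)
     - f (u + t *: v))) =
   (fun h : R => h^-1 *: ((f \o shift (u + t *: v)) (h *: v) - f (u + t *: v))).
  apply/funext => h /=; congr (_ *: (f _ - _)).
  by rewrite [h *: 1]mulr1 scalerDl addrCA.
by apply: DeriveDef; rewrite /derivable /derive E.
Qed.

(** The open cube is used because a derivative sees a whole neighbourhood of the
   point. *)
Lemma peval_eq0_mderiv p i :
  (forall u, (forall j, 0 < u 0 j < 1) -> peval p u = 0) ->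
  (forall u, (forall j, 0 < u 0 j < 1) -> peval (mpoly.mderiv i p) u = 0).
Proof.
move=> h u uI.
have h1 := @is_derive_line _ u (delta_mx 0 i) 0 _ (is_derive_peval p (u + 0 *: delta_mx 0 i) i).
rewrite [in X in is_derive _ _ _ X]scale0r addr0 in h1.
have h2 : is_derive (0 : R) (1 : R) (fun s : R => peval p (u + s *: delta_mx 0 i)) 0.
  apply: (@near_eq_is_derive _ _ _ (cst (0 : R)) _ (0 : R) (1 : R) (0 : R)).
  have /andP[u0 u1] := uI i.
  near=> s; apply/esym/h => j; rewrite !mxE eqxx/=.
  have [->|ji] := eqVneq j i; last by rewrite mulr0 addr0.
  rewrite mulr1; have : `|s| < Num.min (u 0 i) (1 - u 0 i).
    near: s; apply: (@nbhs0_lt _ R^o); by rewrite lt_min u0 subr_gt0.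
  rewrite lt_min !ltr_norml => /andP[/andP[a b] /andP[a' b']].
  by apply/andP; split; lra.
by rewrite -(@derive_val _ _ _ _ _ _ _ h1) (@derive_val _ _ _ _ _ _ _ h2).
Unshelve. all: by end_near. Qed.

(** Every other monomial of [p] has, in some variable, an exponent smaller than
   that of [m], so it is killed. *)
Lemma mderivm_const p (m : mpoly.multinom d) :
  (mpoly.msize p <= (mpoly.mdeg m).+1)%N ->
  mpoly.mderivm m p
  = mpoly.mpolyC d (mpoly.mcoeff m p *+ (\prod_(i < d) (m i) ^_ (m i))).
Proof.
move=> pm; apply/mpoly.mpolyP => m'; rewrite mpoly.mcoeff_mderivm mpoly.mcoeffC.
have [->|m'0] := eqVneq m' mpoly.mnm0; first by rewrite mulr1 mpoly.addm0.
rewrite mulr0 (_ : mpoly.mcoeff _ _ = 0) ?mul0rn//.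
apply/eqP; rewrite mpoly.mcoeff_eq0; apply/negP => /mpoly.msize_mdeg_lt.
move=> /leq_trans/(_ pm).
rewrite mpoly.mdegD ltnS -[leqRHS]addn0 leq_add2l leqn0.
by rewrite mpoly.mdeg_eq0 (negbTE m'0).
Qed.

(** The derivative along its leading exponent turns a nonzero polynomial into
   a nonzero constant. *)
Lemma peval_eq0 p : (forall u, cube u -> peval p u = 0) -> p = 0.
Proof.
move=> h; apply/eqP/negPn/negP => p0.
pose m := mpoly.mlead p.
have H (w : seq 'I_d) u : (forall j, 0 < u 0 j < 1) ->
    peval (foldr (@mpoly.mderiv d R) p w) u = 0.
  elim: w u => [|i w IH] u uI /=; last exact: peval_eq0_mderiv.
  by apply: h => j; have /andP[? ?] := uI j; apply/andP; split; exact: ltW.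
have := H (flatten [seq nseq (m i) i | i <- enum 'I_d]) (const_mx 2^-1).
rewrite -mpoly.mderivm_foldr.
rewrite mderivm_const ?mpoly.mlead_deg//.
rewrite /peval mpoly.mevalC => H2.
have cI j : 0 < (const_mx 2^-1 : 'rV[R]_d) 0 j < 1.
  by rewrite mxE; apply/andP; split; lra.
have /eqP := H2 cI.
rewrite mulrn_eq0 mpoly.mleadc_eq0 (negbTE p0) orbF.
have -> : (\prod_(i < d) (m i) ^_ (m i) == 0)%N = false.
  by apply/negbTE; rewrite -lt0n prodn_gt0// => i; rewrite ffactnn fact_gt0.
by [].
Qed.

(** Since no nonzero polynomial of the span vanishes on the cube, evaluations
   at points of the cube span the dual space: add points one at a time. *)
Lemma unisolvent_exists q k (psi : 'I_q -> mpoly.mpoly d R) : poly_basis k psi ->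
  exists2 w : 'I_q -> 'rV[R]_d, (forall r, cube (w r)) &
    \matrix_(r, j) peval (psi j) (w r) \in unitmx.
Proof.
move=> [psik psiU].
suff H m : (m <= q)%N -> exists2 w : 'I_m -> 'rV[R]_d, (forall r, cube (w r)) &
    row_free (\matrix_(r, j) peval (psi j) (w r)).
  by have [w wc wf] := H q (leqnn _); exists w; rewrite -?row_free_unit.
elim: m => [|m IH] mq.
  by exists (fun=> 0) => [[]|]//; rewrite /row_free -leqn0 rank_leq_row.
have [w wc wf] := IH (ltnW mq).
set M := \matrix_(r, j) _ in wf.
have : cokermx M != 0.
  rewrite -mxrank_eq0 mxrank_coker -lt0n subn_gt0.
  by move: wf; rewrite /row_free => /eqP ->.
move=> K0.
have [jk cj] : exists jk, col jk (cokermx M) != 0.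
  apply: contrapT => h; move/eqP: K0; apply; apply/matrixP => a b.
  have : col b (cokermx M) == 0 by apply/negPn/negP => hb; apply: h; exists b.
  by move=> /eqP/colP/(_ a); rewrite !mxE.
set c := col jk (cokermx M) in cj.
have Mc : M *m c = 0 by rewrite /c colE mulmxA mulmx_coker mul0mx.
clearbody c.
pose p := \sum_j c j 0 *: psi j.
have [u uc pu] : exists2 u, cube u & peval p u != 0.
  apply: contrapT => h; have p0 : p = 0.
    apply: peval_eq0 => u uc; apply/eqP/negPn/negP => pu; apply: h; by exists u.
  have [|c' [_ c'U]] := psiU 0; first by rewrite mpoly.mmeasure0.
  have e1 : c' = c^T.
    apply: c'U; transitivity p; [exact/esym|apply: eq_bigr => j _; by rewrite mxE].
  have e2 : c' = 0 by apply: c'U; rewrite big1// => j _; rewrite mxE scale0r.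
  by move/eqP: cj; apply; rewrite -[c]trmxK -e1 e2 trmx0.
exists (fun r => odflt u (omap w (unlift ord0 r))).
  by move=> r; case: unliftP => [r' _|_] /=.
set M' := \matrix_(r, j) _.
have M'0 j : M' ord0 j = peval (psi j) u by rewrite mxE unlift_none.
have M'S r j : M' (lift ord0 r) j = M r j by rewrite !mxE liftK.
rewrite -kermx_eq0; apply/rowV0P => v /sub_kermxP v_M.
have vE j : v 0 ord0 * peval (psi j) u + \sum_r v 0 (lift ord0 r) * M r j = 0.
  have := congr1 (fun A : 'rV[R]_q => A 0 j) v_M; rewrite 2!mxE big_ord_recl M'0 => h.
  by rewrite -[RHS]h; congr (_ + _); apply: eq_bigr => r _; rewrite M'S.
have v0 : v 0 ord0 = 0.
  have : v 0 ord0 * peval p u = 0.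
    rewrite /peval /p raddf_sum mulr_sumr/=.
    have S0 : \sum_j (v 0 ord0 * peval (psi j) u
        + \sum_r v 0 (lift ord0 r) * M r j) * c j 0 = 0.
      by rewrite big1// => j _; rewrite vE mul0r.
    rewrite -[RHS]S0; under [RHS]eq_bigr do rewrite mulrDl.
    rewrite big_split/= [X in _ + X](_ : _ = 0) ?addr0.
      by apply: eq_bigr => j _; rewrite mpoly.mevalZ mulrA mulrAC.
    under eq_bigr do rewrite mulr_suml.
    rewrite exchange_big big1// => r _.
    have := congr1 (fun A : 'cV[R]_m => A r 0) Mc; rewrite !mxE => h.
    under eq_bigr do rewrite -mulrA.
    by rewrite -mulr_sumr h mulr0.
  by move/eqP; rewrite mulf_eq0 (negbTE pu) orbF => /eqP.
have v'0 : \row_r v 0 (lift ord0 r) = 0.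
  apply: (row_free_inj wf); rewrite mul0mx; apply/rowP => j.
  rewrite !mxE -[RHS](vE j) v0 mul0r add0r.
  by apply: eq_bigr => r _; rewrite mxE.
apply/rowP => r; rewrite !mxE; case: (unliftP ord0 r) => [r' ->|->//].
by have /rowP/(_ r') := v'0; rewrite !mxE.
Qed.

(** By continuity, points near unisolvent ones are still unisolvent, with a
   uniform constant. *)
Lemma unisolvent q k (psi : 'I_q -> mpoly.mpoly d R) : poly_basis k psi ->
  exists w : 'I_q -> 'rV[R]_d, exists delta kap : R,
  [/\ (forall r, cube (w r)), 0 < delta <= 2^-1, 0 < kap &
   forall w', (forall r, cube (w' r)) -> (forall r, `|w' r - w r| <= delta) ->
   forall c : 'rV[R]_q,
     kap * sqn c <= \sum_r (\sum_j c 0 j * peval (psi j) (w' r)) ^+ 2].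
Proof.
move=> /unisolvent_exists[w wc uM].
set M := \matrix_(r, j) _ in uM.
have /choice[C CP] : forall j, exists C : R, 0 <= C /\
    forall u v, cube u -> cube v -> `|peval (psi j) u - peval (psi j) v| <= C * `|u - v|.
  by move=> j; have [C C0 [_ h]] := peval_lipschitz (psi j); exists C.
pose K := \sum_i \sum_j (invmx M^T) i j ^+ 2 + 1.
have K0 : 0 < K.
  rewrite ltr_pwDr// sumr_ge0// => i _; apply: sumr_ge0 => j _; exact: sqr_ge0.
pose S := \sum_j C j ^+ 2.
have S0 : 0 <= S by apply: sumr_ge0 => j _; exact: sqr_ge0.
(* M c = (M' c) + ((M - M') c), and the last term is at most half of M c. *)
pose delta := Num.min 2^-1 (4 * K * q%:R * S + 1)^-1.
have A0 : 0 <= 4 * K * q%:R * S by rewrite !mulr_ge0// ltW.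
have delta0 : 0 < delta.
  by rewrite lt_min invr_gt0 ltr0n/= invr_gt0 ltr_wpDl.
have delta1 : 4 * K * q%:R * S * delta ^+ 2 <= 1.
  have d1 : delta <= 1 by rewrite ge_min; apply/orP; left; lra.
  have d2 : delta <= (4 * K * q%:R * S + 1)^-1 by rewrite ge_min lexx orbT.
  have d3 : (4 * K * q%:R * S + 1) * delta <= 1.
    by rewrite -ler_pdivlMl ?ltr_wpDl// mulr1.
  have : delta ^+ 2 <= delta by rewrite expr2 ler_piMr// ltW.
  move=> /(ler_wpM2l A0) h; apply: (le_trans h); apply: le_trans d3.
  by rewrite ler_wpM2r ?(ltW delta0)// [leRHS]addrC lerDr.
exists w, delta, (4 * K)^-1; split => //.
- by rewrite delta0 ge_min lexx.
- by rewrite invr_gt0 mulr_gt0.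
move=> w' w'c w'w c.
pose M' := \matrix_(r, j) peval (psi j) (w' r).
have sE (N : 'M[R]_q) : sqn (c *m N^T) = \sum_r (\sum_j c 0 j * N r j) ^+ 2.
  by apply: eq_bigr => r _; rewrite mxE; congr (_ ^+ 2); apply: eq_bigr => j _; rewrite mxE.
have -> : \sum_r (\sum_j c 0 j * peval (psi j) (w' r)) ^+ 2 = sqn (c *m M'^T).
  by rewrite sE; apply: eq_bigr => r _; congr (_ ^+ 2); apply: eq_bigr => j _; rewrite mxE.
have h1 : sqn c <= K * sqn (c *m M^T).
  have e : c = c *m M^T *m invmx M^T by rewrite mulmxK// unitmx_tr.
  rewrite [in leLHS]e.
  by apply: (le_trans (sqn_mulmx _ _)); rewrite ler_wpM2r ?sqn_ge0// /K lerDl.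
have h2 : sqn (c *m (M - M')^T) <= q%:R * S * delta ^+ 2 * sqn c.
  rewrite sE; apply: (@le_trans _ _ (\sum_(r < q) S * delta ^+ 2 * sqn c)).
    apply: ler_sum => r _; rewrite mulrC.
    apply: (le_trans (CS_sum _ _)); rewrite ler_wpM2l ?sqn_ge0//.
    rewrite /S mulr_suml; apply: ler_sum => j _; rewrite !mxE.
    have [Cj0 Cj] := CP j.
    rewrite -exprMn -(real_normK (num_real (_ - _))) ler_sqr ?nnegrE ?mulr_ge0 ?(ltW delta0)//.
    rewrite distrC; apply: (le_trans (Cj _ _ _ _)) => //.
    by rewrite ler_wpM2l.
  by rewrite sumr_const card_ord -[leLHS]mulr_natl !mulrA.
have h3 : sqn (c *m M^T) <= 2 * sqn (c *m M'^T) + 2 * sqn (c *m (M - M')^T).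
  rewrite -[in leLHS](subrK M' M) linearD/= mulmxDr /sqn !mulr_sumr -big_split/=.
  apply: ler_sum => r _; rewrite mxE.
  set x := _ 0 r; set y := _ 0 r.
  by have := sqr_ge0 (x - y); lra.
rewrite ler_pdivrMl ?mulr_gt0//.
set e := q%:R * S * delta ^+ 2 in h2.
have de : 4 * K * e <= 1.
  by rewrite (_ : 4 * K * e = 4 * K * q%:R * S * delta ^+ 2)// /e; ring.
have hA := ler_wpM2l (ltW K0) h3.
have hD := ler_wpM2l (ltW K0) h2.
have hd := ler_wpM2r (sqn_ge0 c) de.
by clearbody e; lra.
Qed.

End polynomials.

(** * Taylor polynomials of Hoelder functions *)

Section taylor.
Context {R : realType} {d : nat}.
Implicit Types (f g h : 'rV[R]_d -> R) (U : set 'rV[R]_d) (x y : 'rV[R]_d).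
Local Notation e_ i := (delta_mx 0 i : 'rV[R]_d).

Lemma line_MVT f x (v : 'rV[R]_d) (a b : R) : a <= b ->
  (forall t, a <= t <= b -> derivable f (x + t *: v) v) ->
  exists2 c, a <= c <= b & f (x + b *: v) - f (x + a *: v) = 'D_v f (x + c *: v) * (b - a).
Proof.
move=> ab df.
have D t : t \in `[a, b] -> is_derive t (1 : R) (fun t : R => f (x + t *: v)) ('D_v f (x + t *: v)).
  by rewrite in_itv/= => /df /derivableP h; exact: (@is_derive_line R d f x v t _ h).
have D' t : t \in `]a, b[ -> is_derive t (1 : R) (fun t : R => f (x + t *: v)) ('D_v f (x + t *: v)).
  by move=> tab; apply: D; exact: subset_itv_oo_cc.
have cf : {within `[a, b], continuous (fun t : R => f (x + t *: v))}.
  apply: derivable_within_continuous => t tab.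
  exact: (@ex_derive _ _ _ _ _ _ _ (D t tab)).
have [c cab E] := MVT_segment ab D' cf.
by exists c => //; move: cab; rewrite in_itv.
Qed.

Lemma is_derive_shift f (a x v : 'rV[R]_d) (D : R) :
  is_derive (x - a) v f D -> is_derive x v (fun y => f (y - a)) D.
Proof.
move=> [df fD].
have E : (fun h : R => h^-1 *: (((fun y => f (y - a)) \o shift x) (h *: v) - f (x - a))) =
   (fun h : R => h^-1 *: ((f \o shift (x - a)) (h *: v) - f (x - a))).
  by apply/funext => h /=; rewrite addrA.
by apply: DeriveDef; rewrite /derivable /derive E.
Qed.

Lemma open_derive_eq U f g x (v : 'rV[R]_d) : open U -> U x ->
  (forall y, U y -> f y = g y) -> 'D_v f x = 'D_v g x.
Proof.
move=> oU Ux fg; apply: near_eq_derive.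
by apply: filterS fg _; exact: open_nbhs_nbhs.
Qed.

(** The mean value theorem along [v], applied to the increment of [f] along [w],
   then along [w], applied to [fv]. *)
Lemma second_difference U f fv fvw x v w (s : R) : 0 <= s ->
  (forall a b, 0 <= a <= s -> 0 <= b <= s -> U (x + a *: v + b *: w)) ->
  (forall y, U y -> is_derive y v f (fv y)) ->
  (forall y, U y -> is_derive y w fv (fvw y)) ->
  exists a b, [/\ 0 <= a <= s, 0 <= b <= s &
   f (x + s *: v + s *: w) - f (x + s *: v) - f (x + s *: w) + f x
   = fvw (x + a *: v + b *: w) * s ^+ 2].
Proof.
move=> s0 US df ddf.
have s_s : 0 <= s <= s by rewrite s0 lexx.
have z_s : 0 <= (0 : R) <= s by rewrite s0 lexx.
pose ph y := f (y + s *: w) - f y.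
have dph t : 0 <= t <= s -> is_derive (x + t *: v) v ph
    (fv (x + t *: v + s *: w) - fv (x + t *: v)).
  move=> ts; apply: is_deriveB.
    rewrite (_ : (fun y => _) = (fun y => f (y - (- (s *: w))))); last first.
      by apply/funext => y; rewrite opprK.
    apply: is_derive_shift; rewrite opprK.
    by apply: df; exact: US.
  by apply: df; rewrite -[X in U X]addr0 -(scale0r w); exact: US.
have [a as_] := line_MVT s0 (fun t ts => @ex_derive _ _ _ _ _ _ _ (dph t ts)).
rewrite (@derive_val _ _ _ _ _ _ _ (dph a as_)) scale0r addr0 subr0 /ph => E1.
have [b bs] := line_MVT s0 (fun t ts =>
  @ex_derive _ _ _ _ _ _ _ (ddf _ (US a t as_ ts))).
rewrite (@derive_val _ _ _ _ _ _ _ (ddf _ (US a b as_ bs))).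
rewrite scale0r addr0 subr0 => E2.
exists a, b; split => //.
by rewrite expr2 mulrA -E2 -E1 opprB addrA addrAC.
Qed.

Lemma continuous_eq_nearby (F G : 'rV[R]_d -> R) x (r0 : R) : 0 < r0 ->
  {for x, continuous F} -> {for x, continuous G} ->
  (forall r : R, 0 < r <= r0 -> exists y z, [/\ ball x r y, ball x r z & F y = G z]) ->
  F x = G x.
Proof.
move=> r00 cF cG H; apply/eqP; rewrite -subr_eq0 -normr_le0.
apply/ler_addgt0Pl => e e0; rewrite addr0.
have e2 : 0 < e / 2 by rewrite divr_gt0.
have /cvgr_dist_lt/(_ _ e2)/nbhs_ballP[r r_gt0 xr] := cF.
have /cvgr_dist_lt/(_ _ e2)/nbhs_ballP[r' r'_gt0 xr'] := cG.
have [|y [z [By Bz E]]] := H (Num.min r0 (Num.min r r')).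
  by rewrite !lt_min r00 r_gt0 r'_gt0 ge_min lexx.
have ly : Num.min r0 (Num.min r r') <= r by rewrite !ge_min lexx ?orbT.
have lz : Num.min r0 (Num.min r r') <= r' by rewrite !ge_min lexx ?orbT.
have /= := xr y (le_ball ly By); have /= := xr' z (le_ball lz Bz).
rewrite E !ltr_norml => /andP[? ?] /andP[? ?].
by rewrite ler_norml; apply/andP; split; lra.
Qed.

(** Symmetry of second derivatives: the second difference is symmetric in [v]
   and [w], and both mixed derivatives are its limit after rescaling. *)
Lemma schwarz U f fv fw fvw fwv x i j : open U -> U x ->
  (forall y, U y -> is_derive y (e_ i) f (fv y)) ->
  (forall y, U y -> is_derive y (e_ j) fv (fvw y)) ->
  (forall y, U y -> is_derive y (e_ j) f (fw y)) ->
  (forall y, U y -> is_derive y (e_ i) fw (fwv y)) ->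
  {for x, continuous fvw} -> {for x, continuous fwv} ->
  fvw x = fwv x.
Proof.
move=> oU Ux dv dvw dw dwv cvw cwv.
have /nbhs_ballP[r0 r00 xr] : nbhs x U by exact: open_nbhs_nbhs.
apply: (@continuous_eq_nearby _ _ x r0 r00 cvw cwv).
move=> r /andP[r_gt0 rr0].
have {}xr y : ball x r y -> U y by move=> /(le_ball rr0) /xr.
pose s := r / 4.
have s0 : 0 < s by rewrite divr_gt0.
have B k l a b : 0 <= a <= s -> 0 <= b <= s -> ball x r (x + a *: e_ k + b *: e_ l).
  move=> ha hb.
  rewrite -ball_normE /ball_/= opprD addrA opprD addrA subrr sub0r.
  rewrite -opprD normrN; apply: (@le_lt_trans _ _ (r / 2)); last first.
    by rewrite ltr_pdivrMr// mulr_natr mulr2n ltrDl.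
  apply/norm_rV_le; first by rewrite ltW// divr_gt0.
  move=> m; rewrite !mxE eqxx/=; apply: le_trans (ler_normD _ _) _.
  have F (c : R) (t : bool) : 0 <= c <= s -> `|c * t%:R| <= s.
    move=> /andP[c0 cs]; rewrite ger0_norm ?mulr_ge0//.
    by case: t; rewrite ?mulr1 ?mulr0 ?(ltW s0).
  have -> : r / 2 = s + s by rewrite /s; lra.
  by rewrite lerD ?F.
have xB k l a b ha hb := xr _ (B k l a b ha hb).
have [a [b [ha hb E1]]] := second_difference (ltW s0) (xB i j) dv dvw.
have [a' [b' [ha' hb' E2]]] := second_difference (ltW s0) (xB j i) dw dwv.
exists (x + a *: e_ i + b *: e_ j), (x + a' *: e_ j + b' *: e_ i); split; [exact: B|exact: B|].
apply: (mulIf (x := s ^+ 2)); first by rewrite expf_neq0 ?gt_eqF.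
rewrite -E1 -E2 [x + s *: e_ j + _]addrAC; congr (_ + _); exact: addrAC.
Qed.

Section ck.
Variables (U : set 'rV[R]_d) (k : nat) (g : 'rV[R]_d -> R).
Hypotheses (oU : open U) (gk : Ck_on U k g).

Lemma wpartial_swap w i j x : ((size w).+2 <= k)%N -> U x ->
  wpartial [:: i, j & w] g x = wpartial [:: j, i & w] g x.
Proof.
move=> wk Ux.
have D v l y : (size v < k)%N -> U y ->
    is_derive y (e_ l) (wpartial v g) (wpartial (l :: v) g y).
  by move=> vk Uy; apply: derivableP; have [_] := gk (ltnW vk); exact.
apply: (@schwarz U (wpartial w g) (wpartial (j :: w) g) (wpartial (i :: w) g) _ _ x j i oU Ux).
- by move=> y; apply: D; exact: ltnW.
- by move=> y; exact: D.
- by move=> y; apply: D; exact: ltnW.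
- by move=> y; exact: D.
- by have [C _] := gk (w := [:: i, j & w]) wk; exact: C.
- by have [C _] := gk (w := [:: j, i & w]) wk; exact: C.
Qed.

Lemma wpartial_move w1 w2 i x : ((size w1 + size w2).+1 <= k)%N -> U x ->
  wpartial (i :: w1 ++ w2) g x = wpartial (w1 ++ i :: w2) g x.
Proof.
elim: w1 x => [//|j w1 IH] x wk Ux.
rewrite !cat_cons wpartial_swap ?size_cat//.
change ('D_(e_ j) (wpartial (i :: w1 ++ w2) g) x = 'D_(e_ j) (wpartial (w1 ++ i :: w2) g) x).
apply: (@open_derive_eq U) => // y Uy.
by apply: (IH y) => //; exact: ltnW.
Qed.

Definition mword (mu : mpoly.multinom d) : seq 'I_d :=
  flatten [seq nseq (mu i) i | i <- enum 'I_d].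

Lemma size_mword mu : size (mword mu) = mpoly.mdeg mu.
Proof.
rewrite /mword size_flatten /shape -map_comp mpoly.mdegE sumnE big_map.
by rewrite -big_enum; apply: eq_bigr => i _; rewrite /= size_nseq.
Qed.

(** [mpartial] lists the variables in increasing order, so that one more
   derivative has to be inserted in the middle of the word. *)
Lemma mword_add mu i : exists w1 w2, mword mu = w1 ++ w2 /\
  mword (mpoly.mnm_add mu (mpoly.mnm1 i)) = w1 ++ i :: w2.
Proof.
have := enum_uniq 'I_d; have := mem_enum 'I_d i; rewrite /mword inE.
move: (enum 'I_d) => s si.
case/splitPr: si => s1 s2; rewrite cat_uniq /= negb_or => /and4P[_ /andP[i1 _] i2 _].
exists (flatten [seq nseq (mu j) j | j <- s1]).
exists (nseq (mu i) i ++ flatten [seq nseq (mu j) j | j <- s2]).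
have E s' : i \notin s' ->
  [seq nseq (mpoly.mnm_add mu (mpoly.mnm1 i) j) j | j <- s'] = [seq nseq (mu j) j | j <- s'].
  move=> is'; apply/eq_in_map => j js'; rewrite mpoly.mnmDE mpoly.mnm1E.
  by have [ij|ij] := eqVneq i j; rewrite ?addn0//; rewrite -ij (negbTE is') in js'.
by rewrite !map_cat !flatten_cat /= !E// mpoly.mnmDE mpoly.mnm1E eqxx addn1.
Qed.

Lemma mpartial_derive (mu : mpoly.multinom d) i x :
  (mpoly.mdeg mu < k)%N -> U x ->
  is_derive x (e_ i) (mpartial mu g) (mpartial (mpoly.mnm_add mu (mpoly.mnm1 i)) g x).
Proof.
move=> muk Ux.
have [w1 [w2 [E1 E2]]] := mword_add mu i.
have sz : ((size w1 + size w2) < k)%N by rewrite -size_cat -E1 size_mword.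
rewrite /mpartial -!/(mword _) E1 E2 -wpartial_move//.
have szk : (size (w1 ++ w2) < k)%N by rewrite size_cat.
by apply: derivableP; have [_] := gk (ltnW szk); exact.
Qed.

End ck.

(** Move from [y] to [x] one coordinate at a time, inside the box. *)
Lemma box_lipschitz (K : set 'rV[R]_d) f (f' : 'I_d -> 'rV[R]_d -> R) (a b : 'I_d -> R) (M : R) :
  (forall x, K x <-> forall j, a j <= x 0 j <= b j) ->
  (forall x j, K x -> is_derive x (e_ j) f (f' j x)) ->
  (forall x j, K x -> `|f' j x| <= M) ->
  forall x y, K x -> K y -> `|f x - f y| <= M * \sum_j `|x 0 j - y 0 j|.
Proof.
move=> KE df f'M x y Kx Ky.
have step z j t : K z -> K (z + t *: e_ j) ->
    `|f (z + t *: e_ j) - f z| <= M * `|t|.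
  wlog t0 : z t / 0 <= t => [hw|].
    have [t0|/ltW t0] := leP 0 t; first exact: hw.
    move=> Kz Kz'; have := hw (z + t *: e_ j) (- t).
    rewrite -addrA -scalerDl subrr scale0r addr0 oppr_ge0 normrN distrC.
    by apply.
  move=> /KE Kz /KE Kz'.
  have Kc c : 0 <= c <= t -> K (z + c *: e_ j).
    move=> /andP[c0 ct]; apply/KE => m; have := Kz m; have := Kz' m; rewrite !mxE eqxx/=.
    have [->|] := eqVneq m j; rewrite ?mulr0 ?addr0// !mulr1 => /andP[? ?] /andP[? ?].
    by apply/andP; split; lra.
  have [c ct] := line_MVT t0 (fun c ct => @ex_derive _ _ _ _ _ _ _ (df _ j (Kc c ct))).
  rewrite (@derive_val _ _ _ _ _ _ _ (df _ j (Kc c ct))) scale0r addr0 subr0 => ->.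
  by rewrite normrM ler_wpM2r// f'M//; exact: Kc.
pose z m : 'rV[R]_d := \row_j (if (j < m)%N then x 0 j else y 0 j).
have Kz m : K (z m).
  apply/KE => j; rewrite mxE.
  by move/KE: Kx => /(_ j); move/KE: Ky => /(_ j); case: ifP.
have H m : (m <= d)%N ->
    `|f (z m) - f y| <= M * \sum_(j < d | (j < m)%N) `|x 0 j - y 0 j|.
  elim: m => [_|m IH md].
    rewrite big1 // mulr0 (_ : z 0%N = y) ?subrr ?normr0//.
    by apply/rowP => j; rewrite mxE.
  have -> : f (z m.+1) - f y = (f (z m.+1) - f (z m)) + (f (z m) - f y).
    by rewrite addrA subrK.
  apply: le_trans (ler_normD _ _) _.
  rewrite (bigD1 (Ordinal md)) ?ltnSn//= mulrDr lerD//; last first.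
    apply: (le_trans (IH (ltnW md))); apply: le_of_eq.
    congr (_ * _); apply: eq_bigl => j; rewrite ltnS -(inj_eq val_inj)/=.
    by rewrite ltn_neqAle andbC.
  have zE : z m.+1 = z m + (x 0 (Ordinal md) - y 0 (Ordinal md)) *: e_ (Ordinal md).
    apply/rowP => j; rewrite !mxE eqxx/= ltnS leq_eqVlt.
    have [jm|jm] := eqVneq j (Ordinal md); last first.
      rewrite mulr0 addr0 (_ : (val j == m) = false)//.
      by apply: contra_neqF jm => /eqP jm; apply: val_inj.
    by rewrite jm /= eqxx ltnn mulr1 addrC subrK.
  rewrite zE; apply: step => //; rewrite -zE; exact: Kz.
have := H d (leqnn _); rewrite (_ : z d = x).
  by rewrite (eq_bigl predT)// => j; rewrite ltn_ord.
by apply/rowP => j; rewrite mxE ltn_ord.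
Qed.

Lemma peval0_mcoeff (p : mpoly.mpoly d R) : peval p 0 = mpoly.mcoeff mpoly.mnm0 p.
Proof.
rewrite /peval; elim/(@mpoly_elim R d): p => [c|i|p q hp hq|p q hp hq].
- by rewrite mpoly.mevalC mpoly.mcoeffC eqxx mulr1.
- rewrite mpoly.mevalXU mxE mpoly.mcoeffX.
  suff -> : (mpoly.mnm1 i == mpoly.mnm0) = false by [].
  by rewrite -mpoly.mdeg_eq0 mpoly.mdeg1.
- by rewrite mpoly.mevalD mpoly.mcoeffD hp hq.
- by rewrite mpoly.mevalM hp hq rmorphM.
Qed.

Definition mpoly_of k (c : mpoly.multinom d -> R) : mpoly.mpoly d R :=
  \sum_(m : mpoly.bmultinom d k.+1) c m *: mpoly.mpolyX R m.

Lemma msize_mpoly_of k c : (mpoly.msize (mpoly_of k c) <= k.+1)%N.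
Proof.
apply: (leq_trans (mpoly.mmeasure_sum _ _ _ _)); apply/bigmax_leqP => m _.
apply: (leq_trans (mpoly.mmeasureZ_le _ _ _)); rewrite mpoly.msizeX.
exact: mpoly.bmdeg.
Qed.

Lemma ell_bounds (s : R) : 1 < s ->
  (0 < ell s)%N /\ 0 < s - (ell s)%:R <= 1.
Proof.
move=> s1.
have c2 : (2 <= Num.ceil s :> int)%R.
  by rewrite -[2]/(1 + 1)%R lezD1 ceil_gt_int.
have E : (ell s)%:Z = Num.ceil s - 1 by rewrite /ell gez0_abs//; lra.
have E' : (ell s)%:R = (Num.ceil s)%:~R - 1 :> R.
  by rewrite -[LHS]/((ell s)%:Z%:~R) E intrD.
split; first by rewrite -ltz_nat E; lra.
have := Num.Theory.ceil_itv s; rewrite E' => /andP[].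
by rewrite intrD => a b; apply/andP; split; lra.
Qed.

Lemma mpartial0 g : mpartial mpoly.mnm0 g = g.
Proof.
rewrite /mpartial -/(mword _) (_ : mword _ = [::])//; apply/nilP.
by rewrite /nilp size_mword mpoly.mdeg0.
Qed.

Lemma enorm_le (x : 'rV[R]_d) (H : R) : 0 <= H -> (forall j, `|x 0 j| <= H) ->
  enorm x <= d%:R * H.
Proof.
move=> H0 xH; rewrite /enorm -[leRHS]ger0_norm ?mulr_ge0// -sqrtr_sqr ler_wsqrtr//.
apply: (@le_trans _ _ (\sum_(j < d) H ^+ 2)).
  by apply: ler_sum => j _; rewrite -(real_normK (num_real _)) ler_sqr ?nnegrE.
rewrite sumr_const card_ord exprMn -[leLHS]mulr_natl ler_wpM2r ?sqr_ge0//.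
rewrite -natrX ler_nat; case: (d) => // n.
by rewrite expnS leq_pmulr// expn_gt0.
Qed.

Lemma holder_top U (s L : R) g : (0 < d)%N -> 0 <= L ->
  (forall x, cube x -> U x) -> holder_ball U s L g ->
  forall mu : mpoly.multinom d, mpoly.mdeg mu = ell s -> forall x y, U x -> U y ->
    `|mpartial mu g x - mpartial mu g y| <= L * enorm (x - y) `^ (s - (ell s)%:R).
Proof.
move=> d0 L0 cU [_ gL] mu muE x y Ux Uy.
have [->|xy] := eqVneq x y.
  by rewrite subrr normr0 mulr_ge0// powR_ge0.
(* U is not empty, so the first summand of the norm is not -oo *)
have U0 : U 0 by apply: cU => j; rewrite mxE lexx ler01.
have mul : (mpoly.mdeg mu < (ell s).+1)%N by rewrite muE.
pose nu : mpoly.bmultinom d (ell s).+1 := mpoly.BMultinom mul.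
have exy : 0 < enorm (x - y) `^ (s - (ell s)%:R).
  rewrite powR_gt0// lt_def sqrtr_ge0 andbT sqrtr_eq0 -ltNge.
  have : sqn (x - y) != 0 by rewrite sqn_eq0 subr_eq0.
  by rewrite lt_def => ->; exact: sqn_ge0.
rewrite -ler_pdivrMr// -lee_fin; apply: le_trans gL.
rewrite /holder_norm; set S := (\sum_(_ : _) _)%E.
have S0 : (0 <= S)%E.
  apply: sume_ge0 => m _; apply: ereal_sup_ge.
  by exists `|mpartial m g 0|%:E; [exists 0|rewrite lee_fin].
apply: le_trans (leeDr _ S0) => //; rewrite /= .
apply: (@le_trans _ _ (ereal_sup [set (`|mpartial nu g xy.1 - mpartial nu g xy.2|
                       / enorm (xy.1 - xy.2) `^ (s - (ell s)%:R))%:E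
                 | xy in [set xy | [/\ U xy.1, U xy.2 & xy.1 != xy.2]]])).
  by apply: ereal_sup_ubound; exists (x, y).
by apply: (bigmax_sup nu); rewrite /= ?muE.
Qed.

(** The remainder and its derivatives up to order [ell s] vanish at [x0], so
   bounds propagate from the top derivatives down: each order gains a factor
   [H].  The Lipschitz bound in the variable [u] is [H] times the bound on the
   gradient. *)
Lemma holder_taylor U (s L : R) g (x0 h : 'rV[R]_d) (H : R) :
  (0 < d)%N -> 1 < s -> 0 <= L -> open U -> (forall x, cube x -> U x) ->
  holder_ball U s L g -> 0 < H -> (forall j, 0 < h 0 j <= H) ->
  (forall u : 'rV[R]_d, cube u -> cube (\row_j (x0 0 j + h 0 j * u 0 j))) ->
  exists2 p : mpoly.mpoly d R, (mpoly.msize p <= (ell s).+1)%N &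
   let rho (u : 'rV[R]_d) := g (\row_j (x0 0 j + h 0 j * u 0 j)) - peval p u in
   let C := L * d%:R ^+ (ell s).+1 * H `^ s in
   (forall u, cube u -> `|rho u| <= C) /\
   (forall u v, cube u -> cube v -> `|rho u - rho v| <= C * `|u - v|).
Proof.
move=> d0 s1 L0 oU cU gb H0 hH hc; set k := ell s.
have [k0 /andP[al0 al1]] := ell_bounds s1; rewrite -/k in k0 al0 al1.
have top := holder_top d0 L0 cU gb.
have [gk _] := gb.
pose K : set 'rV[R]_d := [set x | forall j, x0 0 j <= x 0 j <= x0 0 j + h 0 j].
have KE u : cube u -> K (\row_j (x0 0 j + h 0 j * u 0 j)).
  move=> cu j; rewrite mxE; have /andP[u0 u1] := cu j; have /andP[h0 _] := hH j.
  by rewrite lerDl mulr_ge0 ?(ltW h0)//= lerD2l ler_piMr// ltW.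
have UK x : K x -> U x.
  move=> Kx; apply: cU.
  have -> : x = \row_j (x0 0 j + h 0 j * ((\row_i ((x 0 i - x0 0 i) / h 0 i)) 0 j)).
    apply/rowP => j; rewrite !mxE mulrC divfK ?gt_eqF//; last by have /andP[] := hH j.
    by rewrite addrC subrK.
  apply: hc => j; rewrite mxE; have /andP[h0 _] := hH j; have /andP[? ?] := Kx j.
  by rewrite divr_ge0 ?(ltW h0) ?subr_ge0//= ler_pdivrMr// mul1r lerBlDl.
have Kx0 : K x0 by move=> j; rewrite lexx lerDl ltW//; have /andP[] := hH j.
(* the Taylor polynomial at x0, in the variable x - x0; k ^_ k is k! *)
pose c (mu : mpoly.multinom d) := mpartial mu g x0 / (\prod_(i < d) (mu i) ^_ (mu i))%:R.
pose p := mpoly_of k c.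
pose rho (mu : mpoly.multinom d) x := mpartial mu g x - peval (mpoly.mderivm mu p) (x - x0).
have rhoD (mu : mpoly.multinom d) i x : (mpoly.mdeg mu < k)%N -> K x ->
    is_derive x (e_ i) (rho mu) (rho (mpoly.mnm_add mu (mpoly.mnm1 i)) x).
  move=> muk Kx.
  have D1 := mpartial_derive oU gk i muk (UK _ Kx).
  have D2 : is_derive x (e_ i) (fun y => peval (mpoly.mderivm mu p) (y - x0))
      (peval (mpoly.mderivm (mpoly.mnm_add mu (mpoly.mnm1 i)) p) (x - x0)).
    apply: is_derive_shift; rewrite mpoly.mderivmDm mpoly.mderivmU1m.
    exact: is_derive_peval.
  exact: (is_deriveB D1 D2).
have fact0 (mu : mpoly.multinom d) : (\prod_(i < d) (mu i) ^_ (mu i))%:R != 0 :> R.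
  rewrite pnatr_eq0 -lt0n prodn_gt0// => i; by rewrite ffactnn fact_gt0.
have coefp (mu : mpoly.multinom d) : (mpoly.mdeg mu <= k)%N -> mpoly.mcoeff mu p = c mu.
  by move=> muk; rewrite /p /mpoly_of mpoly.mcoeff_mpoly.
have rho0 (mu : mpoly.multinom d) : (mpoly.mdeg mu <= k)%N -> rho mu x0 = 0.
  move=> muk; rewrite /rho subrr peval0_mcoeff mpoly.mcoeff_mderivm mpoly.addm0 coefp//.
  by rewrite -[X in _ - X]mulr_natr divfK// subrr.
have rhoT (mu : mpoly.multinom d) x : mpoly.mdeg mu = k -> rho mu x = mpartial mu g x - mpartial mu g x0.
  move=> muk; rewrite /rho mderivm_const ?muk ?msize_mpoly_of//.
  by rewrite /peval mpoly.mevalC coefp ?muk// -[X in _ - X = _]mulr_natr divfK.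
pose al := s - k%:R.
have dge1 : 1 <= d%:R :> R by rewrite ler1n.
have Kdist x y j : K x -> K y -> `|x 0 j - y 0 j| <= H.
  move=> /(_ j)/andP[? ?] /(_ j)/andP[? ?]; have /andP[h0 hH'] := hH j.
  by rewrite ler_norml; apply/andP; split; lra.
have Ksum x y : K x -> K y -> \sum_j `|x 0 j - y 0 j| <= d%:R * H.
  move=> Kx Ky; apply: (@le_trans _ _ (\sum_(j < d) H)).
    by apply: ler_sum => j _; exact: Kdist.
  by rewrite sumr_const card_ord mulr_natl.
have bound m : (m <= k)%N -> forall (mu : mpoly.multinom d) x, mpoly.mdeg mu = (k - m)%N -> K x ->
    `|rho mu x| <= L * d%:R ^+ m.+1 * (H ^+ m * H `^ al).
  elim: m => [_|m IH mk] mu x muE Kx.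
    rewrite subn0 in muE; rewrite rhoT//.
    apply: (le_trans (top _ muE _ _ (UK _ Kx) (UK _ Kx0))).
    rewrite -mulrA ler_wpM2l// expr1 expr0 mul1r.
    have le1 : enorm (x - x0) <= d%:R * H.
      by apply: enorm_le; [exact: ltW|move=> j; rewrite !mxE; exact: Kdist].
    apply: (le_trans (ge0_ler_powR (ltW al0) _ _ le1)).
    - by rewrite nnegrE sqrtr_ge0.
    - by rewrite nnegrE mulr_ge0// ltW.
    rewrite powRM ?(ltW H0)// ler_wpM2r ?powR_ge0//.
    by rewrite -[leRHS]powRr1// ler_powR.
  have muk : (mpoly.mdeg mu < k)%N by rewrite muE ltn_subrL k0.
  have := box_lipschitz (K := K) (fun x => conj id id) (fun x j Kx => rhoD mu j x muk Kx)
    (M := L * d%:R ^+ m.+1 * (H ^+ m * H `^ al)) _ Kx Kx0.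
  rewrite rho0 ?(ltnW muk)// subr0 => /(_ _)/le_trans; apply.
    move=> y j Ky; apply: IH => //; first exact: ltnW.
    by rewrite mpoly.mdegD mpoly.mdeg1 muE addn1 -subSn// subSS.
  apply: (le_trans (ler_wpM2l _ (Ksum _ _ Kx Kx0))).
    by rewrite !mulr_ge0 ?exprn_ge0 ?powR_ge0 ?(ltW H0).
  apply: le_of_eq.
  rewrite (exprSr (d%:R : R) m.+1) (exprSr H m).
  by move: (d%:R ^+ m.+1) (H ^+ m) (H `^ al) => A B E; ring.
have HsE : H ^+ k * H `^ al = H `^ s.
  rewrite -powR_mulrn ?(ltW H0)// -powRD; last by apply/implyP => _; rewrite gt_eqF.
  by rewrite addrC subrK.
have HsE' : H ^+ k.-1 * H `^ al * H = H `^ s.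
  by rewrite -HsE -[in RHS](prednK k0) exprSr; ring.
pose cu (mu : mpoly.multinom d) := c mu * \prod_j h 0 j ^+ mu j.
have puE (u : 'rV[R]_d) : peval (mpoly_of k cu) u = peval p (\row_j (h 0 j * u 0 j)).
  rewrite /peval /mpoly_of !raddf_sum; apply: eq_bigr => m _ /=.
  rewrite !mpoly.mevalZ !mpoly.mevalX /cu -mulrA; congr (_ * _).
  by rewrite -big_split/=; apply: eq_bigr => j _; rewrite mxE exprMn.
exists (mpoly_of k cu); first exact: msize_mpoly_of.
have rhoE (u : 'rV[R]_d) : g (\row_j (x0 0 j + h 0 j * u 0 j)) - peval (mpoly_of k cu) u
    = rho mpoly.mnm0 (\row_j (x0 0 j + h 0 j * u 0 j)).
  rewrite /rho mpartial0 mpoly.mderivm0m puE; congr (_ - peval _ _).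
  by apply/rowP => j; rewrite !mxE addrAC subrr add0r.
split=> [u uc|u v uc vc]; rewrite !rhoE -?HsE.
  by apply: (bound k) => //; [rewrite mpoly.mdeg0 subnn|exact: KE].
have := box_lipschitz (K := K) (fun x => conj id id)
  (fun x j Kx => rhoD mpoly.mnm0 j x _ Kx)
  (M := L * d%:R ^+ k * (H ^+ k.-1 * H `^ al)) _ (KE _ uc) (KE _ vc).
move=> h1; apply: (le_trans (h1 _ _)); first by rewrite mpoly.mdeg0.
  move=> y j Ky; rewrite -[in X in _ ^+ X](prednK k0); apply: bound => //.
    exact: leq_pred.
  by rewrite mpoly.mdegD mpoly.mdeg1 mpoly.mdeg0 -[X in (X - _)%N](prednK k0) subSnn.
rewrite HsE -HsE' exprS.
apply: (@le_trans _ _ (L * d%:R ^+ k * (H ^+ k.-1 * H `^ al) * (d%:R * (H * `|u - v|)))).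
  rewrite ler_wpM2l ?mulr_ge0 ?exprn_ge0 ?powR_ge0 ?(ltW H0)//.
  apply: (@le_trans _ _ (\sum_(j < d) H * `|u - v|)); last by rewrite sumr_const card_ord mulr_natl.
  apply: ler_sum => j _; rewrite !mxE opprD addrACA subrr add0r -mulrBr normrM.
  have /andP[h0 hH'] := hH j; rewrite (gtr0_norm h0) ler_pM ?(ltW h0)//.
  by have := ler_coord (u - v) j; rewrite !mxE.
apply: le_of_eq.
by set a := `|u - v|; ring.
Qed.

End taylor.

(** * Integrals over an i.i.d. sample *)

Section lower_integral.
Import HBNNSimple.
Context {dT : measure_display} {T : measurableType dT} {R : realType}.
Variable mu : {measure set T -> \bar R}.
Local Open Scope ereal_scope.

(** The integral of a nonnegative function, measurable or not, is a supremum
   of integrals of simple functions below it. *)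
Lemma integral_le_lower (F : T -> \bar R) (B : \bar R) : (forall x, 0 <= F x) ->
  (forall h : T -> R, measurable_fun [set: T] h -> (forall x, (0 <= h x)%R) ->
     (forall x, (h x)%:E <= F x) -> \int[mu]_x (h x)%:E <= B) ->
  \int[mu]_x F x <= B.
Proof.
move=> F0 H; rewrite ge0_integralTE//; apply: ge_ereal_sup => _ [h hF <-].
have <- : \int[mu]_x (h x)%:E = sintegral mu h by rewrite integral_nnsfun// patch_setT.
apply: H => // x; exact: fun_ge0.
Qed.

End lower_integral.

Section iid_integral.
Context {dT : measure_display} {T : measurableType dT} {R : realType}.
Variable P : probability T R.
Local Open Scope ereal_scope.

Lemma integral_iid_cons n (h : n.+1.-tuple T -> \bar R) :
  measurable_fun [set: _] h -> (forall z, 0 <= h z) ->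
  \int[iid P n.+1]_z h z = \int[P]_x \int[iid P n]_z h (cons_pair (x, z)).
Proof.
move=> mh h0; rewrite /= ge0_integral_distribution//.
by apply: (fubini_tonelli1 (h \o @cons_pair _ T n)) => [|x /=//]; exact: measurableT_comp.
Qed.

Lemma integral_iid0 (h : 0.-tuple T -> \bar R) :
  measurable_fun [set: _] h -> \int[iid P 0]_z h z = h [tuple].
Proof. by move=> mh; rewrite /= integral_dirac// diracT mul1e. Qed.

(** The number of sample points in a cell being random, functions of these
   points are defined on sequences; measurability is then required for each
   length, jointly with a parameter that accumulates the first points in
   inductions. *)
Definition jmeas dZ (Z : measurableType dZ) (f : Z -> seq T -> \bar R) :=
  forall n, measurable_fun [set: _] (fun zt : Z * n.-tuple T => f zt.1 (tval zt.2)).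

Lemma jmeas_cons dZ (Z : measurableType dZ) (f : Z -> seq T -> \bar R) :
  jmeas f -> jmeas (fun (zx : Z * T) s => f zx.1 (zx.2 :: s)).
Proof.
move=> mf n.
apply: (measurableT_comp (mf n.+1) (g := fun zt : (Z * T) * n.-tuple T =>
   (zt.1.1, cons_pair (zt.1.2, zt.2)))).
apply: measurable_fun_pair => /=.
  exact: (measurableT_comp measurable_fst measurable_fst).
apply: (measurableT_comp (measurable_cons_pair (n := n))).
apply: measurable_fun_pair => //.
exact: (measurableT_comp measurable_snd measurable_fst).
Qed.

Lemma measurable_behead n :
  measurable_fun [set: n.+1.-tuple T] (fun t : n.+1.-tuple T => [tuple of behead t]).
Proof.
apply/measurable_fun_tnthP => i.
rewrite (_ : _ \o _ = @tnth _ T ^~ (lift ord0 i)); first exact: measurable_tnth.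
apply/funext => t /=; case: t => [[//|a t] szt] /=.
by rewrite (tnth_nth a) [RHS](tnth_nth a).
Qed.

Lemma jmeas_filter (A : pred T) dZ (Z : measurableType dZ) (f : Z -> seq T -> \bar R) :
  measurable_fun [set: T] A -> jmeas f -> jmeas (fun z s => f z (seq.filter A s)).
Proof.
move=> mA mf n; elim: n dZ Z f mf => [|n IH] dZ Z f mf.
  rewrite (_ : (fun zt => _) = fun zt : Z * 0.-tuple T => f zt.1 (tval zt.2)); first exact: mf.
  by apply/funext => -[z t]; rewrite (tuple0 t).
pose F1 (zt : (Z * T) * n.-tuple T) := f zt.1.1 (zt.1.2 :: seq.filter A zt.2).
pose F2 (zt : Z * n.-tuple T) := f zt.1 (seq.filter A zt.2).
have mF1 : measurable_fun setT F1 by exact: (IH _ _ _ (jmeas_cons mf)).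
have mF2 : measurable_fun setT F2 by exact: IH.
have mt0 : measurable_fun setT (fun zt : Z * n.+1.-tuple T => tnth zt.2 ord0).
  exact: (measurableT_comp (measurable_tnth ord0) measurable_snd).
have mb : measurable_fun setT (fun zt : Z * n.+1.-tuple T => [tuple of behead zt.2]).
  exact: (measurableT_comp (@measurable_behead n) measurable_snd).
rewrite (_ : (fun zt => _) = fun zt : Z * n.+1.-tuple T =>
   if A (tnth zt.2 ord0) then F1 ((zt.1, tnth zt.2 ord0), [tuple of behead zt.2])
   else F2 (zt.1, [tuple of behead zt.2])); last first.
  by apply/funext => -[z [[//|a t] szt]] /=; rewrite (tnth_nth a)/=; case: ifP.
apply: measurable_fun_ifT.
- exact: measurableT_comp.
- apply: (measurableT_comp mF1); apply: measurable_fun_pair => //.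
  exact: measurable_fun_pair.
- by apply: (measurableT_comp mF2); exact: measurable_fun_pair.
Qed.

(** E[f(X_1, ..., X_m); X_1 in A, ..., X_m in A] *)
Fixpoint selint (A : pred T) m (f : seq T -> \bar R) : \bar R :=
  if m is m'.+1 then \int[P]_x (if A x then selint A m' (fun s => f (x :: s)) else 0)
  else f [::].

Lemma selint_ge0 A m f : (forall s, 0 <= f s) -> 0 <= selint A m f.
Proof.
elim: m f => [|m IH] f f0 /=; first exact: f0.
by apply: integral_ge0 => x _; case: ifP => // _; exact: IH.
Qed.

Lemma measurable_selint (A : pred T) m dZ (Z : measurableType dZ) (f : Z -> seq T -> \bar R) :
  measurable_fun [set: T] A -> jmeas f -> (forall z s, 0 <= f z s) ->
  measurable_fun [set: Z] (fun z => selint A m (f z)).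
Proof.
move=> mA; elim: m dZ Z f => [|m IH] dZ Z f mf f0 /=.
  rewrite (_ : (fun z => _) = (fun zt : Z * 0.-tuple T => f zt.1 (tval zt.2))
     \o (fun z => (z, [tuple])))//.
  by apply: (measurableT_comp (mf 0%N)); exact: measurable_fun_pair.
have H : measurable_fun setT (fun zx : Z * T =>
    if A zx.2 then selint A m (fun s => f zx.1 (zx.2 :: s)) else 0).
  apply: measurable_fun_ifT => //; first exact: measurableT_comp.
  by apply: (IH _ _ (fun (zx : Z * T) s => f zx.1 (zx.2 :: s))) => //; exact: jmeas_cons.
have H0 zx : 0 <= if A zx.2 then selint A m (fun s => f zx.1 (zx.2 :: s)) else 0.
  by case: ifP => // _; exact: selint_ge0.
exact: (measurable_fun_fubini_tonelli_F (m2 := P) _ H H0).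
Qed.

Definition smeas (f : seq T -> \bar R) :=
  forall n, measurable_fun [set: n.-tuple T] (fun t : n.-tuple T => f (tval t)).

Lemma smeas_cons (f : seq T -> \bar R) : smeas f -> jmeas (fun (x : T) s => f (x :: s)).
Proof. by move=> mf n; exact: (measurableT_comp (mf n.+1) (measurable_cons_pair (n := n))). Qed.

Lemma jmeas_smeas dZ (Z : measurableType dZ) (f : Z -> seq T -> \bar R) z :
  jmeas f -> smeas (f z).
Proof.
move=> mf n.
apply: (measurableT_comp (mf n) (g := fun t : n.-tuple T => (z, t))).
exact: measurable_fun_pair.
Qed.

Lemma smeas_filter (A : pred T) (f : seq T -> \bar R) :
  measurable_fun [set: T] A -> smeas f -> smeas (fun s => f (seq.filter A s)).
Proof.
move=> mA mf.
apply: (@jmeas_smeas _ T (fun=> fun s => f (seq.filter A s)) point).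
apply: (@jmeas_filter A _ T (fun=> f)) => // n.
exact: (measurableT_comp (mf n) measurable_snd).
Qed.

Section two_sets.
Variables (A A' : pred T) (r : R).
Hypotheses (mA : measurable_fun [set: T] A) (mA' : measurable_fun [set: T] A').
Hypothesis AA' : forall x, A x -> A' x = false.
Hypothesis Pr : \int[P]_x (if A x || A' x then 0 else 1) = r%:E.

(** The number of ways of choosing the points of [A] and those of [A'], times
   the probability that the other points avoid both sets. *)
Definition multinom_coef n m m' : R :=
  (('C(n, m) * 'C(n - m, m'))%:R * r ^+ (n - m - m'))%R.

Lemma multinom_coefS n m m' : (multinom_coef n.+1 m m' =
  (if m is m0.+1 then multinom_coef n m0 m' else 0) +
  (if m' is m0'.+1 then multinom_coef n m m0' else 0) + multinom_coef n m m' * r)%R.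
Proof.
rewrite /multinom_coef.
have [mn|mn] := leqP m n; last first.
  have e1 : (n.+1 - m = 0)%N by apply/eqP; rewrite subn_eq0.
  have e2 : (n - m = 0)%N by apply/eqP; rewrite subn_eq0 ltnW.
  rewrite e1 e2 [in 'C(n, m)]bin_small// !mul0n !mul0r.
  rewrite (_ : (if m' is _.+1 then _ else _) = 0%R); last first.
    by case: (m') => // m0; rewrite bin_small// mul0n mul0r.
  case: m mn e1 e2 => // m0 mn e1 e2; rewrite !addr0.
  rewrite binS bin_small// add0n.
  have -> : (n - m0 = n.+1 - m0.+1)%N by rewrite subSS.
  by rewrite e1.
rewrite -(mulrA _ (r ^+ _)%R) -exprSr.
have E3 : (('C(n, m) * 'C(n - m, m'))%:R * r ^+ (n - m - m').+1
   = ('C(n, m) * 'C(n - m, m'))%:R * r ^+ (n.+1 - m - m'))%R.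
  have [m'n|m'n] := leqP m' (n - m); last by rewrite [in 'C(n - m, m')]bin_small// muln0 !mul0r.
  by rewrite subSn// subSn.
have E2 : ((if m' is m0'.+1 then ('C(n, m) * 'C(n - m, m0'))%:R * r ^+ (n - m - m0') else 0)
  = (if m' is m0'.+1 then 'C(n, m) * 'C(n - m, m0') else 0)%:R * r ^+ (n.+1 - m - m'))%R.
  by case: (m') => [|m0']; rewrite ?mul0r// subSn// subSS.
have E1 : ((if m is m0.+1 then ('C(n, m0) * 'C(n - m0, m'))%:R * r ^+ (n - m0 - m') else 0)
  = (if m is m0.+1 then 'C(n, m0) * 'C(n - m0, m') else 0)%:R * r ^+ (n.+1 - m - m'))%R.
  by case: (m) mn => [|m0]; rewrite ?mul0r// subSS.
rewrite E1 E2 E3 -!mulrDl -!natrD; congr ((_)%:R * _)%R.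
rewrite -addnA.
have -> : ((if m' is m0'.+1 then 'C(n, m) * 'C(n - m, m0') else 0)
   + 'C(n, m) * 'C(n - m, m') = 'C(n, m) * 'C(n.+1 - m, m'))%N.
  rewrite subSn//; case: (m') => [|m0']; first by rewrite !bin0.
  by rewrite binS mulnDr addnC.
case: (m) mn => [|m0] mn; first by rewrite !bin0.
by rewrite binS mulnDl addnC subSS.
Qed.

(** Condition on the first point: it falls in [A], in [A'], or in neither. *)
Lemma integral_two_sets n m m' f f' :
  smeas f -> smeas f' -> (forall s, 0 <= f s) -> (forall s, 0 <= f' s) ->
  (forall s, size s != m -> f s = 0) -> (forall s, size s != m' -> f' s = 0) ->
  \int[iid P n]_z (f (seq.filter A z) * f' (seq.filter A' z))
  = (multinom_coef n m m')%:E * (selint A m f * selint A' m' f').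
Proof.
elim: n m m' f f' => [|n IH] m m' f f' mf mf' f0 f0' fm fm'.
  rewrite integral_iid0; last first.
    by apply: emeasurable_funM; exact: smeas_filter.
  rewrite /= /multinom_coef sub0n.
  case: m fm => [|m] fm; last by rewrite fm// bin0n !mul0e mul0n mul0r mul0e.
  case: m' fm' => [|m'] fm'; last by rewrite fm'// !bin0n muln0 mul0r mul0e mule0.
  by rewrite !bin0 mul1r expr0 mul1e.
have mff : measurable_fun [set: n.+1.-tuple T]
    (fun z : n.+1.-tuple T => f (seq.filter A z) * f' (seq.filter A' z)).
  by apply: emeasurable_funM; exact: smeas_filter.
rewrite integral_iid_cons//; last by move=> z; exact: mule_ge0.
set I := selint A m f; set I' := selint A' m' f'.
have I0 : 0 <= I by exact: selint_ge0.
have I'0 : 0 <= I' by exact: selint_ge0.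
have r0 : (0 <= r)%R.
  by rewrite -lee_fin -Pr; apply: integral_ge0 => x _; case: ifP.
have c0 k l l' : (0 <= multinom_coef k l l')%R by rewrite mulr_ge0 ?exprn_ge0.
pose u1 : R := (if m is m0.+1 then multinom_coef n m0 m' else 0)%R.
pose u2 : R := (if m' is m0'.+1 then multinom_coef n m m0' else 0)%R.
pose u3 : R := multinom_coef n m m'.
have u10 : (0 <= u1)%R by rewrite /u1; case: (m).
have u20 : (0 <= u2)%R by rewrite /u2; case: (m').
pose a x := if A x then selint A m.-1 (fun s => f (x :: s)) else 0.
pose b x := if A' x then selint A' m'.-1 (fun s => f' (x :: s)) else 0.
pose c x : \bar R := if A x || A' x then 0 else 1.
have a0 x : 0 <= a x by rewrite /a; case: ifP => // _; exact: selint_ge0.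
have b0 x : 0 <= b x by rewrite /b; case: ifP => // _; exact: selint_ge0.
have cc0 x : 0 <= c x by rewrite /c; case: ifP.
have ma : measurable_fun setT a.
  by apply: measurable_fun_ifT => //; apply: measurable_selint => //; exact: smeas_cons.
have mb : measurable_fun setT b.
  by apply: measurable_fun_ifT => //; apply: measurable_selint => //; exact: smeas_cons.
have mc : measurable_fun setT c by apply: measurable_fun_ifT => //; exact: measurable_or.
have G x : \int[iid P n]_z (f (seq.filter A (x :: z)) * f' (seq.filter A' (x :: z)))
   = u1%:E * I' * a x + u2%:E * I * b x + u3%:E * (I * I') * c x.
  rewrite /= /a /b /c; case: ifP => Ax; [rewrite (AA' Ax)/=|case: ifP => A'x /=].
  - rewrite !mule0 !adde0 /u1; case Em : m => [|m0].
      by rewrite !mul0e integral0_eq// => z _; rewrite fm ?mul0e// Em.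
    rewrite (IH m0 m' (fun s => f (x :: s)) f')//.
    + by rewrite -!muleA; congr (_ * _); rewrite muleC.
    + exact: (jmeas_smeas _ (smeas_cons mf)).
    + by move=> s sm; rewrite fm// Em.
  - rewrite !mule0 add0e adde0 /u2; case Em : m' => [|m0].
      by rewrite !mul0e integral0_eq// => z _; rewrite fm' ?mule0// Em.
    rewrite (IH m m0 f (fun s => f' (x :: s)))//.
    + by rewrite -!muleA.
    + exact: (jmeas_smeas _ (smeas_cons mf')).
    + by move=> s sm; rewrite fm'// Em.
  - by rewrite !mule0 !add0e mule1 (IH m m').
under eq_integral do rewrite G.
have H1 : 0 <= u1%:E * I' by rewrite mule_ge0// lee_fin.
have H2 : 0 <= u2%:E * I by rewrite mule_ge0// lee_fin.
have H3 : 0 <= u3%:E * (I * I') by apply: mule_ge0; [rewrite lee_fin; exact: c0|exact: mule_ge0].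
rewrite ge0_integralD//; last 4 first.
- by move=> x _; rewrite adde_ge0 ?mule_ge0.
- by apply: emeasurable_funD; apply: measurable_funeM.
- by move=> x _; rewrite mule_ge0.
- exact: measurable_funeM.
rewrite ge0_integralD//; last 4 first.
- by move=> x _; rewrite mule_ge0.
- exact: measurable_funeM.
- by move=> x _; rewrite mule_ge0.
- exact: measurable_funeM.
rewrite !ge0_integralZl// Pr multinom_coefS -/u1 -/u2 -/u3.
have -> : u1%:E * I' * \int[P]_x a x = u1%:E * (I * I').
  rewrite /u1 /I /a; case: (m) => [|m0]; first by rewrite !mul0e.
  by rewrite -muleA; congr (_ * _); rewrite muleC.
have -> : u2%:E * I * \int[P]_x b x = u2%:E * (I * I').
  rewrite /u2 /I' /b; case: (m') => [|m0]; first by rewrite !mul0e.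
  by rewrite -muleA.
rewrite EFinD EFinD !ge0_muleDl ?adde_ge0 ?lee_fin ?mulr_ge0 ?exprn_ge0//.
by rewrite EFinM muleAC.
Qed.

End two_sets.

End iid_integral.

(** * Integrating the noise out at fixed design points *)

Section pull_kernel.
Context {dX dW dY : measure_display} {X : measurableType dX} {W : measurableType dW}
  {Y : measurableType dY} {R : realType}.
Variables (k : R.-pker X ~> Y) (g : W -> X).

(** The noise kernel read at one coordinate of a sample: as a kernel on samples,
   it gives access to the measurability of integrals with a parameter. *)
Definition pull_kernel (mg : measurable_fun [set: W] g) (w : W) :
  {measure set Y -> \bar R} := k (g w).

Variable mg : measurable_fun [set: W] g.

Let mpull U : measurable U -> measurable_fun [set: W] (pull_kernel mg ^~ U).
Proof. by move=> mU; apply: (measurableT_comp (measurable_kernel k U mU) mg). Qed.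

HB.instance Definition _ := isKernel.Build _ _ W Y R (pull_kernel mg) mpull.

Let pull_uub : measure_fam_uub (pull_kernel mg).
Proof.
by exists 2%R => w; rewrite /pull_kernel prob_kernel lte_fin ltr1n.
Qed.

HB.instance Definition _ := Kernel_isFinite.Build _ _ W Y R (pull_kernel mg) pull_uub.

Lemma measurable_integral_pull (f : W * Y -> \bar R) :
  measurable_fun [set: _] f -> (forall wy, (0 <= f wy)%E) ->
  measurable_fun [set: W] (fun w => \int[k (g w)]_y f (w, y))%E.
Proof.
by move=> mf f0; exact: (measurable_fun_integral_finite_kernel f (pull_kernel mg)).
Qed.

End pull_kernel.

Section kernel_probability.
Context {dX dY : measure_display} {X : measurableType dX}
  {Y : measurableType dY} {R : realType}.
Variables (k : R.-pker X ~> Y) (x : X).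
(** A single law of the kernel, as a probability, for Tonelli's theorem. *)
Definition kernel_at : set Y -> \bar R := k x.
HB.instance Definition _ := Measure.on kernel_at.
Let kernel_at_setT : kernel_at [set: Y] = 1%E.
Proof. exact: prob_kernel. Qed.
HB.instance Definition _ := Measure_isProbability.Build _ _ _ kernel_at kernel_at_setT.
End kernel_probability.

Section noise_integral.
Context {R : realType} {d : nat}.
Variable th : param R d.
Local Notation X := (d.-tuple R).
Local Open Scope ereal_scope.

Import HBNNSimple.

(** For a simple function, both sides agree by definition of the joint law; the
   left-hand side is a supremum over simple functions. *)
Lemma integral_joint_le (g : X * R -> \bar R) :
  measurable_fun [set: _] g -> (forall w, 0 <= g w) ->
  \int[joint_law th]_w g w <= \int[design_law th]_x \int[noise th x]_u g (x, u).
Proof.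
move=> mg g0; rewrite ge0_integralTE//; apply: ge_ereal_sup => _ [h hg <-].
pose D r := h @^-1` [set r].
have mD r : measurable (D r) by exact: measurable_funPTI.
have D0 r x : (r < 0)%R -> xsection (D r) x = set0.
  move=> r0; apply/seteqP; split => // u /xsectionP/= hr.
  by move: r0; rewrite -hr ltNge fun_ge0.
have inner x : \int[noise th x]_u (h (x, u))%:E
    = \sum_(r \in range h) r%:E * noise th x (xsection (D r) x).
  transitivity (\int[noise th x]_u
      \sum_(r \in range h) (r * \1_(xsection (D r) x) u)%:E).
    apply: eq_integral => u _; rewrite fimfunE -fsumEFin//.
    apply: eq_fsbigr => r _; congr (_ * _)%:E.
    by rewrite /indic mem_xsection.
  rewrite ge0_integral_fsum//; last 2 first.
  - move=> r; apply/measurable_EFinP; apply: measurable_funM => //.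
    by apply: measurable_indic; exact: measurable_xsection.
  - move=> r u _; have [r0|r0] := leP 0%R r; first by rewrite lee_fin mulr_ge0.
    by rewrite D0// indic0 mulr0.
  apply: eq_fsbigr => r /[!inE] -[z _ <-].
  under eq_integral do rewrite EFinM.
  rewrite ge0_integralZl//.
  - by rewrite integral_indic ?setIT//; exact: measurable_xsection.
  - apply/measurable_EFinP/measurable_indic; exact: measurable_xsection.
  - by rewrite lee_fin; exact: fun_ge0.
have mnoise r : measurable_fun [set: X] (fun x => noise th x (xsection (D r) x)).
  by apply: measurable_fun_xsection_finite_kernel; rewrite inE.
have H : sintegral (joint_law th) h = \int[design_law th]_x \int[noise th x]_u (h (x, u))%:E.
  rewrite sintegralE; under [RHS]eq_integral do rewrite inner.
  rewrite ge0_integral_fsum//; last 2 first.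
  - by move=> r; exact: measurable_funeM.
  - move=> r x _; have [r0|r0] := leP 0%R r; first by rewrite mule_ge0.
    by rewrite D0// measure0 mule0.
  apply: eq_fsbigr => r /[!inE] -[z _ <-].
  by rewrite ge0_integralZl// lee_fin fun_ge0.
rewrite H; apply: ge0_le_integral => //.
- by move=> x _; apply: integral_ge0 => u _; rewrite lee_fin fun_ge0.
- apply: (measurable_fun_integral_finite_kernel (EFin \o h)) => //.
    by move=> z; rewrite lee_fin fun_ge0.
  exact/measurable_EFinP.
- exact: measurable_fun_integral_finite_kernel.
- move=> x _; apply: ge0_le_integral => //.
  + by move=> u _; rewrite lee_fin fun_ge0.
  + by apply/measurable_EFinP; apply: measurableT_comp => //; exact: measurable_fun_pair.
  + by apply: measurableT_comp => //; exact: measurable_fun_pair.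
Qed.

Lemma integral_obs_le (g : X * R -> \bar R) :
  measurable_fun [set: _] g -> (forall w, 0 <= g w) ->
  \int[obs_law th]_w g w
    <= \int[design_law th]_x \int[noise th x]_u g (x, (reg th x + u)%R).
Proof.
move=> mg g0; rewrite /obs_law ge0_integral_distribution//.
apply: integral_joint_le => [|w]; last exact: g0.
by apply: measurableT_comp => //; exact: measurable_obs_of.
Qed.

Lemma ge0_integral_le (dT : measure_display) (T : measurableType dT)
    (mu : {measure set T -> \bar R}) (f g : T -> \bar R) :
  (forall x, 0 <= f x) -> (forall x, f x <= g x) ->
  \int[mu]_x f x <= \int[mu]_x g x.
Proof.
move=> f0 fg; rewrite !ge0_integralTE//; last by move=> x; exact: le_trans (fg x).
apply: le_ereal_sup => _ [h hf <-]; exists h => // x.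
exact: le_trans (fg x).
Qed.

Variable ok : pred X.

(** Integral over the responses at fixed design points.  The moments of the noise
   are known off a null set of design points only; points outside of [ok] are
   given no mass, which is harmless when they form a null set. *)
Fixpoint noise_int (xs : seq X) (h : seq (X * R) -> \bar R) : \bar R :=
  if xs is x :: xs' then
    if ok x then \int[noise th x]_u noise_int xs' (fun s => h ((x, (reg th x + u)%R) :: s))
    else 0
  else h [::].

Lemma noise_int_ge0 xs h : (forall s, 0 <= h s) -> 0 <= noise_int xs h.
Proof.
elim: xs h => [|x xs IH] h h0 /=; first exact: h0.
by case: ifP => // _; apply: integral_ge0 => u _; exact: IH.
Qed.

Section measurability.
Hypothesis mok : measurable_fun [set: X] ok.

Lemma measurable_noise_int n dZ (Z : measurableType dZ) (h : Z -> seq (X * R) -> \bar R) :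
  jmeas h -> (forall z s, 0 <= h z s) ->
  measurable_fun [set: Z * n.-tuple X] (fun zx => noise_int zx.2 (h zx.1)).
Proof.
elim: n dZ Z h => [|n IH] dZ Z h mh h0.
  rewrite (_ : (fun zx => _) = (fun zt : Z * 0.-tuple (X * R) => h zt.1 (tval zt.2))
      \o (fun zx : Z * 0.-tuple X => (zx.1, [tuple]))).
    by apply: (measurableT_comp (mh 0%N)); exact: measurable_fun_pair.
  by apply/funext => -[z t] /=; rewrite (tuple0 t).
have IH1 := IH _ _ _ (jmeas_cons mh) (fun zx s => h0 _ _).
have mt0 : measurable_fun setT (fun zt : Z * n.+1.-tuple X => tnth zt.2 ord0).
  exact: (measurableT_comp (measurable_tnth ord0) measurable_snd).
have mb : measurable_fun setT (fun zt : Z * n.+1.-tuple X => [tuple of behead zt.2]).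
  exact: (measurableT_comp (@measurable_behead _ _ n) measurable_snd).
rewrite (_ : (fun zx => _) = fun zt : Z * n.+1.-tuple X =>
  if ok (tnth zt.2 ord0) then
    \int[noise th (tnth zt.2 ord0)]_u
      noise_int [tuple of behead zt.2]
        (fun s => h zt.1 ((tnth zt.2 ord0, (reg th (tnth zt.2 ord0) + u)%R) :: s))
  else 0); last first.
  by apply/funext => -[z [[//|a t] szt]] /=; rewrite (tnth_nth a).
apply: measurable_fun_ifT => //; first exact: (measurableT_comp mok mt0).
apply: (measurable_integral_pull (noise th) mt0 (f := fun wu : (Z * n.+1.-tuple X) * R =>
   noise_int [tuple of behead wu.1.2]
     (fun s => h wu.1.1 ((tnth wu.1.2 ord0, (reg th (tnth wu.1.2 ord0) + wu.2)%R) :: s)))).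
- apply: (measurableT_comp IH1 (g := fun wu : (Z * n.+1.-tuple X) * R =>
    ((wu.1.1, (tnth wu.1.2 ord0, (reg th (tnth wu.1.2 ord0) + wu.2)%R)),
      [tuple of behead wu.1.2]))).
  have mx : measurable_fun setT (fun wu : (Z * n.+1.-tuple X) * R => tnth wu.1.2 ord0).
    exact: (measurableT_comp mt0 measurable_fst).
  apply: measurable_fun_pair; last exact: (measurableT_comp mb measurable_fst).
  apply: measurable_fun_pair; first exact: (measurableT_comp measurable_fst measurable_fst).
  apply: measurable_fun_pair => //.
  apply: measurable_funD => //.
  by apply: (measurableT_comp (f := reg th)).
- by move=> wu; exact: noise_int_ge0.
Qed.

Hypothesis ok_ae : forall f : X -> \bar R, measurable_fun setT f -> (forall x, 0 <= f x) ->
  \int[design_law th]_x f x = \int[design_law th]_x (if ok x then f x else 0).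

Lemma measurable_noise_int1 n (h : seq (X * R) -> \bar R) :
  smeas h -> (forall s, 0 <= h s) ->
  measurable_fun [set: n.-tuple X] (fun xs : n.-tuple X => noise_int xs h).
Proof.
move=> mh h0.
have mh' : jmeas (fun _ : X => h).
  by move=> k; exact: (measurableT_comp (mh k) measurable_snd).
apply: (measurableT_comp (@measurable_noise_int n _ X (fun=> h) mh' (fun _ => h0))
  (g := fun xs : n.-tuple X => (point : X, xs))).
exact: measurable_fun_pair.
Qed.

(** By induction on the sample size; the noise of the first point is exchanged
   with the other design points by Tonelli's theorem. *)
Lemma integral_sample_le n (h : seq (X * R) -> \bar R) :
  smeas h -> (forall s, 0 <= h s) ->
  \int[sample_law th n]_z h z <= \int[iid (design_law th) n]_xs noise_int xs h.
Proof.
rewrite /sample_law; elim: n h => [|n IH] h mh h0.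
  rewrite (integral_iid0 _ (mh 0%N)) integral_iid0//.
  exact: measurable_noise_int1.
rewrite (integral_iid_cons _ (mh n.+1))//.
rewrite integral_iid_cons; last 2 first.
- exact: measurable_noise_int1.
- by move=> z; exact: noise_int_ge0.
pose g (w : X * R) := \int[iid (design_law th) n]_xs noise_int xs (fun s => h (w :: s)).
have mN : measurable_fun setT (fun wx : (X * R) * n.-tuple X =>
    noise_int wx.2 (fun s => h (wx.1 :: s))).
  by apply: (@measurable_noise_int n _ (X * R)%type (fun w s => h (w :: s))) => //; exact: smeas_cons.
have N0 (wx : (X * R) * n.-tuple X) : 0 <= noise_int wx.2 (fun s => h (wx.1 :: s)).
  exact: noise_int_ge0.
have mg : measurable_fun setT g.
  exact: (measurable_fun_fubini_tonelli_F (m2 := iid (design_law th) n) _ mN N0).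
have g0 w : 0 <= g w by apply: integral_ge0 => xs _; exact: noise_int_ge0.
apply: (@le_trans _ _ (\int[obs_law th]_w g w)).
  apply: ge0_le_integral => //.
  - by move=> w _; exact: integral_ge0.
  - exact: (measurable_fun_fubini_tonelli_F (m2 := iid (obs_law th) n) _ (smeas_cons mh (n:=n)) (fun=> h0 _)).
  - by move=> w _; apply: IH => //; exact: (jmeas_smeas _ (smeas_cons mh)).
apply: (le_trans (integral_obs_le mg g0)).
rewrite ok_ae; last 2 first.
- apply: (measurable_fun_integral_finite_kernel (g \o obs_of th)) => //.
    by move=> w; exact: g0.
  by apply: measurableT_comp => //; exact: measurable_obs_of.
- by move=> x; apply: integral_ge0 => u _; exact: g0.
apply: le_of_eq; apply: eq_integral => x _ /=.
case: ifP => okx; last by rewrite integral0.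
pose G (ux : R * n.-tuple X) := noise_int ux.2 (fun s => h ((x, (reg th x + ux.1)%R) :: s)).
have mG : measurable_fun setT G.
  apply: (measurableT_comp mN (g := fun ux : R * n.-tuple X => ((x, (reg th x + ux.1)%R), ux.2))).
  apply: measurable_fun_pair => //; apply: measurable_fun_pair => //.
  exact: measurable_funD.
have G0 ux : 0 <= G ux by exact: noise_int_ge0.
have F1 := fubini_tonelli1 (m1 := kernel_at (noise th) x) (m2 := iid (design_law th) n) _ mG G0.
have F2 := fubini_tonelli2 (m1 := kernel_at (noise th) x) (m2 := iid (design_law th) n) _ mG G0.
by rewrite F1 in F2; exact: F2.
Qed.

End measurability.

Lemma noise_int_le xs (h h' : seq (X * R) -> \bar R) : (forall s, 0 <= h s) ->
  (forall s, map fst s = xs -> h s <= h' s) -> noise_int xs h <= noise_int xs h'.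
Proof.
elim: xs h h' => [|x xs IH] h h' h0 hh' /=; first exact: hh'.
case: ifP => // _; apply: ge0_integral_le => u; first exact: noise_int_ge0.
by apply: IH => // s sxs; apply: hh'; rewrite /= sxs.
Qed.

Lemma noise_int_cst xs (c : \bar R) : 0 <= c -> noise_int xs (fun=> c) <= c.
Proof.
move=> c0; elim: xs => //= x xs IH; case: ifP => // _.
apply: (@le_trans _ _ (\int[noise th x]_u c)).
  by apply: ge0_integral_le => // u; exact: noise_int_ge0.
by rewrite integral_cst// [X in _ * X](@prob_kernel _ _ _ _ _ (noise th) x) mule1.
Qed.

(** ** Second moment of a quadratic form in the noise *)

Variables v M4 : R.
Hypothesis v0 : (0 <= v)%R.
Hypothesis ok_moments : forall x, ok x ->
  [/\ \int[noise th x]_u u%:E = 0, \int[noise th x]_u (u ^+ 2)%:E = v%:E &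
      \int[noise th x]_u (u ^+ 4)%:E <= M4%:E].

(** The quartic bound has no cubic term, since the third moment of the noise is
   arbitrary. *)
Lemma noise_quartic_le x (a b c e : R) (F : R -> \bar R) : ok x -> (0 <= e)%R ->
  (forall u, 0 <= F u) ->
  (forall u, F u <= (a + b * u + c * u ^+ 2 + e * u ^+ 4)%:E) ->
  \int[noise th x]_u F u <= (a + c * v + e * M4)%:E.
Proof.
move=> okx e0 F0 FQ; have [m1 m2 m4] := ok_moments okx.
apply: (@le_trans _ _ (\int[noise th x]_u (a + b * u + c * u ^+ 2 + e * u ^+ 4)%:E)).
  exact: ge0_integral_le.
have mX k : measurable_fun setT (fun u : R => (u ^+ k)%R) by exact: exprn_measurable.
have i2 : (noise th x).-integrable setT (fun u => (u ^+ 2)%:E).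
  apply/integrableP; split; first exact/measurable_EFinP.
  by under eq_integral do rewrite gee0_abs ?lee_fin ?sqr_ge0//; rewrite m2 ltry.
have i4 : (noise th x).-integrable setT (fun u => (u ^+ 4)%:E).
  apply/integrableP; split; first exact/measurable_EFinP.
  under eq_integral do rewrite gee0_abs ?lee_fin ?exprn_even_ge0//.
  by apply: (le_lt_trans m4); rewrite ltry.
have i0 k : (noise th x).-integrable setT (fun=> k%:E).
  exact: (finite_measure_integrable_cst (kernel_at (noise th) x) k measurableT).
have i1 : (noise th x).-integrable setT (fun u => u%:E).
  apply: (@le_integrable _ _ _ (noise th x) setT measurableT _ (fun u => 1%:E + (u ^+ 2)%:E)).
  - exact/measurable_EFinP.
  - move=> u _; rewrite -EFinD !abse_EFin lee_fin [leRHS]ger0_norm ?addr_ge0 ?sqr_ge0//.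
    by rewrite ler_norml; apply/andP; split; have := sqr_ge0 (u - 1); have := sqr_ge0 (u + 1); nra.
  - exact: integrableD.
have iZ k (f : R -> \bar R) : (noise th x).-integrable setT f ->
   (noise th x).-integrable setT (fun u => k%:E * f u) by exact: integrableZl.
under eq_integral do rewrite 3!EFinD !EFinM.
rewrite integralD//; last 2 first.
- by apply: integrableD => //; [apply: integrableD => //; exact: iZ|exact: iZ].
- exact: iZ.
rewrite integralD//; last 2 first.
- by apply: integrableD => //; exact: iZ.
- exact: iZ.
rewrite integralD//; last exact: iZ.
rewrite !integralZl// m1 m2 mule0 adde0.
rewrite (_ : \int[noise th x]_u a%:E = a%:E); last first.
  by rewrite integral_cst// [X in _ * X](@prob_kernel _ _ _ _ _ (noise th) x) mule1.
rewrite 2!EFinD !EFinM leeD2l// lee_wpmul2l// lee_fin.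
Qed.

Definition res (s : seq (X * R)) i : R := ((nth point s i).2 - reg th (nth point s i).1)%R.

Definition quad n (c : R) (b : nat -> R) (A : nat -> nat -> R) s : R :=
  (c + \sum_(0 <= i < n) b i * res s i
     + \sum_(0 <= i < n) \sum_(0 <= j < n) A i j * res s i * res s j)%R.

Lemma quad_cons n c b A x u s :
  quad n.+1 c b A ((x, (reg th x + u)%R) :: s) =
  quad n (c + b 0%N * u + A 0%N 0%N * u ^+ 2)%R
    (fun i => b i.+1 + (A 0%N i.+1 + A i.+1 0%N) * u)%R
    (fun i j => A i.+1 j.+1) s.
Proof.
have r0 : res ((x, (reg th x + u)%R) :: s) 0%N = u by rewrite /res /= addrC addKr.
have rS i : res ((x, (reg th x + u)%R) :: s) i.+1 = res s i by [].
rewrite /quad !big_nat_recl// r0.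
set w := _ :: s.
have e1 : (\sum_(0 <= i < n) b i.+1 * res w i.+1 = \sum_(0 <= i < n) b i.+1 * res s i)%R by [].
have e2 : (\sum_(0 <= i < n) A 0%N i.+1 * u * res w i.+1
         = u * \sum_(0 <= i < n) A 0%N i.+1 * res s i)%R.
  by rewrite mulr_sumr; apply: eq_bigr => i _; rewrite rS; ring.
have e3 : (\sum_(0 <= i < n) \sum_(0 <= j < n.+1) A i.+1 j * res w i.+1 * res w j
    = u * (\sum_(0 <= i < n) A i.+1 0%N * res s i)
    + \sum_(0 <= i < n) \sum_(0 <= j < n) A i.+1 j.+1 * res s i * res s j)%R.
  rewrite mulr_sumr -big_split/=; apply: eq_bigr => i _.
  by rewrite big_nat_recl// r0 rS; congr (_ + _)%R; ring.
have e4 : (\sum_(0 <= i < n) (b i.+1 + (A 0%N i.+1 + A i.+1 0%N) * u) * res s i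
   = \sum_(0 <= i < n) b i.+1 * res s i + (u * \sum_(0 <= i < n) A 0%N i.+1 * res s i
     + u * \sum_(0 <= i < n) A i.+1 0%N * res s i))%R.
  rewrite !mulr_sumr -!big_split/=; apply: eq_bigr => i _; ring.
rewrite e1 e2 e3 e4; ring.
Qed.

(** Integrate one noise [u] at a time: the polynomial in the other noises has
   coefficients that depend on [u], and the induction hypothesis bounds its second
   moment by a quartic in [u].  The cubic term of this quartic comes from the
   product of [b0 * u] and [A0 * (u ^+ 2 - v)], which is bounded by half the sum
   of the squares of the factors. *)
Lemma noise_int_quad (K : R) xs c b A : (2 * M4 <= K)%R -> (4 * v ^+ 2 <= K)%R ->
  noise_int xs (fun s => (quad (size xs) c b A s ^+ 2)%:E) <=
  ((c + v * \sum_(0 <= i < size xs) A i i) ^+ 2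
    + 2 * v * \sum_(0 <= i < size xs) b i ^+ 2
    + K * \sum_(0 <= i < size xs) \sum_(0 <= j < size xs) A i j ^+ 2)%:E.
Proof.
move=> hK hK'; elim: xs c b A => [|x xs IH] c b A.
  by rewrite /= /quad !big_nil !mulr0 !addr0.
rewrite [size (x :: xs)]/= [noise_int _ _]/=; case: ifP => okx; last first.
  rewrite lee_fin !addr_ge0 ?sqr_ge0// !mulr_ge0//.
  - by apply: sumr_ge0 => i _; exact: sqr_ge0.
  - by apply: le_trans hK'; rewrite mulr_ge0 ?sqr_ge0.
  - by apply: sumr_ge0 => i _; apply: sumr_ge0 => j _; exact: sqr_ge0.
set n := size xs in IH *.
pose a0 i := (A 0%N i.+1 + A i.+1 0%N)%R.
pose tr := (\sum_(0 <= i < n) A i.+1 i.+1)%R.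
pose S2 := (\sum_(0 <= i < n) \sum_(0 <= j < n) A i.+1 j.+1 ^+ 2)%R.
pose Sb := (\sum_(0 <= i < n) b i.+1 ^+ 2)%R.
pose Sa := (\sum_(0 <= i < n) a0 i ^+ 2)%R.
pose Sab := (\sum_(0 <= i < n) b i.+1 * a0 i)%R.
pose C := (c + v * (A 0%N 0%N + tr))%R.
pose b0 := b 0%N; pose A0 := A 0%N 0%N.
apply: (@le_trans _ _
  ((C ^+ 2 - 2 * C * A0 * v + 2 * A0 ^+ 2 * v ^+ 2 + 2 * v * Sb + K * S2)
   + (2 * C * A0 + 2 * b0 ^+ 2 - 4 * A0 ^+ 2 * v + 2 * v * Sa) * v + (2 * A0 ^+ 2) * M4)%:E).
  apply: (@noise_quartic_le x _ (2 * C * b0 + 4 * v * Sab)%R) => //.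
  - by rewrite mulr_ge0// sqr_ge0.
  - by move=> u; apply: noise_int_ge0 => s; rewrite lee_fin sqr_ge0.
  move=> u; apply: (@le_trans _ _ (noise_int xs (fun s =>
    (quad n (c + b 0%N * u + A 0%N 0%N * u ^+ 2)%R
    (fun i => b i.+1 + a0 i * u)%R
    (fun i j => A i.+1 j.+1) s ^+ 2)%:E))).
    by apply: noise_int_le => [s|s _]; rewrite ?lee_fin ?sqr_ge0// quad_cons.
  apply: (le_trans (IH _ _ _)); rewrite lee_fin.
  rewrite -/tr -/S2.
  have -> : (\sum_(0 <= i < n) (b i.+1 + a0 i * u) ^+ 2 = Sb + 2 * u * Sab + u ^+ 2 * Sa)%R.
    rewrite /Sb /Sab /Sa !mulr_sumr -!big_split/=.
    by apply: eq_bigr => i _; ring.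
  have -> : (c + b 0%N * u + A 0%N 0%N * u ^+ 2 + v * tr = C + b0 * u + A0 * (u ^+ 2 - v))%R.
    by rewrite /C /b0 /A0; ring.
  have := sqr_ge0 (b0 * u - A0 * (u ^+ 2 - v))%R.
  move: C b0 A0 Sb Sab Sa S2 => C b0 A0 Sb Sab Sa S2 h.
  rewrite -subr_ge0; apply: (le_trans h); apply: le_of_eq.
  ring.
rewrite lee_fin !big_nat_recl// -/tr -/b0 -/A0 -/Sb.
under [X in (_ + K * (_ + X))%R]eq_bigr do rewrite big_nat_recl//.
rewrite !big_split/= -/S2.
have Sa_le : (Sa <= 2 * (\sum_(0 <= i < n) A 0%N i.+1 ^+ 2 + \sum_(0 <= i < n) A i.+1 0%N ^+ 2))%R.
  rewrite /Sa -big_split/= mulr_sumr; apply: ler_sum => i _; rewrite /a0.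
  by have := sqr_ge0 (A 0%N i.+1 - A i.+1 0%N)%R; lra.
move: Sa_le; set T1 := (\sum_(0 <= i < n) A 0%N i.+1 ^+ 2)%R.
set T2 := (\sum_(0 <= i < n) A i.+1 0%N ^+ 2)%R => Sa_le.
have T0 : (0 <= T1 + T2)%R by rewrite addr_ge0//; apply: sumr_ge0 => i _; exact: sqr_ge0.
have h1 := ler_wpM2r T0 hK'.
have h2 := ler_wpM2l (mulr_ge0 v0 v0) Sa_le.
have h3 := ler_wpM2r (sqr_ge0 A0) hK.
have h4 : (0 <= A0 ^+ 2 * v ^+ 2)%R by rewrite mulr_ge0 ?sqr_ge0.
rewrite -/C.
move: C b0 A0 Sb Sab Sa S2 T1 T2 T0 h1 h2 h3 h4 {Sa_le} => C b0 A0 Sb Sab Sa S2 T1 T2 T0 h1 h2 h3 h4.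
lra.
Qed.

End noise_integral.

(** * Boxes in the unit cube *)

Section boxes.
Context {R : realType}.
Local Open Scope ereal_scope.

Lemma measurable_box dT (T : measurableType dT) n (A : 'I_n -> set T) :
  (forall i, measurable (A i)) ->
  measurable [set x : n.-tuple T | forall i, A i (tnth x i)].
Proof.
move=> mA; rewrite (_ : [set x | _] = \bigcap_(i in [set: 'I_n]) (@tnth n T ^~ i @^-1` A i)).
  apply: fin_bigcap_measurable => // i _.
  rewrite -[X in measurable X]setTI; exact: (measurable_tnth i).
by apply/seteqP; split => x /= h i; [move=> _; exact: h|exact: (h i I)].
Qed.

Lemma iid_box dT (T : measurableType dT) (P : probability T R) n (A : 'I_n -> set T) :
  (forall i, measurable (A i)) ->
  iid P n [set x | forall i, A i (tnth x i)] = \prod_(i < n) P (A i).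
Proof.
elim: n A => [|n IH] A mA.
  rewrite big_ord0 /= diracE; congr (_%:E); by rewrite mem_set// => -[].
rewrite big_ord_recl -(IH (fun i => A (lift ord0 i)))//= /distribution /pushforward.
rewrite (_ : _ @^-1` _ = A ord0 `*`
   [set z : n.-tuple T | forall i, A (lift ord0 i) (tnth z i)]); last first.
  apply/seteqP; split => -[x z] /=.
    move=> h; split; first exact: (h ord0).
    by move=> i; have := h (lift ord0 i); rewrite tnthS.
  move=> [h0 h] i; case: (unliftP ord0 i) => [j ->|->]; last exact: h0.
  by rewrite tnthS.
by rewrite product_measure1E//; exact: (@measurable_box _ _ n (fun i => A (lift ord0 i))).
Qed.

Definition unif01 : probability R R :=
  distribution (uniform_prob (@ltr01 R)) (@from_measurableTypeR R).

Lemma unif01_itv (a b : R) (x y : bool) : (0 <= a)%R -> (a <= b)%R -> (b <= 1)%R ->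
  unif01 [set` Interval (BSide x a) (BSide y b)] = (b - a)%:E.
Proof.
move=> a0 ab b1.
rewrite /unif01 /distribution /pushforward/= /uniform_prob.
rewrite (_ : _ @^-1` _ = [set` Interval (BSide x a) (BSide y b)]); last by [].
rewrite (eq_integral (cst 1)); last first.
  move=> t; rewrite inE/= itv_boundlr => /andP[ta tb].
  rewrite /uniform_pdf subr0 invr1.
  have at_ : (a <= t)%R by move: ta; case: (x); rewrite ?bnd_simp => // /ltW.
  have tb_ : (t <= b)%R by move: tb; case: (y); rewrite ?bnd_simp => // /ltW.
  by rewrite (le_trans a0 at_) (le_trans tb_ b1).
rewrite integral_cst//= mul1e.
rewrite (_ : lebesgue_measure _ = lebesgue_measure ([set` Interval (BSide x a) (BSide y b)] : set R))//.
rewrite lebesgue_measure_itv/= lte_fin.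
case: ltP => ba; first by [].
by rewrite (le_anti (introT andP (conj ab ba))) subrr.
Qed.

Lemma prod_EFin n (F : 'I_n -> R) : \prod_(i < n) (F i)%:E = (\prod_(i < n) F i)%:E.
Proof.
elim: n F => [|n IH] F; first by rewrite !big_ord0.
by rewrite !big_ord_recl IH EFinM.
Qed.

End boxes.

Section cells.
Context {R : realType} {d : nat}.
Variables (s : 'I_d -> nat) (Q : cell s).

Local Notation side := (cell_side (R := R) s).
Local Notation corner := (cell_corner (R := R) Q).

Lemma side_gt0 j : 0 < side j.
Proof. by rewrite invr_gt0 ltr0n expn_gt0. Qed.

Lemma corner_ge0 j : 0 <= corner j.
Proof. by rewrite mulr_ge0// ltW// side_gt0. Qed.

Lemma corner_sideE j : corner j + side j = (Q j).+1%:R * side j.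
Proof. by rewrite /cell_corner -[X in _ + X]mul1r -mulrDl natr1. Qed.

Lemma corner_side_le1 j : corner j + side j <= 1.
Proof.
rewrite corner_sideE ler_pdivrMr ?ltr0n ?expn_gt0// mul1r ler_nat.
exact: ltn_ord.
Qed.

Definition edge j : set R :=
  [set` Interval (BLeft (corner j))
     (BSide ((Q j).+1 != 2 ^ s j)%N (corner j + side j))].

Lemma in_cellP x : in_cell Q x <-> forall j, edge j (tnth x j).
Proof.
have E j : edge j (tnth x j) = is_true ((corner j <= tnth x j) &&
    ((tnth x j < corner j + side j) || (((Q j).+1 == 2 ^ s j)%N && (tnth x j == 1)))).
  rewrite /edge /=; congr is_true; rewrite itv_boundlr /= bnd_simp; congr andb.
  have [l|l] := eqVneq; rewrite ?bnd_simp//= ?orbF//.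
  rewrite corner_sideE l divff ?pnatr_eq0 -?lt0n ?expn_gt0//.
  by rewrite le_eqVlt orbC.
split=> [/forallP h j|h]; first by rewrite E; exact: h.
by apply/forallP => j; rewrite -E; exact: h.
Qed.

Lemma measurable_edge j : measurable (edge j).
Proof. exact: measurable_itv. Qed.

Lemma unif01_edge j : unif01 (edge j) = (side j)%:E.
Proof.
rewrite unif01_itv ?corner_ge0 ?corner_side_le1 ?lerDl ?(ltW (side_gt0 _))//.
by rewrite addrC addKr.
Qed.

Lemma cell_setE : [set x | in_cell Q x] = [set x : d.-tuple R | forall j, edge j (tnth x j)].
Proof. by apply/seteqP; split => x /in_cellP. Qed.

Lemma measurable_cell_set : measurable [set x : d.-tuple R | in_cell Q x].
Proof. by rewrite cell_setE; apply: measurable_box => j; exact: measurable_edge. Qed.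

Lemma measurable_in_cell : measurable_fun [set: d.-tuple R] (in_cell Q).
Proof.
apply: (measurable_fun_bool true); rewrite setTI; exact: measurable_cell_set.
Qed.

Lemma prod_side : \prod_j side j = (#|{: cell s}|)%:R^-1.
Proof.
rewrite /cell card_dep_ffun foldrE big_map big_enum/=.
under [in RHS]eq_bigr do rewrite card_ord.
by rewrite natr_prod -prodfV.
Qed.

Lemma lebesgue_cell : lebesgue_cube R d [set x | in_cell Q x] = (#|{: cell s}|%:R^-1)%:E.
Proof.
rewrite cell_setE (iid_box _ measurable_edge).
under eq_bigr do rewrite unif01_edge.
by rewrite prod_EFin prod_side.
Qed.

Lemma in_cell_unit_cube (x : d.-tuple R) : in_cell Q x -> unit_cube x.
Proof.
move=> /forallP h j; have /andP[c1 c2] := h j.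
rewrite (le_trans (corner_ge0 j) c1)/=; case/orP: c2 => [|/andP[_ /eqP->//]].
by move/ltW/le_trans; apply; exact: corner_side_le1.
Qed.

Lemma local_coord_cube (x : d.-tuple R) : in_cell Q x -> cube (local_coord Q x).
Proof.
move=> /in_cellP h j; rewrite mxE; have := h j.
rewrite /edge /= itv_boundlr /= bnd_simp => /andP[c1 c2].
have {c2} : tnth x j <= corner j + side j.
  by move: c2; case: eqP => _; rewrite bnd_simp => // /ltW.
move=> c2; rewrite divr_ge0 ?(ltW (side_gt0 _)) ?subr_ge0//=.
by rewrite ler_pdivrMr ?side_gt0// mul1r lerBlDl.
Qed.

Lemma row_of_local (x : d.-tuple R) :
  row_of x = \row_j ((\row_i corner i) 0 j + (\row_i side i) 0 j * local_coord Q x 0 j).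
Proof.
apply/rowP => j; rewrite !mxE mulrC divfK ?gt_eqF ?side_gt0//.
by rewrite addrC subrK.
Qed.

(** A box of side [delta] inside the ball of radius [delta] about [y], in local
   coordinates; in each direction it extends from [y] towards the centre of the
   cube, so as to stay in the cube. *)
Definition ball_edge (y : 'rV[R]_d) (delta : R) j : set R :=
  let lo := if y 0 j <= 2^-1 then y 0 j else y 0 j - delta in
  [set` `[corner j + side j * lo, corner j + side j * (lo + delta)[ ].

Definition ball_box (y : 'rV[R]_d) (delta : R) : set (d.-tuple R) :=
  [set x | forall j, ball_edge y delta j (tnth x j)].

Lemma measurable_ball_edge y delta j : measurable (ball_edge y delta j).
Proof. exact: measurable_itv. Qed.

Lemma measurable_ball_box y delta : measurable (ball_box y delta).
Proof. by apply: measurable_box => j; exact: measurable_ball_edge. Qed.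

Section ball_box.
Variables (y : 'rV[R]_d) (delta : R).
Hypotheses (yc : cube y) (d0 : 0 < delta) (d1 : delta <= 2^-1).
Let lo j := if y 0 j <= 2^-1 then y 0 j else y 0 j - delta.

Let lo_bounds j : [/\ 0 <= lo j, lo j + delta <= 1, y 0 j - delta <= lo j & lo j <= y 0 j].
Proof.
rewrite /lo; have /andP[? ?] := yc j; move: d0 d1 => ? ?.
by case: ifPn => [l|]; [split; lra|rewrite -ltNge => l; split; lra].
Qed.

Lemma lebesgue_ball_box :
  lebesgue_cube R d (ball_box y delta) = (delta ^+ d / #|{: cell s}|%:R)%:E.
Proof.
rewrite /ball_box (iid_box _ (measurable_ball_edge y delta)).
transitivity (\prod_(j < d) (delta * side j)%:E)%E.
  apply: eq_bigr => j _; have [l0 l1 _ _] := lo_bounds j; have s0 := side_gt0 j.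
  rewrite /ball_edge /= -/(lo j) unif01_itv.
  - by rewrite opprD addrACA subrr add0r -mulrBr addrC addKr mulrC.
  - by rewrite addr_ge0 ?corner_ge0// mulr_ge0// ltW.
  - by rewrite lerD2l ler_wpM2l ?(ltW s0)// lerDl ltW.
  - apply: le_trans (corner_side_le1 j); rewrite lerD2l.
    by rewrite -[leRHS]mulr1 ler_wpM2l// ltW.
by rewrite prod_EFin big_split/= prodr_const card_ord prod_side.
Qed.

Lemma ball_box_sub x : ball_box y delta x ->
  in_cell Q x /\ `|local_coord Q x - y| <= delta.
Proof.
move=> h.
have H j : side j * lo j <= tnth x j - corner j < side j * (lo j + delta).
  by have := h j; rewrite /ball_edge /= in_itv/= -/(lo j) -lerBrDl -ltrBlDl.
split.
  apply/forallP => j; have [l0 l1 _ _] := lo_bounds j; have s0 := side_gt0 j.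
  have /andP[h1 h2] := H j.
  rewrite -subr_ge0 (le_trans _ h1) ?mulr_ge0 ?(ltW s0)//= -ltrBlDl (lt_le_trans h2)//.
  by rewrite -[leRHS]mulr1 ler_wpM2l// ltW.
apply/norm_rV_le; first exact: ltW.
move=> j; rewrite !mxE; have [l0 l1 l2 l3] := lo_bounds j; have s0 := side_gt0 j.
have /andP[] := H j; rewrite -ler_pdivlMl// -ltr_pdivrMl// ![_^-1 * _]mulrC => h1 h2.
by rewrite ler_norml; apply/andP; split; lra.
Qed.

End ball_box.
End cells.

Section design.
Context {R : realType} {d : nat}.
Variable th : param R d.
Local Open Scope ereal_scope.

Lemma design_law_ge (plo : R) (A : set (d.-tuple R)) : measurable A -> (0 <= plo)%R ->
  (forall x, A x -> (plo <= dens th x)%R) ->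
  plo%:E * lebesgue_cube R d A <= design_law th A.
Proof.
move=> mA p0 Ap; rewrite -integral_cst//; apply: ge0_le_integral => //.
- exact/measurable_EFinP/measurable_funTS.
Qed.

Lemma design_law_le (phi : R) (A : set (d.-tuple R)) : measurable A ->
  (forall x, A x -> (dens th x <= phi)%R) ->
  design_law th A <= phi%:E * lebesgue_cube R d A.
Proof.
move=> mA Ap; rewrite -integral_cst//; apply: ge0_le_integral => //.
- by move=> x _; rewrite lee_fin dens_ge0.
- exact/measurable_EFinP/measurable_funTS.
Qed.

End design.

(** * Size of the partition and rates *)

Section partition_size.
Context {R : realType} {d : nat}.

Lemma card_cell (s : 'I_d -> nat) : #|{: cell s}| = (2 ^ (\sum_j s j))%N.
Proof.
rewrite /cell card_dep_ffun foldrE big_map big_enum/=.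
under eq_bigr do rewrite card_ord.
by rewrite expn_sum.
Qed.

(** Rounding the logarithm changes the number of cells by a bounded factor.  The
   constant 1 in the upper bound accounts for small [n], for which there is one
   cell. *)
Lemma log_cells_bounds (lambda0 : R) n : 0 < lambda0 -> (0 < n)%N ->
  n%:R / (2 * lambda0) <= (2 ^ log_cells lambda0 n)%:R <= (1 + 2 / lambda0) * n%:R.
Proof.
move=> l0 n0.
have n0R : 0 < n%:R :> R by rewrite ltr0n.
have n1R : 1 <= n%:R :> R by rewrite ler1n.
have t0 : 0 < n%:R / lambda0 by rewrite divr_gt0.
have ln2 : 0 < ln 2 :> R by rewrite ln_gt0// ltr1n.
set y := ln (n%:R / lambda0) / ln 2.
have tE : n%:R / lambda0 = expR (y * ln 2) by rewrite /y divfK ?gt_eqF// lnK// posrE.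
have two : 2 = expR (ln 2) :> R by rewrite lnK// posrE.
set fl := Num.floor (y + 2^-1).
have /andP[f1 f2] := floor_itv (y + 2^-1); rewrite -/fl in f1 f2.
have rE : (2 ^ log_cells lambda0 n)%:R = expR ((log_cells lambda0 n)%:R * ln 2) :> R.
  by rewrite natrX [in LHS]two -expRM_natl mulrC.
have rz : ((log_cells lambda0 n)%:R = (Num.max 0 fl)%:~R :> R).
  rewrite /log_cells -/y -/fl -[LHS]/((absz _)%:Z%:~R) gez0_abs//.
  by rewrite le_max lexx.
rewrite intrD in f2; rewrite rE rz.
apply/andP; split.
  rewrite (_ : n%:R / (2 * lambda0) = expR ((y - 1) * ln 2)); last first.
    rewrite mulrBl mul1r expRB -tE -two; field.
    by rewrite gt_eqF.
  rewrite ler_expR ler_wpM2r ?(ltW ln2)//.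
  have : fl%:~R <= (Num.max 0 fl)%:~R :> R by rewrite ler_int le_max lexx orbT.
  move: f2; clear; clearbody y fl; move: (fl%:~R) ((Num.max 0 fl)%:~R) => a b; lra.
have [fl0|fl0] := leP 0 fl; last first.
  rewrite mul0r expR0; apply: le_trans n1R _.
  by rewrite ler_peMl ?ler0n// lerDl divr_ge0// ltW.
apply: (@le_trans _ _ (2 * (n%:R / lambda0))).
  rewrite (_ : 2 * (n%:R / lambda0) = expR ((1 + y) * ln 2)); last first.
    by rewrite [in RHS]mulrDl [in RHS]mul1r expRD -two -tE.
  rewrite ler_expR.
  rewrite ler_wpM2r ?(ltW ln2)//; move: f1; clear; clearbody y fl.
  by move: (fl%:~R) => a; lra.
by rewrite [leRHS]mulrDl mul1r mulrA [2 / _ * _]mulrAC lerDr ltW.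
Qed.

(** All the sides are within a factor 2 of each other, so the largest one,
   raised to the power [d], is at most 2^d times the volume of the cell. *)
Lemma cell_side_le (s : 'I_d -> nat) (H : R) j : (0 < d)%N -> 0 <= H ->
  (forall i j, (s i <= (s j).+1)%N) ->
  2 ^+ d / (2 ^ (\sum_j s j))%:R <= H ^+ d -> cell_side s j <= H.
Proof.
move=> d0 H0 sij; apply: contraTT; rewrite -!ltNge => Hs.
have : H ^+ d < cell_side s j ^+ d by rewrite ltr_pXn2r ?nnegrE// (ltW (side_gt0 _ _)).
move=> /lt_le_trans; apply.
rewrite /cell_side exprVn -natrX -expnM -natrX.
rewrite ler_pdivlMr ?ltr0n ?expn_gt0//.
rewrite mulrC ler_pdivrMr ?ltr0n ?expn_gt0// -natrM ler_nat -expnD leq_exp2l//.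
apply: (@leq_trans (\sum_(i < d) (s j).+1)%N); first exact: leq_sum.
by rewrite sum_nat_const card_ord mulnC mulSn addnC.
Qed.

End partition_size.

Section rates.
Context {R : realType}.
Variables (d : nat) (bb : R).
Hypotheses (hbb : 1 < bb) (hd : 4 * bb < d%:R).

Definition lr_exponent : R := 4 * (bb + 1) / (d%:R + 4).

(** a_star is such that 1 - d a_star = lr_exponent. *)
Lemma bandwidth_variance (ce : R) (eps : R) n : (0 < n)%N -> 0 < ce ->
  ce * n%:R `^ (- a_star d bb) <= eps ->
  ce ^+ d * n%:R `^ lr_exponent <= n%:R * eps ^+ d.
Proof.
move=> n0 c0 he.
have d0 : 0 < d%:R :> R by move: hbb hd => ? ?; lra.
have n0R : 0 < n%:R :> R by rewrite ltr0n.
have -> : lr_exponent = 1 + (- a_star d bb) * d%:R.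
  by rewrite /lr_exponent /a_star; field; apply/andP; split; rewrite gt_eqF// ltr_wpDr.
rewrite powRD; last by apply/implyP => _; rewrite gt_eqF.
rewrite powRr1 ?ler0n// powRrM powR_mulrn ?powR_ge0// mulrCA -exprMn.
rewrite ler_wpM2l ?ler0n// lerXn2r ?nnegrE// ?mulr_ge0 ?powR_ge0 ?(ltW c0)//.
by apply: le_trans he; rewrite mulr_ge0 ?powR_ge0// ltW.
Qed.

(** a_star is such that 4 (bb / d + a_star) = lr_exponent. *)
Lemma bandwidth_bias (ce' eps H cH : R) n : (0 < n)%N -> 0 <= cH -> 0 <= eps ->
  eps <= ce' * n%:R `^ (- a_star d bb) -> H = cH * n%:R `^ (- d%:R^-1) ->
  (H `^ bb * eps) ^+ 4 <= (cH `^ bb * ce') ^+ 4 * n%:R `^ (- lr_exponent).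
Proof.
move=> n0 c0 e0 he ->.
have d0 : 0 < d%:R :> R by move: hbb hd => ? ?; lra.
have n0R : 0 < n%:R :> R by rewrite ltr0n.
have -> : n%:R `^ (- lr_exponent) = (n%:R `^ (- d%:R^-1 * bb) * n%:R `^ (- a_star d bb)) ^+ 4.
  rewrite -powRD; last by apply/implyP => _; rewrite gt_eqF.
  rewrite -powR_mulrn ?powR_ge0// -powRrM; congr (_ `^ _).
  by rewrite /lr_exponent /a_star; field; apply/andP; split; rewrite gt_eqF// ltr_wpDr.
rewrite -exprMn lerXn2r ?nnegrE ?mulr_ge0 ?powR_ge0//.
- by rewrite -(pmulr_lge0 _ (powR_gt0 (- a_star d bb) n0R)) (le_trans e0).
- rewrite powRM ?powR_ge0// -powRrM -!mulrA ler_wpM2l ?powR_ge0//.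
  by rewrite mulrCA ler_wpM2l ?powR_ge0.
Qed.

End rates.

(** * Residual projection of a least-squares fit *)

Section residual_projection.
Context {R : realType}.
Variables (N q : nat) (Phi : 'M[R]_(N, q)) (k : R).
Local Notation G := (Phi^T *m Phi).
Hypotheses (k0 : 0 < k) (hk : forall x : 'rV[R]_q, k * sqn x <= qform G x x).

Lemma gram_sym : G^T = G.
Proof. by rewrite trmx_mul trmxK. Qed.

Lemma gram_unit : G \in unitmx.
Proof.
rewrite -row_free_unit -kermx_eq0; apply/rowV0P => v /sub_kermxP vG.
apply/eqP; rewrite -sqn_eq0 eq_le sqn_ge0 andbT.
by rewrite -(pmulr_rle0 _ k0); apply: (le_trans (hk v)); rewrite /qform vG mul0mx mxE.
Qed.

Definition resid : 'M[R]_N := 1%:M - Phi *m invmx G *m Phi^T.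

Lemma resid_Phi : resid *m Phi = 0.
Proof.
by rewrite mulmxBl mul1mx -!mulmxA mulVmx ?gram_unit// mulmx1 subrr.
Qed.

Lemma resid_sym : resid^T = resid.
Proof.
rewrite linearB/= trmx1; congr (_ - _).
by rewrite !trmx_mul trmxK trmx_inv gram_sym mulmxA.
Qed.

Lemma resid_idem : resid *m resid = resid.
Proof. by rewrite {2}/resid mulmxBr mulmx1 !mulmxA resid_Phi !mul0mx subr0. Qed.

Lemma inv_gram_dot (y : 'rV[R]_q) :
  qform (invmx G) y y = qform G (y *m invmx G) (y *m invmx G).
Proof.
rewrite /qform mulmxKV ?gram_unit// trmx_mul trmx_inv gram_sym.
by rewrite mulmxA.
Qed.

Lemma inv_gram_le (y : 'rV[R]_q) : k ^+ 2 * sqn (y *m invmx G) <= sqn y.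
Proof.
set v := y *m invmx G.
have vy : qform G v v = \sum_i y 0 i * v 0 i.
  by rewrite /qform mulmxKV ?gram_unit// mxE; apply: eq_bigr => i _; rewrite [v^T _ _]mxE.
have [v0|v0] := eqVneq (sqn v) 0; first by rewrite v0 mulr0 sqn_ge0.
have vp : 0 < sqn v by rewrite lt_def v0 sqn_ge0.
have h1 := hk v; have h2 := CS_qform1 y v; rewrite -vy in h2.
have h3 : (k * sqn v) ^+ 2 <= sqn y * sqn v.
  have p0 : 0 <= k * sqn v by rewrite mulr_ge0 ?sqn_ge0 ?ltW.
  by apply: le_trans h2; rewrite ler_sqr ?nnegrE// (le_trans p0 h1).
by rewrite -(ler_pM2r vp) -mulrA -expr2 -exprMn.
Qed.

Lemma inv_gram_form (y : 'rV[R]_q) : k * qform (invmx G) y y <= sqn y.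
Proof.
set v := y *m invmx G.
have vy : qform (invmx G) y y = \sum_i y 0 i * v 0 i.
  rewrite /qform -/v mxE; apply: eq_bigr => i _; by rewrite [y^T _ _]mxE mulrC.
have h1 : k * sqn v <= qform (invmx G) y y by rewrite inv_gram_dot.
have h2 := CS_qform1 y v; rewrite -vy in h2.
have q0 : 0 <= qform (invmx G) y y by apply: le_trans h1; rewrite mulr_ge0 ?sqn_ge0 ?ltW.
have [z|nz] := eqVneq (qform (invmx G) y y) 0; first by rewrite z mulr0 sqn_ge0.
have qp : 0 < qform (invmx G) y y by rewrite lt_def nz q0.
rewrite -(ler_pM2r qp) -mulrA -expr2.
apply: (le_trans (ler_wpM2l (ltW k0) h2)); rewrite mulrCA.
by rewrite ler_wpM2l ?sqn_ge0.
Qed.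

Variable e : 'cV[R]_N.

Lemma resid_norm : (e^T *m resid *m e) 0 0 = \sum_r ((resid *m e) r 0) ^+ 2.
Proof.
rewrite -{1}resid_idem mulmxA -mulmxA mxE; apply: eq_bigr => r _.
rewrite expr2; congr (_ * _).
by rewrite -[in LHS]resid_sym -trmx_mul mxE.
Qed.

(** The projection removes from [e] a part of squared norm
   e^T Phi G^-1 Phi^T e, and G^-1 is at most 1/k. *)
Lemma resid_form_ge : k * (\sum_r e r 0 ^+ 2 - (e^T *m resid *m e) 0 0) <= sqn (e^T *m Phi).
Proof.
apply: le_trans (inv_gram_form _); rewrite ler_wpM2l ?(ltW k0)//; apply: le_of_eq.
rewrite /resid mulmxBr mulmxBl mulmx1 [X in _ - X]mxE [X in _ - (_ + X)]mxE.
rewrite [in X in _ - (X + _)]mxE.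
rewrite (_ : \sum_j e^T 0 j * e j 0 = \sum_r e r 0 ^+ 2); last first.
  by apply: eq_bigr => j _; rewrite mxE expr2.
by rewrite opprB addrCA subrr addr0 /qform trmx_mul trmxK !mulmxA.
Qed.

Lemma resid_dual_le (rho : 'cV[R]_N) :
  k ^+ 2 * ((e^T *m resid *m rho) 0 0 - \sum_r e r 0 * rho r 0) ^+ 2
  <= sqn (e^T *m Phi) * sqn (rho^T *m Phi).
Proof.
have -> : (e^T *m resid *m rho) 0 0 - \sum_r e r 0 * rho r 0
   = - \sum_i (e^T *m Phi) 0 i * (rho^T *m Phi *m invmx G) 0 i.
  rewrite /resid mulmxBr mulmxBl mulmx1 [X in X - _]mxE [X in _ + X - _]mxE.
  rewrite [in X in X + _ - _]mxE.
  rewrite (_ : \sum_j e^T 0 j * rho j 0 = \sum_r e r 0 * rho r 0); last first.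
    by apply: eq_bigr => j _; rewrite mxE.
  rewrite addrAC subrr add0r; congr (- _).
  have E : invmx G *m (Phi^T *m rho) = (rho^T *m Phi *m invmx G)^T.
    by rewrite !trmx_mul trmxK trmx_inv gram_sym.
  rewrite !mulmxA -(mulmxA _ _ rho) -(mulmxA _ _ (Phi^T *m rho)) E mxE.
  by apply: eq_bigr => i _; congr (_ * _); rewrite mxE.
rewrite sqrrN.
apply: (le_trans (ler_wpM2l (sqr_ge0 k) (CS_qform1 _ _))).
by rewrite mulrCA ler_wpM2l ?sqn_ge0// inv_gram_le.
Qed.

End residual_projection.

(** * Witness contrasts *)

Section witness_contrast.
Context {R : realType} {d n q : nat}.
Variables (psi : 'I_q -> mpoly.mpoly d R) (s : 'I_d -> nat).
Variables (kappa v0 eps : R).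

(** The selection rule and the contrasts depend on the sample only through the
   design points [pt]. *)
Section design_points.
Variables (pt : 'I_n -> d.-tuple R) (Q : cell s).

Definition pidx : {set 'I_n} := finset (fun i => in_cell Q (pt i)).
Notation N := #|pidx|.
Definition ploc (r : 'I_N) : 'rV[R]_d := local_coord Q (pt (enum_val r)).
Definition pPhi : 'M[R]_(N, q) := \matrix_(r, k) peval (psi k) (ploc r).
Definition pdiff (e : 'I_N * 'I_N) : 'cV[R]_N := delta_mx e.1 0 - delta_mx e.2 0.
Definition pform (e : 'I_N * 'I_N) : R := ((pdiff e)^T *m resid pPhi *m pdiff e) 0 0.
Definition pwell : bool := kappa <= lambda_min (N%:R^-1 *: (pPhi^T *m pPhi)).
Definition ppairs : seq ('I_N * 'I_N) :=
  [seq e : 'I_N * 'I_N <- [seq (r, r') | r <- enum 'I_N, r' <- enum 'I_N] |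
    [&& (e.1 < e.2)%N, `|ploc e.1 - ploc e.2| <= eps & v0 <= pform e]].
Definition pselected : bool := [&& N == q.+2, pwell & ppairs != [::]].
Definition pcontrast (e : 'I_N * 'I_N) : 'cV[R]_N :=
  (Num.sqrt (pform e))^-1 *: (resid pPhi *m pdiff e).
(** The contrast as a function on the whole sample, so that contrasts of
   different cells can be compared. *)
Definition pweight (i : 'I_n) : R :=
  if ppairs is e :: _ then \sum_(r | enum_val r == i) pcontrast e r 0 else 0.

Lemma sum_enum_val (G : R -> 'I_n -> R) (c : 'I_N -> R) : (forall i, G 0 i = 0) ->
  \sum_i G (\sum_(r | enum_val r == i) c r) i = \sum_r G (c r) (enum_val r).
Proof.
move=> G0; rewrite (bigID (mem pidx))/= [X in _ + X]big1 ?addr0; last first.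
  move=> i iI; rewrite big_pred0 ?G0// => r; apply/negbTE; apply: contraNneq iI => <-.
  exact: enum_valP.
rewrite big_enum_val; apply: eq_bigr => r _.
rewrite (big_pred1 r)// => r'; exact: (inj_eq enum_val_inj).
Qed.

End design_points.

Lemma selected_pt (z : sample (R := R) (d := d) n) Q :
  selected psi kappa v0 eps z Q = pselected (fun i => (tnth z i).1) Q.
Proof. by []. Qed.

Lemma cell_term_pt (z : sample (R := R) (d := d) n) Q :
  cell_term psi v0 eps z Q
  = (\sum_i pweight (fun i => (tnth z i).1) Q i * (tnth z i).2) ^+ 2.
Proof.
rewrite /cell_term /pweight -[close_pairs _ _ _ _ _]/(ppairs (fun i => (tnth z i).1) Q).
case: ppairs => [|e _]; first by rewrite big1 ?expr0n// => i _; rewrite mul0r.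
rewrite (sum_enum_val (G := fun c i => c * (tnth z i).2)); last by move=> i; rewrite mul0r.
congr (_ ^+ 2); rewrite mxE; apply: eq_bigr => r _.
by rewrite [X in X * _]mxE [X in _ * X]mxE.
Qed.

Section selected.
Variables (pt : 'I_n -> d.-tuple R) (Q : cell s).
Hypotheses (kappa0 : 0 < kappa) (q0 : (0 < q)%N) (v00 : 0 < v0).
Notation N := #|pidx pt Q|.
Notation loc := (@ploc pt Q).
Notation Phi := (pPhi pt Q).

Lemma pwell_qform : (0 < N)%N ->
  pwell pt Q <-> forall x, kappa * N%:R * sqn x <= qform ((pPhi pt Q)^T *m pPhi pt Q) x x.
Proof.
move=> N0; have N0' : 0 < N%:R :> R by rewrite ltr0n.
rewrite /pwell lambda_minP//; last by rewrite linearZ/= gram_sym.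
have E x : qform (N%:R^-1 *: ((pPhi pt Q)^T *m pPhi pt Q)) x x
    = N%:R^-1 * qform ((pPhi pt Q)^T *m pPhi pt Q) x x.
  by rewrite /qform -scalemxAr -scalemxAl mxE.
split=> h x.
  by have := h x; rewrite E ler_pdivlMl// mulrA [_ * kappa]mulrC.
by rewrite E ler_pdivlMl// mulrA [_ * kappa]mulrC.
Qed.

Lemma gram_qform x : qform ((pPhi pt Q)^T *m pPhi pt Q) x x
  = \sum_r (\sum_j x 0 j * peval (psi j) (loc r)) ^+ 2.
Proof.
have -> : qform ((pPhi pt Q)^T *m pPhi pt Q) x x = sqn (x *m (pPhi pt Q)^T).
  by rewrite /qform sqnE /qform mulmx1 trmx_mul trmxK !mulmxA.
apply: eq_bigr => r _; rewrite mxE; congr (_ ^+ 2); apply: eq_bigr => j _.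
by rewrite !mxE.
Qed.

Lemma ploc_cube r : cube (loc r).
Proof. by apply: local_coord_cube; have := enum_valP r; rewrite inE; exact. Qed.

Lemma pdiff_sum (e : 'I_N * 'I_N) (F : 'I_N -> R) :
  \sum_r pdiff e r 0 * F r = F e.1 - F e.2.
Proof.
have D (a : 'I_N) : \sum_r (delta_mx a 0 : 'cV[R]_N) r 0 * F r = F a.
  rewrite (bigD1 a)//= big1 ?addr0; first by rewrite mxE !eqxx mul1r.
  by move=> r ra; rewrite mxE (negbTE ra) mul0r.
rewrite -(D e.1) -(D e.2) -sumrB; apply: eq_bigr => r _.
by rewrite -mulrBl; congr (_ * _); rewrite [LHS]mxE; congr (_ + _); rewrite mxE.
Qed.

Lemma pdiff_sq (e : 'I_N * 'I_N) : (e.1 < e.2)%N -> \sum_r pdiff e r 0 ^+ 2 = 2.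
Proof.
move=> e12; have ne : e.1 != e.2 by rewrite -(inj_eq val_inj) ltn_eqF.
under eq_bigr do rewrite expr2.
rewrite pdiff_sum /pdiff !mxE !eqxx (negbTE ne) eq_sym (negbTE ne) /=.
by lra.
Qed.

Variable B : R.
Hypotheses (B0 : 0 <= B)
  (Bbd : forall u, cube u -> \sum_k peval (psi k) u ^+ 2 <= B)
  (Blip : forall u v, cube u -> cube v ->
     \sum_k (peval (psi k) u - peval (psi k) v) ^+ 2 <= B * `|u - v| ^+ 2).

Lemma pdiff_Phi (e : 'I_N * 'I_N) : `|loc e.1 - loc e.2| <= eps ->
  sqn ((pdiff e)^T *m Phi) <= B * eps ^+ 2.
Proof.
move=> he; apply: (@le_trans _ _ (B * `|loc e.1 - loc e.2| ^+ 2)); last first.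
  by rewrite ler_wpM2l// ler_sqr ?nnegrE// (le_trans _ he).
apply: le_trans (Blip (ploc_cube e.1) (ploc_cube e.2)).
apply: le_of_eq; apply: eq_bigr => k _.
rewrite mxE; congr (_ ^+ 2).
rewrite -(pdiff_sum e (fun r => peval (psi k) (loc r))); apply: eq_bigr => r _.
by rewrite [X in X * _]mxE [X in _ * X]mxE.
Qed.

Section well_conditioned.
Hypotheses (N0 : (0 < N)%N) (well : pwell pt Q).

Let k0 : 0 < kappa * N%:R. Proof. by rewrite mulr_gt0// ltr0n. Qed.
Let hk := (pwell_qform N0).1 well.

(** The basis takes nearly equal values at two close points, so [pdiff e], of
   squared norm 2, is almost orthogonal to the columns of Phi. *)
Lemma pform_ge1 (e : 'I_N * 'I_N) : (e.1 < e.2)%N -> `|loc e.1 - loc e.2| <= eps ->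
  B * eps ^+ 2 <= kappa * N%:R -> 1 <= pform e.
Proof.
move=> e12 he Be.
have := resid_form_ge k0 hk (pdiff e); rewrite -/(pform e) pdiff_sq//.
move=> /le_trans/(_ (pdiff_Phi he))/le_trans/(_ Be).
by rewrite -[leRHS]mulr1 ler_pM2l//; lra.
Qed.

Lemma ppairs_head : if ppairs pt Q is e :: _ then
  `|loc e.1 - loc e.2| <= eps /\ v0 <= pform e else True.
Proof.
case E : ppairs => [//|e l]; have : e \in ppairs pt Q by rewrite E inE eqxx.
by rewrite mem_filter => /andP[/and3P[_ ? ?] _].
Qed.

Lemma pweight_norm : ppairs pt Q != [::] -> \sum_i pweight pt Q i ^+ 2 = 1.
Proof.
have := ppairs_head; rewrite /pweight; case: ppairs => // e _ [_ ve] _.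
rewrite (sum_enum_val (G := fun c _ => c ^+ 2)); last by move=> _; rewrite expr0n.
have f0 : 0 < pform e by exact: lt_le_trans ve.
under eq_bigr do rewrite mxE exprMn.
rewrite -mulr_sumr -(resid_norm k0 hk) -/(pform e) exprVn sqr_sqrtr ?(ltW f0)//.
by rewrite mulVf// gt_eqF.
Qed.

Lemma pweight_notin i : i \notin pidx pt Q -> pweight pt Q i = 0.
Proof.
move=> iI; rewrite /pweight; case: ppairs => // e _; rewrite big_pred0// => r.
by apply/negbTE; apply: contraNneq iI => <-; exact: enum_valP.
Qed.

(** The contrast annihilates the polynomial part.  On the remainder, the
   difference vector contributes the increment of [rho] over a close pair, and the
   correction by the projection is controlled by the size of [rho] times the
   increment of the basis over the pair. *)
Lemma pweight_bias k (p : mpoly.mpoly d R) (M : R) (F : 'I_n -> R) :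
  poly_basis k psi -> (mpoly.msize p <= k.+1)%N -> 0 <= M -> 0 <= eps ->
  let rho r := F (enum_val r) - peval p (loc r) in
  (forall r, `|rho r| <= M) ->
  (forall r r', `|rho r - rho r'| <= M * `|loc r - loc r'|) ->
  (\sum_i pweight pt Q i * F i) ^+ 2 <= (2 + 2 * (B / kappa) ^+ 2) / v0 * (M * eps) ^+ 2.
Proof.
move=> [_ psiU] pk M0 eps0 rho rhoM rhoL.
have C0 : 0 <= (2 + 2 * (B / kappa) ^+ 2) / v0 * (M * eps) ^+ 2.
  by rewrite mulr_ge0 ?sqr_ge0// divr_ge0 ?(ltW v00)// addr_ge0// mulr_ge0// sqr_ge0.
have := ppairs_head; rewrite /pweight; case: ppairs => [|e _].
  by move=> _; rewrite big1 ?expr0n// => i _; rewrite mul0r.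
move=> [he ve].
rewrite (sum_enum_val (G := fun c i => c * F i)); last by move=> i; rewrite mul0r.
have f0 : 0 < pform e by exact: lt_le_trans ve.
have [c [pE _]] := psiU p pk.
pose rv : 'cV[R]_N := \col_r rho r.
have FE : (\col_r F (enum_val r) : 'cV[R]_N) = Phi *m c^T + rv.
  apply/colP => r; rewrite !mxE /rho.
  have -> : \sum_j Phi r j * c^T j 0 = peval p (loc r).
    rewrite pE /peval raddf_sum; apply: eq_bigr => j _ /=.
    by rewrite mpoly.mevalZ !mxE mulrC.
  by rewrite addrC subrK.
have -> : \sum_r pcontrast e r 0 * F (enum_val r)
    = (Num.sqrt (pform e))^-1 * ((pdiff e)^T *m resid Phi *m rv) 0 0.
  transitivity ((Num.sqrt (pform e))^-1 *
     ((pdiff e)^T *m resid Phi *m (\col_r F (enum_val r) : 'cV[R]_N)) 0 0).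
    rewrite mxE mulr_sumr; apply: eq_bigr => r _.
    rewrite [X in X * _]mxE -mulrA [X in _ = _ * (_ * X)]mxE; congr (_ * (_ * _)).
    by rewrite -[in RHS](resid_sym Phi) -trmx_mul [RHS]mxE.
  by rewrite FE mulmxDr mulmxA -(mulmxA _ _ Phi) (resid_Phi k0 hk) mulmx0 mul0mx add0r.
rewrite exprMn exprVn sqr_sqrtr ?(ltW f0)//.
set T := ((pdiff e)^T *m _ *m rv) 0 0.
suff TB : T ^+ 2 <= (2 + 2 * (B / kappa) ^+ 2) * (M * eps) ^+ 2.
  rewrite mulrC -mulrA [X in _ <= _ * X]mulrC mulrA.
  by rewrite ler_pM ?sqr_ge0 ?invr_ge0 ?(ltW f0)// lef_pV2 ?posrE.
pose D := rho e.1 - rho e.2.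
have DB : D ^+ 2 <= (M * eps) ^+ 2.
  rewrite -(real_normK (num_real D)) ler_sqr ?nnegrE ?mulr_ge0//.
  by apply: (le_trans (rhoL _ _)); rewrite ler_wpM2l.
have Drv : \sum_r pdiff e r 0 * rv r 0 = D.
  by rewrite /D -(pdiff_sum e rho); apply: eq_bigr => r _; rewrite [rv _ _]mxE.
have rvPhi : sqn (rv^T *m Phi) <= (N%:R * M) ^+ 2 * B.
  rewrite /sqn; apply: (@le_trans _ _ (\sum_k N%:R * M ^+ 2 * \sum_r peval (psi k) (loc r) ^+ 2)).
    apply: ler_sum => j _; rewrite mxE.
    rewrite (eq_bigr (fun r => rho r * peval (psi j) (loc r))); last by move=> r _; rewrite !mxE.
    apply: (le_trans (CS_sum _ _)); rewrite ler_wpM2r//.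
      by apply: sumr_ge0 => r _; exact: sqr_ge0.
    apply: (@le_trans _ _ (\sum_(r < N) M ^+ 2)).
      by apply: ler_sum => r _; rewrite -(real_normK (num_real _)) ler_sqr ?nnegrE.
    by rewrite sumr_const card_ord -[leLHS]mulr_natl.
  rewrite -mulr_sumr exchange_big/=.
  rewrite (_ : (N%:R * M) ^+ 2 * B = N%:R * M ^+ 2 * (N%:R * B)); last ring.
  rewrite ler_wpM2l ?mulr_ge0 ?sqr_ge0//.
  apply: (@le_trans _ _ (\sum_(r < N) B)); last by rewrite sumr_const card_ord mulr_natl.
  by apply: ler_sum => r _; apply: Bbd; exact: ploc_cube.
have h := resid_dual_le k0 hk (pdiff e) rv.
rewrite Drv -/T in h.
have {}h : (T - D) ^+ 2 <= (B / kappa) ^+ 2 * (M * eps) ^+ 2.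
  have kN : 0 < (kappa * N%:R) ^+ 2 by rewrite exprn_gt0.
  rewrite -(ler_pM2l kN); apply: (le_trans h).
  apply: (le_trans (ler_pM (sqn_ge0 _) (sqn_ge0 _) (pdiff_Phi he) rvPhi)).
  apply: le_of_eq; field.
  by rewrite gt_eqF.
have tri (x y : R) : x ^+ 2 <= 2 * y ^+ 2 + 2 * (x - y) ^+ 2.
  by have := sqr_ge0 (x - 2 * y); lra.
apply: (le_trans (tri T D)); rewrite [leRHS]mulrDl.
by rewrite lerD ?ler_wpM2l// -mulrA ler_wpM2l.
Qed.

End well_conditioned.
End selected.
End witness_contrast.

(** * A configuration of points that forces the selection of a cell *)

Section configuration.
Context {R : realType} {d q : nat}.
Variables (psi : 'I_q -> mpoly.mpoly d R).

Lemma basis_bound : exists2 B : R, 0 <= B &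
  (forall u, cube u -> \sum_k peval (psi k) u ^+ 2 <= B) /\
  (forall u v, cube u -> cube v ->
     \sum_k (peval (psi k) u - peval (psi k) v) ^+ 2 <= B * `|u - v| ^+ 2).
Proof.
have /choice[C CP] : forall k, exists C : R, 0 <= C /\
   ((forall u, cube u -> `|peval (psi k) u| <= C) /\
    (forall u v, cube u -> cube v -> `|peval (psi k) u - peval (psi k) v| <= C * `|u - v|)).
  by move=> k; have [C C0 h] := peval_lipschitz (psi k); exists C.
exists (\sum_k C k ^+ 2); first by apply: sumr_ge0 => k _; exact: sqr_ge0.
split=> [u cu|u v cu cv].
  apply: ler_sum => k _; have [C0 [h _]] := CP k.
  by rewrite -(real_normK (num_real _)) ler_sqr ?nnegrE ?h.
rewrite mulr_suml; apply: ler_sum => k _; have [C0 [_ h]] := CP k.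
by rewrite -(real_normK (num_real _)) -exprMn ler_sqr ?nnegrE ?h ?mulr_ge0.
Qed.

Variables (s : 'I_d -> nat) (w : 'I_q -> 'rV[R]_d) (delta eps : R).

(** The first [q] points, being near unisolvent ones, make the Gram matrix well
   conditioned; the last two provide a close pair. *)
Definition goodseq (Q : cell s) (t : seq (d.-tuple R)) : bool :=
  [&& size t == q.+2,
    [forall k : 'I_q, `|local_coord Q (nth point t k) - w k| <= delta] &
    `|local_coord Q (nth point t q) - local_coord Q (nth point t q.+1)| <= eps].

Lemma filter_pidx n (xs : n.-tuple (d.-tuple R)) (Q : cell s) :
  seq.filter (in_cell Q) xs = [seq tnth xs i | i <- enum (pidx (tnth xs) Q)].
Proof.
rewrite -[in LHS](map_tnth_enum xs) filter_map; congr map.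
rewrite enumT [RHS]/enum_mem; apply: eq_filter => i.
by rewrite /= inE.
Qed.

Lemma nth_filter_pidx n (xs : n.-tuple (d.-tuple R)) (Q : cell s) (r : 'I_#|pidx (tnth xs) Q|) :
  nth point (seq.filter (in_cell Q) xs) r = tnth xs (enum_val r).
Proof.
rewrite filter_pidx (nth_map (enum_val r)) -?cardE ?ltn_ord//.
by rewrite -enum_val_nth.
Qed.

Lemma goodseq_selected n (xs : n.-tuple (d.-tuple R)) (Q : cell s) (kap B : R) :
  (0 < q)%N -> 0 < kap -> 0 <= B ->
  (forall u, cube u -> \sum_k peval (psi k) u ^+ 2 <= B) ->
  (forall u v, cube u -> cube v ->
     \sum_k (peval (psi k) u - peval (psi k) v) ^+ 2 <= B * `|u - v| ^+ 2) ->
  (forall w', (forall r, cube (w' r)) -> (forall r, `|w' r - w r| <= delta) ->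
   forall c : 'rV[R]_q,
     kap * sqn c <= \sum_r (\sum_j c 0 j * peval (psi j) (w' r)) ^+ 2) ->
  B * eps ^+ 2 <= kap ->
  goodseq Q (seq.filter (in_cell Q) xs) ->
  pselected psi (kap / q.+2%:R) 1 eps (tnth xs) Q.
Proof.
move=> q0 kap0 B0 Bbd Blip wP Be /and3P[/eqP szt /forallP hw hqq].
have NE : #|pidx (tnth xs) Q| = q.+2.
  by rewrite -szt filter_pidx size_map -cardE.
have locE (k : nat) (r : 'I_#|pidx (tnth xs) Q|) : k = r ->
    local_coord Q (nth point (seq.filter (in_cell Q) xs) k) = ploc r.
  by move=> ->; rewrite nth_filter_pidx.
have kq (k : 'I_q) : (k < #|pidx (tnth xs) Q|)%N.
  by rewrite NE (leq_trans (ltn_ord k))// -addn2 leq_addr.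
pose f (k : 'I_q) : 'I_#|pidx (tnth xs) Q| := Ordinal (kq k).
have finj : injective f by move=> a b /(congr1 val)/= ab; exact: val_inj.
have well : pwell psi (kap / q.+2%:R) (tnth xs) Q.
  apply/pwell_qform => //; first by rewrite NE.
  move=> x; rewrite gram_qform.
  have -> : kap / q.+2%:R * #|pidx (tnth xs) Q|%:R = kap by rewrite NE divfK// pnatr_eq0.
  apply: (le_trans (wP (fun k => ploc (f k)) _ _ x)).
  - by move=> k; exact: ploc_cube.
  - by move=> k; rewrite -(locE k (f k))//; exact: hw.
  pose F r := (\sum_j x 0 j * peval (psi j) (@ploc _ _ _ _ (tnth xs) Q r)) ^+ 2.
  rewrite -[leLHS](big_imset F (h := f) (A := predT)); last by move=> a b _ _; exact: finj.
  rewrite [leRHS](bigID (mem (imset f (mem predT))))/= lerDl.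
  by apply: sumr_ge0 => r _; exact: sqr_ge0.
have q1 : (q < #|pidx (tnth xs) Q|)%N by rewrite NE -addn2 -addn1 leq_add2l.
have q2 : (q.+1 < #|pidx (tnth xs) Q|)%N by rewrite NE.
pose e := (Ordinal q1, Ordinal q2).
have close : `|@ploc _ _ _ _ (tnth xs) Q e.1 - @ploc _ _ _ _ (tnth xs) Q e.2| <= eps.
  by rewrite -(locE q e.1)// -(locE q.+1 e.2).
apply/and3P; split; [exact/eqP|exact: well|].
have : e \in ppairs psi 1 eps (tnth xs) Q.
  rewrite mem_filter; apply/andP; split.
    rewrite /= ltnSn /= close /=.
    have kp : 0 < kap / q.+2%:R by rewrite divr_gt0.
    have N0 : (0 < #|pidx (tnth xs) Q|)%N by rewrite NE.
    apply: (@pform_ge1 _ _ _ _ _ _ _ _ _ _ kp q0 _ B0 Blip N0 well e _ close).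
      exact: ltnSn.
    by rewrite NE divfK// pnatr_eq0.
  by apply/allpairsP; exists e; split => //; rewrite mem_enum.
by case: ppairs.
Qed.

End configuration.

(** * Concentration of the number of occupied cells *)

Section chebyshev.
Context {dT : measure_display} {T : measurableType dT} {R : realType}.
Variable mu : probability T R.
Local Open Scope ereal_scope.

Lemma chebyshev_half (X : T -> R) (a V : R) : measurable_fun [set: T] X ->
  (forall x, (0 <= X x)%R) -> (0 < a)%R ->
  \int[mu]_x (X x)%:E = a%:E -> \int[mu]_x (X x ^+ 2)%:E <= (a ^+ 2 + V)%:E ->
  \int[mu]_x (if (X x < a / 2)%R then 1 else 0) <= (4 * V / a ^+ 2)%:E.
Proof.
move=> mX X0 a0 EX EX2.
have mX2 : measurable_fun setT (fun x => (X x ^+ 2)%:E).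
  by apply/measurable_EFinP; exact: measurable_funX.
have mXa : measurable_fun setT (fun x => ((X x - a) ^+ 2)%:E).
  by apply/measurable_EFinP; apply: measurable_funX; exact: measurable_funB.
have E : \int[mu]_x (((X x - a) ^+ 2)%:E + (2 * a)%:E * (X x)%:E) =
         \int[mu]_x ((X x ^+ 2)%:E + (a ^+ 2)%:E).
  by apply: eq_integral => x _; rewrite -!EFinM -!EFinD; congr (_%:E); ring.
rewrite ge0_integralD// in E; last 3 first.
- by move=> x _; rewrite lee_fin sqr_ge0.
- by move=> x _; rewrite -EFinM lee_fin !mulr_ge0// ltW.
- by apply: measurable_funeM; exact/measurable_EFinP.
rewrite ge0_integralD// in E; last 2 first.
- by move=> x _; rewrite lee_fin sqr_ge0.
- by move=> x _; rewrite lee_fin sqr_ge0.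
rewrite ge0_integralZl// in E; last 3 first.
- exact/measurable_EFinP.
- by move=> x _; rewrite lee_fin.
- by rewrite lee_fin mulr_ge0// ltW.
rewrite EX integral_cst// [X in _ = _ + _ * X]probability_setT mule1 -EFinM in E.
have VX : \int[mu]_x ((X x - a) ^+ 2)%:E <= V%:E.
  have : \int[mu]_x ((X x - a) ^+ 2)%:E + (2 * a * a)%:E <= (a ^+ 2 + V)%:E + (a ^+ 2)%:E.
    by rewrite E leeD2r.
  rewrite -EFinD -leeBrDr// -EFinB => /le_trans; apply; rewrite lee_fin.
  by rewrite expr2; lra.
apply: (@le_trans _ _ (\int[mu]_x ((4 / a ^+ 2)%:E * ((X x - a) ^+ 2)%:E))).
  apply: ge0_integral_le => x; case: ifPn => // h.
    rewrite -EFinM lee_fin mulrAC ler_pdivlMr ?exprn_gt0// mul1r.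
    have h2 : (0 <= a / 2 - X x)%R by rewrite subr_ge0 ltW.
    have := mulr_ge0 h2 (addr_ge0 h2 (ltW a0)).
    by rewrite !expr2; lra.
  by rewrite -EFinM lee_fin mulr_ge0 ?sqr_ge0// divr_ge0// sqr_ge0.
rewrite ge0_integralZl//; last 2 first.
- by move=> x _; rewrite lee_fin sqr_ge0.
- by rewrite lee_fin divr_ge0// sqr_ge0.
apply: (le_trans (lee_wpmul2l _ VX)); first by rewrite lee_fin divr_ge0// sqr_ge0.
by rewrite -EFinM lee_fin mulrAC.
Qed.

End chebyshev.

Section occupancy.
Context {dT : measure_display} {T : measurableType dT} {R : realType}.
Variable P : probability T R.
Variables (I : finType) (A : I -> pred T) (h : I -> seq T -> bool) (m : nat).
Variables (p : I -> R) (pm phi : R).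
Hypotheses (mA : forall i, measurable_fun [set: T] (A i))
  (disjA : forall i j x, i != j -> A i x -> A j x = false)
  (hsize : forall i t, h i t -> size t = m)
  (mh : forall i, smeas (fun t => (h i t)%:R%:E : \bar R))
  (pE : forall i, P [set x | A i x] = (p i)%:E)
  (ppm : forall i, p i <= pm) (pm0 : 0 <= pm) (pmI : pm * #|I|%:R <= phi).

Local Open Scope ereal_scope.

Let f i t : \bar R := (h i t)%:R%:E.
Let f0 i t : 0 <= f i t. Proof. by rewrite lee_fin. Qed.
Let f1 i t : f i t <= 1. Proof. by rewrite lee_fin; case: (h i t). Qed.
Let fm i t : size t != m -> f i t = 0.
Proof. by rewrite /f; case E : (h i t) => //; rewrite (hsize E) eqxx. Qed.

Lemma selint_le1 (B : pred T) k (g : seq T -> \bar R) :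
  (forall t, 0 <= g t) -> (forall t, g t <= 1) -> selint P B k g <= 1.
Proof.
elim: k g => [|k IH] g g0 g1 /=; first exact: g1.
apply: (@le_trans _ _ (\int[P]_x 1)); last by rewrite integral_cst// [X in _ * X]probability_setT mule1.
apply: ge0_integral_le => x; case: ifP => // _; [exact: selint_ge0|exact: IH].
Qed.

Definition occ_prob i : R := fine (selint P (A i) m (f i)).

Let occ_probE i : selint P (A i) m (f i) = (occ_prob i)%:E.
Proof.
rewrite /occ_prob fineK// ge0_fin_numE; last exact: selint_ge0.
by apply: (le_lt_trans (selint_le1 _ _ (f0 i) (f1 i))); rewrite ltry.
Qed.

Let occ_prob0 i : (0 <= occ_prob i)%R.
Proof. by apply: fine_ge0; exact: selint_ge0. Qed.

Let mset i : measurable [set x | A i x].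
Proof. by have := mA i measurableT (Y := [set true]) Logic.I; rewrite setTI. Qed.

Let p0 i : (0 <= p i)%R. Proof. by rewrite -lee_fin -pE. Qed.

Let integral_compl (B B' : pred T) (b b' : R) :
  measurable [set x | B x] -> measurable [set x | B' x] ->
  (forall x, B x -> B' x = false) -> P [set x | B x] = b%:E -> P [set x | B' x] = b'%:E ->
  \int[P]_x (if B x || B' x then 0 else 1) = (1 - (b + b'))%:E.
Proof.
move=> mB mB' BB' Bb Bb'.
transitivity (\int[P]_x (\1_(~` ([set x | B x] `|` [set x | B' x])) x)%:E).
  apply: eq_integral => x _; rewrite indicE in_setC in_setU.
  rewrite (_ : (x \in [set x | B x]) = B x); last by apply/idP/idP; rewrite inE.
  rewrite (_ : (x \in [set x | B' x]) = B' x); last by apply/idP/idP; rewrite inE.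
  by case: (B x); case: (B' x).
rewrite integral_indic// ?setIT; last by apply: measurableC; exact: measurableU.
transitivity (1 - P ([set x | B x] `|` [set x | B' x])).
  by apply: probability_setC; exact: measurableU.
have -> : P ([set x | B x] `|` [set x | B' x]) = (b + b')%:E; last by rewrite EFinB.
rewrite EFinD -Bb -Bb'; apply: measureU => //.
by apply/seteqP; split => // x [/= /BB' ->].
Qed.

Variable n : nat.
Let t i (z : seq T) : R := (h i (seq.filter (A i) z))%:R.

Definition occ_mean i : R := (('C(n, m))%:R * (1 - p i) ^+ (n - m) * occ_prob i)%R.

Let t_mean i : \int[iid P n]_z (t i z)%:E = (occ_mean i)%:E.
Proof.
pose e (s : seq T) : \bar R := (s == [::])%:R%:E.
have me : smeas e.
  move=> k; case: k => [|k].
    rewrite (_ : (fun _ => _) = cst 1)//; apply/funext => z.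
    by rewrite /e (tuple0 z).
  rewrite (_ : (fun _ => _) = cst 0)//; apply/funext => z.
  by rewrite /e; case: z => -[].
have := @integral_two_sets _ T R P (A i) pred0 (1 - p i) (mA i) (measurable_cst _)
  (fun _ _ => erefl) _ n m 0%N (f i) e (mh i) me (f0 i) _ (@fm i) _.
rewrite /multinom_coef bin0 muln1 subn0 mule1 occ_probE -EFinM => <-.
- apply: eq_integral => z _; rewrite /e.
  by rewrite (_ : seq.filter pred0 z = [::]) ?filter_pred0// mule1.
- rewrite -[in RHS](addr0 (p i)); apply: integral_compl => //.
    by rewrite (_ : [set x | _] = set0)//; apply/seteqP; split.
  by rewrite (_ : [set x | _] = set0) ?measure0//; apply/seteqP; split.
- by move=> s; rewrite lee_fin.
- by case.
Qed.

Let tt_mean i j : i != j -> \int[iid P n]_z (t i z * t j z)%:E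
  = (('C(n, m) * 'C(n - m, m))%:R * (1 - (p i + p j)) ^+ (n - m - m)
      * (occ_prob i * occ_prob j))%:E.
Proof.
move=> ij.
have := @integral_two_sets _ T R P (A i) (A j) (1 - (p i + p j)) (mA i) (mA j)
  (fun x Ax => disjA ij Ax) (integral_compl (mset i) (mset j) (fun x Ax => disjA ij Ax) (pE i) (pE j))
  n m m (f i) (f j) (mh i) (mh j) (f0 i) (f0 j) (@fm i) (@fm j).
by rewrite /multinom_coef !occ_probE -!EFinM => <-.
Qed.

Definition occ_total : R := (\sum_i occ_mean i)%R.
Definition occ_count (z : seq T) : R := (\sum_i t i z)%R.

Let mt i : measurable_fun [set: n.-tuple T] (fun z : n.-tuple T => t i z).
Proof.
have H := @smeas_filter _ _ _ _ _ (mA i) (mh i) n.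
exact: (measurable_EFinP _ _).1 H.
Qed.

Let t0 i z : (0 <= t i z)%R. Proof. by rewrite /t; case: (h _ _). Qed.

Lemma measurable_occ_count : measurable_fun [set: n.-tuple T] (fun z : n.-tuple T => occ_count z).
Proof. by apply: measurable_sum => i; exact: mt. Qed.

Lemma occ_count_mean : \int[iid P n]_z (occ_count z)%:E = occ_total%:E.
Proof.
under eq_integral do rewrite -sumEFin.
rewrite (@ge0_integral_sum _ _ _ (iid P n) _ measurableT _ (fun i (z : n.-tuple T) => (t i z)%:E)).
- by rewrite /occ_total -sumEFin; apply: eq_bigr => i _; exact: t_mean.
- by move=> i; apply/measurable_EFinP; exact: mt.
- by move=> i z _; rewrite lee_fin t0.
Qed.

Hypothesis pm_small : (4 * m%:R * pm <= 1)%R.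

Lemma bernoulli_ineq (x : R) k : (0 <= x <= 1)%R -> (1 - k%:R * x <= (1 - x) ^+ k)%R.
Proof.
move=> /andP[x0 x1]; elim: k => [|k IH]; first by rewrite mul0r subr0 expr0.
rewrite exprS; apply: (@le_trans _ _ ((1 - x) * (1 - k%:R * x))%R).
  rewrite -natr1; have : (0 <= k%:R * x * x)%R by rewrite !mulr_ge0.
  by lra.
by rewrite ler_wpM2l// subr_ge0.
Qed.

(** Occupation of two different cells is nearly independent: the joint
   probability exceeds the product by a factor 1 + O(pm) at most. *)
Let tt_le i j : i != j -> (0 < m)%N -> (('C(n, m) * 'C(n - m, m))%:R * (1 - (p i + p j)) ^+ (n - m - m)
      * (occ_prob i * occ_prob j) <= (1 + 4 * m%:R * pm) * (occ_mean i * occ_mean j))%R.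
Proof.
move=> ij m0; rewrite /occ_mean.
have pmp := pm_small; have pi := ppm i; have pj := ppm j; have pi0 := p0 i; have pj0 := p0 j.
have pmn := pm0; have m1 : (1 <= m%:R :> R)%R by rewrite ler1n.
have mpm : (pm <= m%:R * pm)%R by rewrite ler_peMl.
have x0 : (0 <= 1 - p i)%R by lra.
have y0 : (0 <= 1 - p j)%R by lra.
have s0 : (0 <= 1 - (p i + p j))%R by lra.
set x := (1 - p i)%R in x0 *; set y := (1 - p j)%R in y0 *.
set o := (occ_prob i * occ_prob j)%R.
have o0 : (0 <= o)%R by rewrite mulr_ge0.
rewrite (_ : ('C(n, m)%:R * x ^+ (n - m) * occ_prob i * ('C(n, m)%:R * y ^+ (n - m) * occ_prob j))%R
  = (('C(n, m)%:R ^+ 2 * (x * y) ^+ (n - m)) * o)%R); last first.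
  by rewrite exprMn /o; ring.
rewrite [leRHS]mulrA ler_wpM2r//.
have [mn|mn] := leqP m (n - m); last first.
  rewrite ['C(n - m, m)]bin_small// muln0 mul0r !mulr_ge0 ?exprn_ge0 ?mulr_ge0//.
  by rewrite addr_ge0// !mulr_ge0.
have xy : (1 - (p i + p j) <= x * y)%R.
  rewrite /x /y; have := mulr_ge0 pi0 pj0; lra.
apply: (@le_trans _ _ ('C(n, m)%:R ^+ 2 * (x * y) ^+ (n - m - m))%R).
  apply: ler_pM; rewrite ?exprn_ge0//.
    by rewrite expr2 natrM ler_wpM2l// ler_nat leq_bin2l// leq_subr.
  by rewrite lerXn2r ?nnegrE ?mulr_ge0.
rewrite mulrCA ler_wpM2l ?sqr_ge0// -[in X in (_ <= X)%R](subnK mn) exprD mulrCA.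
rewrite -[leLHS]mulr1 ler_wpM2l ?exprn_ge0 ?mulr_ge0//.
have pm1 : (pm <= 1)%R by lra.
have bx : (1 - m%:R * pm <= x ^+ m)%R.
  apply: le_trans (bernoulli_ineq m (introT andP (conj pmn pm1))) _.
  by apply: lerXn2r; rewrite ?nnegrE; move: x0; rewrite /x; lra.
have by_ : (1 - m%:R * pm <= y ^+ m)%R.
  apply: le_trans (bernoulli_ineq m (introT andP (conj pmn pm1))) _.
  by apply: lerXn2r; rewrite ?nnegrE; move: y0; rewrite /y; lra.
have z0 : (0 <= 1 - m%:R * pm)%R by lra.
have bb : ((1 - m%:R * pm) * (1 - m%:R * pm) <= (x * y) ^+ m)%R.
  by rewrite exprMn ler_pM.
apply: (@le_trans _ _ ((1 + 4 * m%:R * pm) * ((1 - m%:R * pm) * (1 - m%:R * pm)))%R).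
  rewrite -!(mulrA 4%R) in pmp *.
  move: (m%:R * pm)%R (mulr_ge0 (ler0n R m) pmn) pmp => u u0 u1.
  have h1 : (0 <= u * (1 - 4 * u))%R by rewrite mulr_ge0// subr_ge0.
  have h2 : (0 <= u * u * u)%R by rewrite !mulr_ge0.
  by lra.
by rewrite ler_wpM2l// addr_ge0// !mulr_ge0.
Qed.

Lemma occ_total_le : (pm * occ_total <= phi)%R.
Proof.
apply: le_trans pmI; rewrite ler_wpM2l ?pm0//.
apply: (@le_trans _ _ (\sum_(i : I) 1)%R); last by rewrite sumr_const -mulr_natl mulr1.
apply: ler_sum => i _; rewrite -lee_fin -t_mean.
apply: (@le_trans _ _ (\int[iid P n]_z 1)).
  by apply: ge0_integral_le => z; rewrite lee_fin /t; case: (h _ _).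
by rewrite integral_cst// [X in _ * X]probability_setT mule1.
Qed.

Lemma occ_count_sq : (0 < m)%N ->
  \int[iid P n]_z (occ_count z ^+ 2)%:E
  <= (occ_total ^+ 2 + (1 + 4 * m%:R * phi) * occ_total)%:E.
Proof.
move=> m0.
have -> : \int[iid P n]_z (occ_count z ^+ 2)%:E
    = \sum_i \sum_j \int[iid P n]_z (t i z * t j z)%:E.
  under eq_integral do rewrite expr2 /occ_count mulr_suml -sumEFin.
  rewrite (@ge0_integral_sum _ _ _ (iid P n) _ measurableT _
    (fun i (z : n.-tuple T) => (t i z * \sum_j t j z)%:E)); last 2 first.
  - move=> i; apply/measurable_EFinP; apply: measurable_funM; first exact: mt.
    exact: measurable_occ_count.
  - by move=> i z _; rewrite lee_fin mulr_ge0// sumr_ge0.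
  apply: eq_bigr => i _; under eq_integral do rewrite mulr_sumr -sumEFin.
  rewrite (@ge0_integral_sum _ _ _ (iid P n) _ measurableT _
    (fun j (z : n.-tuple T) => (t i z * t j z)%:E))//.
  - by move=> j; apply/measurable_EFinP; apply: measurable_funM; exact: mt.
  - by move=> j z _; rewrite lee_fin mulr_ge0.
have tii i : \int[iid P n]_z (t i z * t i z)%:E = (occ_mean i)%:E.
  rewrite -t_mean; apply: eq_integral => z _; rewrite /t.
  by case: (h _ _); rewrite ?mulr1 ?mulr0.
have m0' i : (0 <= occ_mean i)%R.
  by rewrite -lee_fin -t_mean integral_ge0// => z _; rewrite lee_fin.
have tot0 : (0 <= occ_total)%R by exact: sumr_ge0.
have e0 : (0 <= 4 * m%:R * pm)%R by rewrite !mulr_ge0 ?pm0.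
apply: (@le_trans _ _ (\sum_i \sum_j
   ((i == j)%:R * occ_mean i + (1 + 4 * m%:R * pm) * (occ_mean i * occ_mean j))%:E)).
  apply: lee_sum => i _; apply: lee_sum => j _.
  have [<-|ij] := eqVneq i j.
    by rewrite tii lee_fin mul1r lerDl (mulr_ge0 (addr_ge0 ler01 e0))// mulr_ge0.
  by rewrite tt_mean// lee_fin mul0r add0r tt_le.
under eq_bigr do rewrite sumEFin.
rewrite sumEFin lee_fin.
have -> : (\sum_i \sum_j ((i == j)%:R * occ_mean i + (1 + 4 * m%:R * pm) * (occ_mean i * occ_mean j))
    = \sum_i (occ_mean i + (1 + 4 * m%:R * pm) * occ_total * occ_mean i))%R.
  apply: eq_bigr => i _; rewrite big_split/= (bigD1 i)//= eqxx mul1r big1 ?addr0.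
    by rewrite -mulr_sumr -mulr_sumr -/occ_total; congr (_ + _)%R; ring.
  by move=> j ji; rewrite eq_sym (negbTE ji) mul0r.
rewrite big_split/= -mulr_sumr -/occ_total.
have := occ_total_le => /(ler_wpM2l (mulr_ge0 (mulr_ge0 (ler0n R 4) (ler0n R m)) tot0)) hh.
by rewrite expr2; move: hh; move: (occ_total) => a; lra.
Qed.

(** Chebyshev's inequality: the variance of the count is at most
   1 + 4 m phi times its mean. *)
Lemma occ_count_small : (0 < m)%N -> (0 < occ_total)%R ->
  \int[iid P n]_z (if (occ_count z < occ_total / 2)%R then 1 else 0)
  <= (4 * (1 + 4 * m%:R * phi) / occ_total)%:E.
Proof.
move=> m0 tot0.
have := @chebyshev_half _ _ R (iid P n) (fun z : n.-tuple T => occ_count z) occ_total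
  ((1 + 4 * m%:R * phi) * occ_total)%R measurable_occ_count
  (fun z => sumr_ge0 _ (fun i _ => t0 i z)) tot0 occ_count_mean (occ_count_sq m0).
move=> /le_trans; apply; rewrite lee_fin; apply: le_of_eq; field.
by rewrite gt_eqF.
Qed.

End occupancy.

(** * Number of cells with a good configuration *)

Section good_cells.
Context {R : realType} {d : nat}.
Variables (th : param R d) (s : 'I_d -> nat) (plo phi : R).
Hypotheses (plo0 : 0 <= plo)
  (dens_bounds : forall x, unit_cube x -> plo <= dens th x <= phi).
Local Notation X := (d.-tuple R).
Local Notation P := (design_law th).
Local Notation J := (#|{: cell s}|%:R : R).

Lemma J_gt0 : 0 < J.
Proof. by rewrite card_cell ltr0n expn_gt0. Qed.

Lemma in_cell_disj (Q Q' : cell s) (x : X) : Q != Q' -> in_cell Q x -> in_cell Q' x = false.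
Proof.
move=> QQ' hQ; apply/negP => hQ'.
have [j Qj] : exists j, Q j != Q' j.
  by apply/existsP; apply: contraNT QQ' => /existsPn h; apply/eqP/ffunP => j; apply/eqP/negPn/h.
have lt (C C' : cell s) : in_cell C x -> in_cell C' x -> (C j < C' j)%N -> False.
  move=> /forallP/(_ j)/andP[_ h1] /forallP/(_ j)/andP[h2 _] CC'.
  case/orP: h1 => [|/andP[/eqP h1 _]]; last first.
    have := leq_trans (ltn_ord (C' j)) (eq_leq (esym h1)).
    by rewrite ltnS leqNgt CC'.
  rewrite corner_sideE => /(le_lt_trans h2); rewrite /cell_corner ltr_pM2r ?side_gt0//.
  by rewrite ltr_nat ltnS leqNgt CC'.
move: Qj; rewrite -(inj_eq val_inj) neq_ltn => /orP[]; [exact: lt hQ hQ'|exact: lt hQ' hQ].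
Qed.

Lemma design_cell_le (Q : cell s) : (P [set x | in_cell Q x] <= (phi / J)%:E)%E.
Proof.
rewrite EFinM -(lebesgue_cell (R := R) Q); apply: design_law_le; first exact: measurable_cell_set.
by move=> x /= /in_cell_unit_cube /dens_bounds/andP[].
Qed.

Lemma design_ball_ge (Q : cell s) (y : 'rV[R]_d) (r : R) : cube y -> 0 < r -> r <= 2^-1 ->
  ((plo * r ^+ d / J)%:E <= P (ball_box Q y r))%E.
Proof.
move=> cy r0 r1; rewrite -mulrA EFinM -(lebesgue_ball_box Q cy r0 r1).
apply: design_law_ge => //; first exact: measurable_ball_box.
by move=> x /(ball_box_sub cy r0 r1)[/in_cell_unit_cube/dens_bounds/andP[]].
Qed.

End good_cells.

Section measurable_good.
Context {R : realType} {d q : nat}.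
Variables (s : 'I_d -> nat) (w : 'I_q -> 'rV[R]_d) (delta eps : R) (Q : cell s).
Hypotheses (delta0 : 0 <= delta) (eps0 : 0 <= eps).
Local Notation X := (d.-tuple R).

Lemma measurable_forall_fin dT (T : measurableType dT) (I : finType) (F : I -> T -> bool) :
  (forall i, measurable_fun [set: T] (F i)) ->
  measurable_fun [set: T] (fun x => [forall i, F i x]).
Proof.
move=> mF; apply: (measurable_fun_bool true); rewrite setTI.
rewrite (_ : _ @^-1` _ = \bigcap_(i in [set: I]) (F i @^-1` [set true])).
  apply: fin_bigcap_measurable => // i _.
  by have := mF i measurableT [set true] Logic.I; rewrite setTI.
apply/seteqP; split => x /=; first by move=> /forallP h i _; exact: h.
by move=> h; apply/forallP => i; exact: h.
Qed.

Lemma norm_rV_leb (x : 'rV[R]_d) (e : R) : 0 <= e ->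
  (`|x| <= e) = [forall j, `|x 0 j| <= e].
Proof.
move=> e0; apply/idP/forallP => [/norm_rV_le h j|h]; first exact: h.
exact/norm_rV_le.
Qed.

Lemma measurable_goodseq : smeas (fun t : seq X => (goodseq w delta eps Q t)%:R%:E : \bar R).
Proof.
move=> n.
suff mg : measurable_fun setT (fun t : n.-tuple X => goodseq w delta eps Q t).
  apply/measurable_EFinP.
  rewrite (_ : (fun t => _) = fun t : n.-tuple X => if goodseq w delta eps Q t then 1 else 0).
    exact: measurable_fun_ifT.
  by apply/funext => t; case: goodseq.
have [nq|nq] := eqVneq n q.+2; last first.
  rewrite (_ : (fun t => _) = cst false)//; apply/funext => t.
  by rewrite /goodseq size_tuple (negbTE nq).
have mloc (k : nat) j : (k < n)%N ->
    measurable_fun setT (fun t : n.-tuple X => local_coord Q (nth point t k) 0 j).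
  move=> kn.
  rewrite (_ : (fun t => _) = fun t : n.-tuple X =>
     (tnth (tnth t (Ordinal kn)) j - cell_corner Q j) / cell_side s j); last first.
    by apply/funext => t; rewrite mxE (tnth_nth point t).
  apply: measurable_funM => //; apply: measurable_funB => //.
  exact: (measurableT_comp (measurable_tnth j) (measurable_tnth (Ordinal kn))).
rewrite /goodseq; apply: measurable_and; last apply: measurable_and.
- rewrite (_ : (fun t => _) = cst true)//; apply/funext => t.
  by rewrite size_tuple; apply/eqP.
- apply: measurable_forall_fin => k.
  rewrite (_ : (fun t => _) = fun t : n.-tuple X => [forall j,
      `|local_coord Q (nth point t k) 0 j - w k 0 j| <= delta]); last first.
    by apply/funext => t; rewrite norm_rV_leb//; apply: eq_forallb => j; rewrite !mxE.
  apply: measurable_forall_fin => j; apply: measurable_fun_ler => //.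
  apply: measurableT_comp => //; apply: measurable_funB => //; apply: mloc.
  by rewrite nq (leq_trans (ltn_ord k))// -addn2 leq_addr.
- rewrite (_ : (fun t => _) = fun t : n.-tuple X => [forall j,
      `|local_coord Q (nth point t q) 0 j - local_coord Q (nth point t q.+1) 0 j| <= eps]); last first.
    by apply/funext => t; rewrite norm_rV_leb//; apply: eq_forallb => j; rewrite !mxE.
  apply: measurable_forall_fin => j; apply: measurable_fun_ler => //.
  apply: measurableT_comp => //; apply: measurable_funB => //; apply: mloc.
    by rewrite nq -addn2 -addn1 leq_add2l.
  by rewrite nq.
Qed.

End measurable_good.

Section good_probability.
Context {R : realType} {d q : nat}.
Variables (th : param R d) (s : 'I_d -> nat) (w : 'I_q -> 'rV[R]_d) (delta eps plo phi : R).
Hypotheses (plo0 : 0 <= plo)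
  (dens_bounds : forall x, unit_cube x -> plo <= dens th x <= phi)
  (wc : forall k, cube (w k)) (delta0 : 0 < delta) (delta1 : delta <= 2^-1)
  (eps0 : 0 < eps) (eps1 : eps <= 2^-1).
Local Notation X := (d.-tuple R).
Local Notation P := (design_law th).
Local Notation J := (#|{: cell s}|%:R : R).
Local Notation good := (goodseq w delta eps).

(** Place the first of the points in [S], then the others given the first. *)
Lemma selint_step (A : pred X) m (f : seq X -> \bar R) (S : set X) (a b : R) :
  measurable S -> 0 <= a -> 0 <= b -> (a%:E <= P S)%E ->
  (forall t, (0 <= f t)%E) -> (forall x, S x -> A x) ->
  (forall x, S x -> (b%:E <= selint P A m (fun t => f (x :: t)))%E) ->
  ((a * b)%:E <= selint P A m.+1 f)%E.
Proof.
move=> mS a0 b0 aS f0 SA Sb /=.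
apply: (@le_trans _ _ (\int[P]_x (b%:E * (\1_S x)%:E))%E); last first.
  apply: ge0_integral_le => x; first by rewrite mule_ge0 ?lee_fin.
  rewrite indicE; case: (boolP (x \in S)) => xS; last first.
    by rewrite mule0; case: ifP => // _; exact: selint_ge0.
  by rewrite mule1; move: xS; rewrite inE => xS; rewrite SA//; exact: Sb.
rewrite ge0_integralZl//; last first.
  exact/measurable_EFinP/measurable_indic.
by rewrite integral_indic// setIT mulrC EFinM lee_wpmul2l// lee_fin.
Qed.

Definition good_prob_bound : R :=
  (plo * delta ^+ d / J) ^+ q * ((plo * 2^-1 ^+ d / J) * (plo * eps ^+ d / J)).

(** Place the points one after the other: each of the first [q] near its
   unisolvent point, the next anywhere in the cell, and the last near it. *)
Lemma occ_prob_ge (Q : cell s) :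
  (good_prob_bound%:E <= selint P (in_cell Q) q.+2 (fun t => (good Q t)%:R%:E))%E.
Proof.
have J0 : 0 <= J^-1 by rewrite invr_ge0 ler0n.
have b0 (r : R) : 0 <= r -> 0 <= plo * r ^+ d / J.
  by move=> r0; rewrite mulr_ge0// mulr_ge0// exprn_ge0.
have hb : 0 <= 2^-1 :> R by [].
suff H k (pre : seq X) : (k <= q)%N -> size pre = (q - k)%N ->
    (forall i : 'I_q, (i < size pre)%N -> `|local_coord Q (nth point pre i) - w i| <= delta) ->
    (((plo * delta ^+ d / J) ^+ k * ((plo * 2^-1 ^+ d / J) * (plo * eps ^+ d / J)))%:E
      <= selint P (in_cell Q) k.+2 (fun t => (good Q (pre ++ t))%:R%:E))%E.
  by apply: (H q [::]) => //; rewrite subnn.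
elim: k pre => [|k IH] pre kq szp hpre.
  rewrite expr0 mul1r; rewrite subn0 in szp.
  have ch : cube (const_mx 2^-1 : 'rV[R]_d).
    by move=> j; rewrite mxE; apply/andP; split; lra.
  apply: (@selint_step _ _ _ (ball_box Q (const_mx 2^-1) 2^-1)) => //.
  - exact: measurable_ball_box.
  - exact: b0.
  - by apply: b0; exact: ltW.
  - by apply: (design_ball_ge plo0 dens_bounds) => //; lra.
  - by move=> x /(ball_box_sub ch)[].
  move=> x /(ball_box_sub ch)[]// xQ _.
  rewrite -[leLHS]/((_)%:E) -[X in (X%:E <= _)%E]mulr1.
  have cx := local_coord_cube xQ.
  apply: (@selint_step _ _ _ (ball_box Q (local_coord Q x) eps)) => //.
  - exact: measurable_ball_box.
  - by apply: b0; exact: ltW.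
  - by apply: (design_ball_ge plo0 dens_bounds) => //; lra.
  - by move=> x' /(ball_box_sub cx eps0 eps1)[].
  move=> x' /(ball_box_sub cx eps0 eps1)[x'Q xx'] /=.
  suff -> : good Q (pre ++ [:: x; x']) by [].
  apply/and3P; split.
  - by rewrite size_cat szp addn2.
  - by apply/forallP => i; rewrite nth_cat szp ltn_ord; apply: hpre; rewrite szp.
  - rewrite !nth_cat szp ltnn subnn /= ltnNge leqnSn /= subSn// subnn /=.
    by rewrite distrC.
have jq : (q - k.+1 < q)%N by rewrite ltn_subrL/= (leq_trans _ kq).
pose j := Ordinal jq.
rewrite exprS -mulrA.
apply: (@selint_step _ _ _ (ball_box Q (w j) delta)) => //.
- exact: measurable_ball_box.
- by apply: b0; exact: ltW.
- by rewrite !mulr_ge0 ?exprn_ge0 ?b0 ?(ltW delta0) ?(ltW eps0).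
- by apply: (design_ball_ge plo0 dens_bounds) => //; lra.
- by move=> x /(ball_box_sub (wc j) delta0 delta1)[].
move=> x /(ball_box_sub (wc j) delta0 delta1)[xQ xw].
have szr : size (rcons pre x) = (q - k)%N by rewrite size_rcons szp -subSn// subSS.
have h := IH (rcons pre x) (ltnW kq) szr.
rewrite (_ : (fun t => _) = fun t => (good Q (rcons pre x ++ t))%:R%:E); last first.
  by apply/funext => t; rewrite cat_rcons.
apply: h => i; rewrite size_rcons ltnS leq_eqVlt nth_rcons szp => /orP[/eqP ij|ij].
  by rewrite ij ltnn eqxx (_ : i = j)//; exact: val_inj.
by rewrite ij; apply: hpre; rewrite szp.
Qed.

End good_probability.

(** * Many cells are occupied by a good configuration *)

Section enough_cells.
Context {R : realType}.

Lemma binomial_lower (n m : nat) : (2 * m <= n)%N ->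
  (n%:R / 2) ^+ m / (m`!)%:R <= 'C(n, m)%:R :> R.
Proof.
move=> mn; rewrite ler_pdivrMr ?ltr0n ?fact_gt0// -natrM bin_ffact.
suff H k : (k <= m)%N -> (n%:R / 2) ^+ k <= (n ^_ k)%:R :> R by exact: H.
elim: k => [|k IH] km; first by rewrite expr0 ffactn0.
have k2 : (2 * k <= n)%N by rewrite (leq_trans _ mn)// leq_mul2l ltnW.
rewrite exprSr ffactnSr natrM; apply: ler_pM.
- by rewrite exprn_ge0// divr_ge0.
- by rewrite divr_ge0.
- exact/IH/ltnW.
rewrite natrB; last by rewrite (leq_trans _ k2)// leq_pmull.
move: k2; rewrite -(ler_nat R) natrM; lra.
Qed.

Lemma one_sub_pow_lower (x : R) n : 0 <= x <= 2^-1 ->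
  expR (- (2 * (n%:R * x))) <= (1 - x) ^+ n.
Proof.
move=> /andP[x0 x1].
have -> : - (2 * (n%:R * x)) = n%:R * (- (2 * x)) by ring.
rewrite expRM_natl lerXn2r ?nnegrE ?expR_ge0//; first by lra.
rewrite expRN -div1r ler_pdivrMr ?expR_gt0//.
have x2 : 0 <= 1 - x by lra.
apply: le_trans (ler_wpM2l x2 (expR_ge1Dx (2 * x))).
have : 0 <= x * (1 - 2 * x) by rewrite mulr_ge0//; lra.
lra.
Qed.

End enough_cells.

(** A cell has probability of order 1/n, so it contains exactly q+2 sample
   points, in the required configuration, with probability at least a constant
   times eps^d; and there are of the order of n cells. *)
Lemma occupied_cells (R : realType) (d q : nat) (w : 'I_q -> 'rV[R]_d)
    (delta plo phi lambda0 : R) :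
  0 < plo -> 1 <= phi -> 0 < lambda0 -> (forall k, cube (w k)) ->
  0 < delta -> delta <= 2^-1 ->
  exists n0 c0 C : R, [/\ 0 < n0, 0 < c0, 0 <= C &
  forall (n : nat) (s : 'I_d -> nat) (eps : R) (th : param R d), n0 <= n%:R ->
    (\sum_j s j)%N = log_cells lambda0 n -> 0 < eps -> eps <= 2^-1 ->
    (forall x, unit_cube x -> plo <= dens th x <= phi) ->
    (\int[iid (design_law th) n]_z
       (if (occ_count (fun Q : cell s => in_cell Q) (goodseq w delta eps) z
            < c0 * n%:R * eps ^+ d)%R then 1 else 0)
     <= (C / (n%:R * eps ^+ d))%:E)%E].
Proof.
move=> plo0 phi1 l0 wc delta0 delta1.
have K10 : 0 < 1 + 2 / lambda0 by rewrite addr_gt0// divr_gt0.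
pose m := q.+2.
pose K1 := 1 + 2 / lambda0.
pose g0 := (plo * delta ^+ d) ^+ q * ((plo * 2^-1 ^+ d) * plo).
pose a := 2 * lambda0 * phi.
pose c1 := g0 * expR (- (2 * a)) / (m`!)%:R / (2 * K1) ^+ m / (2 * lambda0).
have phi0 : 0 < phi by apply: lt_le_trans phi1.
have a0 : 0 < a by rewrite !mulr_gt0.
have g00 : 0 < g0 by rewrite !mulr_gt0 ?exprn_gt0 ?mulr_gt0 ?exprn_gt0 ?invr_gt0.
have c10 : 0 < c1.
  have h1 := expR_gt0 (- (2 * a)); have h2 : 0 < (m`!)%:R :> R by rewrite ltr0n fact_gt0.
  have h3 : 0 < (2 * K1) ^+ m by rewrite exprn_gt0// mulr_gt0.
  by rewrite /c1 !divr_gt0// mulr_gt0.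
have m1 : 1 <= m%:R :> R by rewrite ler1n.
exists (4 * m%:R * a + 2 * m%:R), (c1 / 2), (4 * (1 + 4 * m%:R * phi) / c1).
split.
- by rewrite addr_gt0 ?mulr_gt0// (lt_le_trans ltr01).
- by rewrite divr_gt0.
- by rewrite divr_ge0 ?(ltW c10)// mulr_ge0// addr_ge0// !mulr_ge0// ltW.
move=> n s eps th nn0 sE e0 e1 hp.
have nm : (2 * m <= n)%N.
  rewrite -(ler_nat R) natrM; apply: le_trans nn0; rewrite lerDr.
  by rewrite !mulr_ge0// ltW.
have n0 : (0 < n)%N by apply: leq_trans nm.
have n0R : 0 < n%:R :> R by rewrite ltr0n.
have JE : #|{: cell s}|%:R = (2 ^ log_cells lambda0 n)%:R :> R by rewrite card_cell sE.
have /andP[Jlo Jhi] := log_cells_bounds l0 n0; rewrite -JE -/K1 in Jlo Jhi.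
have J0 := @J_gt0 R d s.
set J : R := #|{: cell s}|%:R in JE Jlo Jhi J0.
pose P := design_law th.
pose p (Q : cell s) := fine (P [set x | in_cell Q x]).
have pE Q : P [set x | in_cell Q x] = (p Q)%:E.
  rewrite /p fineK// ge0_fin_numE//.
  by apply: (le_lt_trans (design_cell_le hp Q)); rewrite ltry.
have p0 Q : 0 <= p Q by rewrite -lee_fin -pE.
pose pm := phi / J.
have ppm Q : p Q <= pm by rewrite -lee_fin -pE; exact: (design_cell_le hp Q).
have pm0 : 0 <= pm by rewrite divr_ge0// ltW.
have npm : n%:R * pm <= a.
  rewrite /pm mulrA ler_pdivrMr// /a.
  have hJ : n%:R <= J * (2 * lambda0) by rewrite -ler_pdivrMr// mulr_gt0.
  apply: le_trans (ler_wpM2r (ltW phi0) hJ) _.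
  by apply: le_of_eq; move: (J) => J'; ring.
have pm4 : 4 * m%:R * pm <= 1.
  rewrite -(ler_pM2l n0R) mulr1 mulrCA.
  apply: (@le_trans _ _ (4 * m%:R * a)); first by rewrite ler_wpM2l// mulr_ge0.
  by apply: le_trans nn0; rewrite lerDl mulr_ge0.
have pm_half : pm <= 2^-1.
  have : pm <= m%:R * pm by rewrite ler_peMl.
  by move: pm4; rewrite -mulrA; move: (m%:R * pm) pm0 (pm); clear => u ? ?; lra.
have pmI : pm * #|{: cell s}|%:R <= phi by rewrite -/J divfK// gt_eqF.
have d0 := ltW delta0; have e00 := ltW e0.
set occ := occ_count _ _.
pose total := occ_total P (fun Q : cell s => in_cell Q) (goodseq w delta eps) m p n.
have lower : c1 * (n%:R * eps ^+ d) <= total.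
  pose G := @good_prob_bound R d q s delta eps plo.
  have GE : G = g0 * eps ^+ d / J ^+ m.
    rewrite /G /good_prob_bound -/J /g0 expr_div_n /m !exprS !invfM.
    by move: ((plo * delta ^+ d) ^+ q) (plo * _) (eps ^+ d) (J ^+ q)^-1 (J^-1); clear=> *; ring.
  have G0 : 0 <= G by rewrite GE divr_ge0 ?exprn_ge0 ?(ltW J0)// mulr_ge0 ?exprn_ge0// ltW.
  apply: (@le_trans _ _ (\sum_(Q : cell s) (n%:R / 2) ^+ m / (m`!)%:R * expR (- (2 * a)) * G)).
    rewrite sumr_const -[leRHS]mulr_natl GE.
    have -> : #|{: cell s}|%:R * ((n%:R / 2) ^+ m / (m`!)%:R * expR (- (2 * a)) * (g0 * eps ^+ d / J ^+ m))
      = (g0 * expR (- (2 * a)) / (m`!)%:R) * (((n%:R / (2 * J)) ^+ m) * J) * eps ^+ d.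
      rewrite -/J !expr_div_n exprMn !invfM.
      move: (n%:R ^+ m) ((2 : R) ^+ m)^-1 ((m`!)%:R : R)^-1 (expR _) (g0) (eps ^+ d) (J ^+ m)^-1 (J).
      by clear=> *; ring.
    have hJ : ((2 * K1) ^+ m)^-1 * (n%:R / (2 * lambda0)) <= (n%:R / (2 * J)) ^+ m * J.
      have hK : 0 <= 2 * K1 by rewrite mulr_ge0// ltW.
      apply: ler_pM => //; first by rewrite invr_ge0 exprn_ge0.
        by rewrite divr_ge0// mulr_ge0// ltW.
      have J2 : 0 < 2 * J by rewrite mulr_gt0.
      rewrite -exprVn lerXn2r ?nnegrE ?invr_ge0//; first by rewrite divr_ge0// ltW.
      rewrite ler_pdivlMr// ler_pdivrMl ?mulr_gt0//.
      by rewrite -mulrA ler_pM2l.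
    have -> : c1 * (n%:R * eps ^+ d) = g0 * expR (- (2 * a)) / (m`!)%:R *
        (((2 * K1) ^+ m)^-1 * (n%:R / (2 * lambda0))) * eps ^+ d.
      by rewrite /c1; move: (g0 * _ / _) (((2 * K1) ^+ m)^-1) ((2 * lambda0)^-1) (eps ^+ d); clear=> *; ring.
    by rewrite ler_wpM2r ?exprn_ge0// ler_wpM2l// divr_ge0// mulr_ge0 ?expR_ge0// ltW.
  apply: ler_sum => Q _; rewrite /occ_mean.
  apply: ler_pM => //.
  - apply: ler_pM; rewrite ?expR_ge0//; first exact: binomial_lower.
    apply: (@le_trans _ _ ((1 - pm) ^+ n)).
      apply: le_trans (one_sub_pow_lower n (introT andP (conj pm0 pm_half))).
      by rewrite ler_expR lerN2 ler_wpM2l.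
    apply: (@le_trans _ _ ((1 - pm) ^+ (n - m))).
      by apply: ler_wiXn2l; rewrite ?leq_subr//; move: pm0 pm_half; move: (pm); clear => ?; lra.
    by apply: lerXn2r; rewrite ?nnegrE; have := ppm Q; move: pm0 pm_half; move: (pm) (p Q); clear => ? ?; lra.
  - rewrite -lee_fin /occ_prob fineK.
      exact: (occ_prob_ge (ltW plo0) hp wc delta0 delta1 e0 e1).
    rewrite ge0_fin_numE; last by apply: selint_ge0 => t; rewrite lee_fin.
    apply: (le_lt_trans (selint_le1 _ _ _ _ _)); rewrite ?ltry// => t; rewrite lee_fin//.
    by case: goodseq.
have ne0 : 0 < n%:R * eps ^+ d by rewrite mulr_gt0// exprn_gt0.
have tot0 : 0 < total by apply: lt_le_trans lower; rewrite mulr_gt0.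
have := @occ_count_small _ _ R P {: cell s} (fun Q : cell s => in_cell Q)
  (goodseq w delta eps) m p pm phi _ _ _ _ pE ppm pm0 pmI n pm4 erefl tot0.
have H1 (Q : cell s) : measurable_fun [set: d.-tuple R] (fun x => in_cell Q x) by exact: measurable_in_cell.
have H2 (Q Q' : cell s) (x : d.-tuple R) : Q != Q' -> in_cell Q x -> in_cell Q' x = false by exact: in_cell_disj.
have H3 (Q : cell s) (t : seq (d.-tuple R)) : goodseq w delta eps Q t -> size t = m by case/and3P => /eqP.
have H4 (Q : cell s) := measurable_goodseq w Q d0 e00.
move=> /(_ H1 H2 H3 H4) hs.
apply: (@le_trans _ _ (\int[iid P n]_z (if (occ z < total / 2)%R then 1 else 0))%E).
  apply: ge0_integral_le => z; first by case: ifP.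
  case: ifPn => // h; last by case: ifP.
  rewrite ifT//; apply: (lt_le_trans h).
  rewrite (_ : c1 / 2 * _ * _ = c1 * (n%:R * eps ^+ d) / 2); first by rewrite ler_pM2r.
  by move: (c1) (eps ^+ d) (n%:R : R); clear=> *; ring.
apply: (le_trans hs); rewrite lee_fin -[leRHS]mulrA -invfM ler_wpM2l//.
  by rewrite mulr_ge0// addr_ge0// !mulr_ge0// ltW.
by rewrite lef_pV2 ?posrE// mulr_gt0.
Qed.

(** * Conditional risk of an average of squared contrasts *)

Section contrast_average.
Context {R : realType} {d : nat}.
Variables (th : param R d) (ok : pred (d.-tuple R)) (v M4 K : R).
Local Notation X := (d.-tuple R).
Hypotheses (v0 : 0 <= v)
  (ok_moments : forall x, ok x ->
    [/\ (\int[noise th x]_u u%:E = 0)%E, (\int[noise th x]_u (u ^+ 2)%:E = v%:E)%E &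
      (\int[noise th x]_u (u ^+ 4)%:E <= M4%:E)%E])
  (hK : 2 * M4 <= K) (hK' : 4 * v ^+ 2 <= K).
Variables (I : finType) (S : {set I}) (w : I -> nat -> R) (xs : seq X) (gam : R).
Local Notation n := (size xs).
Local Notation T := (#|S|%:R : R).
Hypotheses (T0 : 0 < T)
  (wnorm : forall Q, Q \in S -> \sum_(0 <= i < n) w Q i ^+ 2 = 1)
  (wdisj : forall Q Q' i, Q != Q' -> w Q i * w Q' i = 0)
  (bias : forall Q, Q \in S ->
     (\sum_(0 <= i < n) w Q i * reg th (nth point xs i)) ^+ 2 <= gam).

Lemma sqr_sum_orthogonal (a : I -> R) : (forall Q Q', Q != Q' -> a Q * a Q' = 0) ->
  (\sum_(Q in S) a Q) ^+ 2 = \sum_(Q in S) a Q ^+ 2.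
Proof.
move=> ao; rewrite expr2 mulr_suml; apply: eq_bigr => Q QS.
rewrite mulr_sumr (bigD1 Q)//= big1 ?addr0 ?expr2// => Q' /andP[_ Q'Q].
by apply: ao; rewrite eq_sym.
Qed.

Let g Q := \sum_(0 <= i < n) w Q i * reg th (nth point xs i).

(** In terms of the noises the error is a quadratic polynomial.  The contrasts
   being orthonormal, the trace of its matrix cancels [v] exactly, the average of
   the squared biases remaining, and the squared Frobenius norm of its matrix is
   1/T. *)
Lemma contrast_average_risk :
  (noise_int th ok xs (fun s =>
     ((T^-1 * \sum_(Q in S) (\sum_(0 <= i < n) w Q i * (nth point s i).2) ^+ 2 - v) ^+ 2)%:E)
   <= (gam ^+ 2 + (8 * v * gam + K) / T)%:E)%E.
Proof.
pose c := T^-1 * (\sum_(Q in S) g Q ^+ 2) - v.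
pose b i := T^-1 * (2 * \sum_(Q in S) g Q * w Q i).
pose A i j := T^-1 * \sum_(Q in S) w Q i * w Q j.
have Tn : T != 0 by rewrite gt_eqF.
have Ti : 0 <= T^-1 by rewrite invr_ge0 ltW.
apply: (@le_trans _ _ (noise_int th ok xs (fun s => (quad th n c b A s ^+ 2)%:E))).
  apply: noise_int_le => [s|s sxs]; first by rewrite lee_fin sqr_ge0.
  have sn : size s = n by rewrite -sxs size_map.
  have YE i : (i < n)%N -> (nth point s i).2 = reg th (nth point xs i) + res th s i.
    by move=> i_n; rewrite /res -[in nth point xs i]sxs (nth_map point) ?sn// addrC subrK.
  pose W Q := \sum_(0 <= i < n) w Q i * res th s i.
  have E Q : \sum_(0 <= i < n) w Q i * (nth point s i).2 = g Q + W Q.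
    rewrite /g /W -big_split/=; apply: eq_big_nat => i /andP[_ i_n].
    by rewrite YE// mulrDr.
  rewrite lee_fin; apply: le_of_eq; congr (_ ^+ 2).
  under eq_bigr do rewrite E sqrrD.
  rewrite !big_split/= /quad /c.
  have -> : \sum_(0 <= i < n) b i * res th s i = T^-1 * (2 * \sum_(Q in S) g Q * W Q).
    rewrite (eq_bigr (fun i => T^-1 * (2 * \sum_(Q in S) g Q * w Q i * res th s i))).
      rewrite -!mulr_sumr exchange_big/=; congr (_ * (_ * _)); apply: eq_bigr => Q _.
      rewrite /W mulr_sumr; apply: eq_bigr => i _.
      by rewrite mulrA.
    by move=> i _; rewrite /b -!mulrA mulr_suml.
  have -> : \sum_(0 <= i < n) \sum_(0 <= j < n) A i j * res th s i * res th s j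
    = T^-1 * \sum_(Q in S) W Q ^+ 2.
    rewrite (_ : \sum_(Q in S) W Q ^+ 2 = \sum_(Q in S) \sum_(0 <= i < n) \sum_(0 <= j < n)
       w Q i * w Q j * res th s i * res th s j); last first.
      apply: eq_bigr => Q _; rewrite expr2 /W mulr_suml; apply: eq_bigr => i _.
      by rewrite mulr_sumr; apply: eq_bigr => j _; ring.
    rewrite [in RHS]exchange_big/= [RHS]mulr_sumr; apply: eq_bigr => i _.
    rewrite [in RHS]exchange_big/= [RHS]mulr_sumr; apply: eq_bigr => j _.
    by rewrite /A -!mulrA mulr_suml; congr (_ * _); apply: eq_bigr => Q _; ring.
  ring.
have Hq := noise_int_quad v0 ok_moments xs c b A hK hK'.
apply: (le_trans Hq).
have K0 : 0 <= K by apply: le_trans hK'; rewrite mulr_ge0// sqr_ge0.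
have sumS (F : I -> R) B : (forall Q, Q \in S -> F Q <= B) -> T^-1 * \sum_(Q in S) F Q <= B.
  move=> FB; rewrite ler_pdivrMl// mulr_natl -sumr_const; exact: ler_sum.
have tr : c + v * \sum_(0 <= i < n) A i i = T^-1 * \sum_(Q in S) g Q ^+ 2.
  rewrite (_ : \sum_(0 <= i < n) A i i = 1) ?mulr1 ?subrK// /A -mulr_sumr exchange_big/=.
  rewrite (eq_bigr (fun=> 1)); last by move=> Q /wnorm <-; apply: eq_bigr => i _; rewrite expr2.
  by rewrite sumr_const mulVf.
have bsum : \sum_(0 <= i < n) b i ^+ 2 <= 4 * gam / T.
  rewrite (_ : \sum_(0 <= i < n) b i ^+ 2 = 4 / T * (T^-1 * \sum_(Q in S) g Q ^+ 2)); last first.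
    rewrite (_ : \sum_(Q in S) g Q ^+ 2 = \sum_(Q in S) \sum_(0 <= i < n) (g Q * w Q i) ^+ 2); last first.
      apply: eq_bigr => Q QS; rewrite -[LHS]mulr1 -(wnorm QS) mulr_sumr.
      by apply: eq_bigr => i _; rewrite exprMn.
    rewrite [in RHS]exchange_big/= [X in _ = _ * X]mulr_sumr [RHS]mulr_sumr; apply: eq_bigr => i _.
    rewrite /b -sqr_sum_orthogonal; last by move=> Q Q' QQ'; rewrite mulrACA wdisj// mulr0.
    by field.
  rewrite [leRHS]mulrAC ler_wpM2l ?divr_ge0 ?(ltW T0)//; exact: sumS.
have Asum : \sum_(0 <= i < n) \sum_(0 <= j < n) A i j ^+ 2 = T^-1.
  rewrite (_ : T^-1 = T^-1 ^+ 2 * \sum_(Q in S) \sum_(0 <= i < n) \sum_(0 <= j < n) (w Q i * w Q j) ^+ 2); last first.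
    rewrite (eq_bigr (fun=> 1)); first by rewrite sumr_const; field.
    move=> Q QS; rewrite -[RHS]mulr1 -{2}(wnorm QS) -(wnorm QS) mulr_suml; apply: eq_bigr => i _.
    by rewrite mulr_sumr; apply: eq_bigr => j _; rewrite exprMn.
  rewrite [in RHS]exchange_big/= [RHS]mulr_sumr; apply: eq_bigr => i _.
  rewrite [in RHS]exchange_big/= [RHS]mulr_sumr; apply: eq_bigr => j _.
  rewrite /A exprMn -sqr_sum_orthogonal// => Q Q' QQ'.
  by rewrite mulrACA wdisj// mul0r.
rewrite lee_fin tr Asum [_ / T in leRHS]mulrDl addrA; apply: lerD => //; apply: lerD.
  rewrite lerXn2r ?nnegrE//.
  - by rewrite mulr_ge0// sumr_ge0// => Q _; exact: sqr_ge0.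
  - by apply: le_trans (sumS _ _ bias); rewrite mulr_ge0// sumr_ge0// => Q _; exact: sqr_ge0.
  - exact: sumS.
apply: le_trans (ler_wpM2l _ bsum) _; first by rewrite mulr_ge0.
by apply: le_of_eq; field.
Qed.

End contrast_average.

Section conditional_risk.
Context {R : realType} {d : nat}.
Variables (bb L H vlo vhi M4 kappa thr eps c0 B : R) (U : set 'rV[R]_d).
Variables (psi : 'I_(num_poly d bb) -> mpoly.mpoly d R) (s : 'I_d -> nat).
Variables (th : param R d) (ok : pred (d.-tuple R)) (g : 'rV[R]_d -> R).
Local Notation X := (d.-tuple R).
Hypotheses (d0 : (0 < d)%N) (bb1 : 1 < bb) (L0 : 0 <= L) (oU : open U)
  (cU : forall x, cube x -> U x) (gb : holder_ball U bb L g)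
  (regE : forall x, unit_cube x -> reg th x = g (row_of x))
  (psiB : poly_basis (ell bb) psi) (H0 : 0 < H) (sH : forall j, cell_side s j <= H)
  (kappa0 : 0 < kappa) (thr0 : 0 < thr) (eps0 : 0 < eps) (c00 : 0 < c0)
  (B0 : 0 <= B) (Bbd : forall u, cube u -> \sum_k peval (psi k) u ^+ 2 <= B)
  (Blip : forall u v, cube u -> cube v ->
     \sum_k (peval (psi k) u - peval (psi k) v) ^+ 2 <= B * `|u - v| ^+ 2)
  (vlo0 : 0 <= vlo) (vv : vlo <= nvar th <= vhi) (M40 : 0 <= M4)
  (ok_moments : forall x, ok x ->
    [/\ (\int[noise th x]_u u%:E = 0)%E, (\int[noise th x]_u (u ^+ 2)%:E = (nvar th)%:E)%E &
      (\int[noise th x]_u (u ^+ 4)%:E <= M4%:E)%E]).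

(** The constant of [holder_taylor] on a cell of sides at most [H]. *)
Definition holder_scale : R := L * d%:R ^+ (ell bb).+1 * H `^ bb.
Definition contrast_bias : R :=
  (2 + 2 * (B / kappa) ^+ 2) / thr * (holder_scale * eps) ^+ 2.

Lemma contrast_bias_ge0 : 0 <= contrast_bias.
Proof.
rewrite /contrast_bias mulr_ge0 ?sqr_ge0// divr_ge0 ?(ltW thr0)// addr_ge0// mulr_ge0//.
exact: sqr_ge0.
Qed.

Lemma num_poly_gt0 : (0 < num_poly d bb)%N.
Proof. by rewrite /num_poly bin_gt0 leq_addl. Qed.

Lemma cell_taylor (Q : cell s) : exists2 p : mpoly.mpoly d R,
  (mpoly.msize p <= (ell bb).+1)%N &
  let rho x := reg th x - peval p (local_coord Q x) in
  (forall x, in_cell Q x -> `|rho x| <= holder_scale) /\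
  (forall x y, in_cell Q x -> in_cell Q y ->
     `|rho x - rho y| <= holder_scale * `|local_coord Q x - local_coord Q y|).
Proof.
pose x0 : 'rV[R]_d := \row_i cell_corner Q i.
pose h : 'rV[R]_d := \row_i cell_side s i.
have hH j : 0 < h 0 j <= H by rewrite mxE side_gt0 sH.
have hc u : cube u -> cube (\row_j (x0 0 j + h 0 j * u 0 j)).
  move=> cu j; rewrite !mxE; have /andP[u0 u1] := cu j.
  rewrite addr_ge0 ?corner_ge0 ?mulr_ge0 ?(ltW (side_gt0 _ _))//=.
  apply: le_trans (corner_side_le1 Q j); rewrite lerD2l ler_piMr//.
  exact/ltW/side_gt0.
have [p pk [h1 h2]] := holder_taylor d0 bb1 L0 oU cU gb H0 hH hc.
exists p => // rho.
have rE x : in_cell Q x ->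
    rho x = g (\row_j (x0 0 j + h 0 j * local_coord Q x 0 j)) - peval p (local_coord Q x).
  by move=> xQ; rewrite /rho (regE (in_cell_unit_cube xQ)) (row_of_local Q x).
split=> [x xQ|x y xQ yQ]; first by rewrite rE//; apply: h1; exact: local_coord_cube xQ.
by rewrite !rE//; apply: h2; [exact: local_coord_cube xQ|exact: local_coord_cube yQ].
Qed.

Definition selected_at n (xs : n.-tuple X) : {set cell s} := finset (pselected psi kappa thr eps (tnth xs)).

Definition risk_bound n (xs : n.-tuple X) : R :=
  if c0 * n%:R * eps ^+ d <= #|selected_at xs|%:R
  then contrast_bias ^+ 2 + (8 * vhi * contrast_bias + (2 * M4 + 4 * vhi ^+ 2))
         / (c0 * (n%:R * eps ^+ d))
  else (vhi - vlo) ^+ 2.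

Lemma lr_conditional_risk n (xs : n.-tuple X) (h : n.-tuple (X * R) -> R) :
  (0 < n)%N -> (forall z, 0 <= h z) ->
  (forall z, h z <= (lr_estimator psi s kappa thr eps z c0 vlo vhi - nvar th) ^+ 2) ->
  (noise_int th ok xs (fun t => if insub t is Some z then (h z)%:E else 0)
   <= (risk_bound xs)%:E)%E.
Proof.
move=> n0 h0 hle; rewrite /risk_bound; have /andP[v1 v2] := vv.
have v0 : 0 <= nvar th by apply: le_trans v1.
have vhi0 : 0 <= vhi by apply: le_trans v2.
have n0R : 0 < n%:R :> R by rewrite ltr0n.
have ne0 : 0 < c0 * n%:R * eps ^+ d by rewrite !mulr_gt0// exprn_gt0.
have bias0 := contrast_bias_ge0.
have H00 (t : seq (X * R)) :
    (0 <= if insub t is Some z then (h z)%:E else 0)%E.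
  by case: insub => // z; rewrite lee_fin.
have ptE (z : n.-tuple (X * R)) : map fst z = xs -> (fun i => (tnth z i).1) = tnth xs.
  move=> zxs; apply/funext => i; rewrite (tnth_nth point xs) -zxs (nth_map point) ?size_tuple//.
  by rewrite (tnth_nth point).
have selE (z : n.-tuple (X * R)) : map fst z = xs ->
    selected_cells psi s kappa thr eps z = selected_at xs.
  by move=> zxs; apply/setP => Q; rewrite !inE selected_pt ptE.
case: ifPn => hT; last first.
  apply: le_trans (noise_int_cst th ok xs _); last by rewrite lee_fin sqr_ge0.
  apply: noise_int_le => // t txs; case: insubP => [z _ zt|_]; last by rewrite lee_fin sqr_ge0.
  rewrite lee_fin; apply: (le_trans (hle z)).
  rewrite /lr_estimator selE ?zt// (negbTE hT).
  have : 0 <= (vhi - nvar th) * (nvar th - vlo) by rewrite mulr_ge0// subr_ge0.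
  have := sqr_ge0 (vhi - vlo).
  move: v1 v2; move: (nvar th) => v v1 v2; nra.
pose w (Q : cell s) (i : nat) : R :=
  if insub i is Some k then pweight psi thr eps (tnth xs) Q k else 0.
have wE Q (k : 'I_n) : w Q k = pweight psi thr eps (tnth xs) Q k by rewrite /w valK.
have T0 : 0 < #|selected_at xs|%:R :> R by apply: lt_le_trans hT.
have NP Q : Q \in selected_at xs -> [/\ (0 < #|pidx (tnth xs) Q|)%N,
    pwell psi kappa (tnth xs) Q & ppairs psi thr eps (tnth xs) Q != [::]].
  by rewrite inE => /and3P[/eqP N ? ?]; split => //; rewrite N.
have wnorm Q : Q \in selected_at xs -> \sum_(0 <= i < size xs) w Q i ^+ 2 = 1.
  move=> /NP[N1 N2 N3]; rewrite size_tuple big_mkord.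
  under eq_bigr do rewrite wE.
  exact: (pweight_norm kappa0 num_poly_gt0 thr0 N1 N2 N3).
have wdisj Q Q' i : Q != Q' -> w Q i * w Q' i = 0.
  move=> QQ'; rewrite /w; case: insub => [k|]; last by rewrite mul0r.
  have [kQ|kQ] := boolP (k \in pidx (tnth xs) Q); last by rewrite pweight_notin// mul0r.
  rewrite [X in _ * X]pweight_notin ?mulr0// inE (in_cell_disj QQ')//.
  by move: kQ; rewrite inE.
have wbias Q : Q \in selected_at xs ->
    (\sum_(0 <= i < size xs) w Q i * reg th (nth point xs i)) ^+ 2 <= contrast_bias.
  move=> /NP[N1 N2 N3]; rewrite size_tuple big_mkord.
  under eq_bigr do rewrite wE -tnth_nth.
  have [p pk [p1 p2]] := cell_taylor Q.
  have hs0 : 0 <= holder_scale.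
    by rewrite /holder_scale !mulr_ge0 ?exprn_ge0 ?powR_ge0.
  have inQ (r : 'I_#|pidx (tnth xs) Q|) : in_cell Q (tnth xs (enum_val r)).
    by have := enum_valP r; rewrite inE.
  apply: (pweight_bias kappa0 num_poly_gt0 thr0 B0 Bbd Blip N1 N2 psiB pk hs0 (ltW eps0)).
    by move=> r; exact: p1.
  by move=> r r'; exact: p2.
have hK : 2 * M4 <= 2 * M4 + 4 * vhi ^+ 2 by rewrite lerDl mulr_ge0// sqr_ge0.
have hK' : 4 * nvar th ^+ 2 <= 2 * M4 + 4 * vhi ^+ 2.
  by rewrite ler_wpDl ?mulr_ge0// ler_wpM2l// lerXn2r ?nnegrE.
apply: (@le_trans _ _ (contrast_bias ^+ 2
   + (8 * nvar th * contrast_bias + (2 * M4 + 4 * vhi ^+ 2)) / #|selected_at xs|%:R)%:E); last first.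
  rewrite lee_fin lerD2l; apply: ler_pM.
  - have K0 : 0 <= 2 * M4 + 4 * vhi ^+ 2 by rewrite addr_ge0 ?mulr_ge0// sqr_ge0.
    by rewrite addr_ge0// mulr_ge0// mulr_ge0.
  - by rewrite invr_ge0 ltW.
  - by rewrite lerD2r ler_wpM2r// ler_wpM2l.
  - by rewrite lef_pV2 ?posrE// mulrA.
apply: le_trans (contrast_average_risk v0 ok_moments hK hK' T0 wnorm wdisj wbias).
apply: noise_int_le => // t txs; case: insubP => [z _ zt|_]; last by rewrite lee_fin sqr_ge0.
rewrite -zt in txs *.
rewrite lee_fin; apply: (le_trans (hle z)); rewrite /lr_estimator selE// hT.
apply: le_of_eq; congr ((_ * _ - _) ^+ 2).
apply: eq_bigr => Q _; rewrite cell_term_pt ptE// size_tuple big_mkord; congr (_ ^+ 2).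
by apply: eq_bigr => i _; rewrite wE (tnth_nth point).
Qed.

Hypotheses (mok : measurable_fun [set: X] ok)
  (ok_ae : forall f : X -> \bar R, measurable_fun setT f -> (forall x, (0 <= f x)%E) ->
    (\int[design_law th]_x f x = \int[design_law th]_x (if ok x then f x else 0))%E).

(** Bound the integral of every measurable function below the squared error,
   which does not require the measurability of the screening.  Such a function of
   [n]-tuples is extended by 0 to sequences. *)
Lemma lr_mse_le n : (0 < n)%N ->
  (mse (fun z : sample n => lr_estimator psi s kappa thr eps z c0 vlo vhi) th
   <= \int[iid (design_law th) n]_xs (risk_bound xs)%:E)%E.
Proof.
move=> n0; rewrite /mse; apply: integral_le_lower => [z|h mh h0 hle].
  by rewrite lee_fin sqr_ge0.
pose hs (t : seq (X * R)) : \bar R :=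
  if insub t is Some z then (h (z : n.-tuple (X * R)))%:E else 0%E.
have hs0 t : (0 <= hs t)%E by rewrite /hs; case: insub => // z; rewrite lee_fin.
have mhs : smeas hs.
  move=> k; have [kn|kn] := eqVneq k n.
    subst k; rewrite (_ : (fun t => _) = EFin \o h); first exact/measurable_EFinP.
    by apply/funext => t; rewrite /hs valK.
  rewrite (_ : (fun t => _) = cst 0%E)//; apply/funext => t.
  by rewrite /hs insubN// size_tuple.
apply: (@le_trans _ _ (\int[sample_law th n]_z hs z)%E).
  by apply: le_of_eq; apply: eq_integral => z _; rewrite /hs valK.
apply: (le_trans (integral_sample_le mok ok_ae _ mhs hs0)).
apply: ge0_integral_le => xs; first exact: noise_int_ge0.
by apply: lr_conditional_risk => // z; rewrite -lee_fin.
Qed.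

End conditional_risk.

Section almost_everywhere.
Context {dT : measure_display} {T : measurableType dT} {R : realType}.
Variable mu : {measure set T -> \bar R}.

(** The complement of a measurable null set that contains the exceptional
   points. *)
Lemma ae_measurable_pred (C : T -> Prop) : {ae mu, forall x, C x} ->
  exists ok : pred T, [/\ measurable_fun [set: T] ok, forall x, ok x -> C x &
    forall f : T -> \bar R, measurable_fun setT f -> (forall x, (0 <= f x)%E) ->
    (\int[mu]_x f x = \int[mu]_x (if ok x then f x else 0))%E].
Proof.
move=> [N [mN N0 CN]]; exists (fun x => x \notin N); split.
- apply: (measurable_fun_bool true); rewrite setTI.
  rewrite (_ : _ @^-1` _ = ~` N); first exact: measurableC.
  apply/seteqP; split => x hx; first by rewrite /= -notin_setE; exact: hx.
  by have : x \notin N by rewrite notin_setE.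
- by move=> x; rewrite notin_setE => xN; apply: contrapT => Cx; apply/xN/CN.
move=> f mf f0; rewrite (ge0_negligible_integral mN measurableT mf)//.
rewrite integral_mkcond; apply: eq_integral => x _.
by rewrite patchE in_setD in_setT.
Qed.

End almost_everywhere.

(** * Risk of the witness estimator *)

Section eventually_small.
Context {R : realType}.

Lemma powR_small (c a eta : R) : 0 <= c -> 0 < a -> 0 < eta ->
  exists N : R, 0 < N /\ forall n : nat, N <= n%:R -> c * n%:R `^ (- a) <= eta.
Proof.
move=> c0 a0 e0; have c1 : 0 < c / eta + 1 by rewrite ltr_wpDl// divr_ge0// ltW.
exists ((c / eta + 1) `^ a^-1); split=> [|n hn]; first exact: powR_gt0.
have := ge0_ler_powR (ltW a0) (powR_ge0 _ _) (ler0n R n) hn.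
rewrite -powRrM mulVf ?gt_eqF// powRr1 ?(ltW c1)// => h.
have na : 0 < n%:R `^ a by apply: lt_le_trans h.
rewrite powRN ler_pdivrMr// -ler_pdivrMl// mulrC; apply: le_trans h.
by rewrite lerDl.
Qed.

Lemma integral_add_indic dT (T : measurableType dT) (P : probability T R)
    (A D p : R) (X : T -> bool) : measurable_fun [set: T] X -> 0 <= A -> 0 <= D ->
  (\int[P]_x (if X x then 1 else 0) <= p%:E)%E ->
  (\int[P]_x (A + D * (X x)%:R)%:E <= (A + D * p)%:E)%E.
Proof.
move=> mX A0 D0 hp.
have mI : measurable_fun setT (fun x => (X x)%:R%:E : \bar R).
  apply/measurable_EFinP; rewrite (_ : (fun x => _) = fun x => if X x then 1 else 0).
    exact: measurable_fun_ifT.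
  by apply/funext => x; case: (X x).
under eq_integral do rewrite EFinD EFinM.
rewrite ge0_integralD//; last 2 first.
- by move=> x _; rewrite mule_ge0// lee_fin.
- exact: measurable_funeM.
rewrite ge0_integralZl//.
rewrite integral_cst// [X in (_ * X + _)%E]probability_setT mule1 EFinD EFinM.
rewrite leeD2l// lee_wpmul2l ?lee_fin//; apply: le_trans hp.
apply: ge0_integral_le => x; first by rewrite lee_fin.
by case: (X x).
Qed.

End eventually_small.

Section witness_risk.
Context {R : realType} {d : nat}.
Variables (bb bg : R) (U : set 'rV[R]_d) (L plo phi vlo vhi M4 lambda0 : R).
Variables (psi : 'I_(num_poly d bb) -> mpoly.mpoly d R) (ce ce' : R).
Hypotheses (hbb : 1 < bb) (hd : 4 * bb < d%:R)
    (hU : open U) (hcube : forall x : d.-tuple R, unit_cube x -> U (row_of x))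
    (plo0 : 0 < plo) (phi1 : 1 <= phi) (L0 : 0 <= L)
    (vlo0 : 0 <= vlo) (vlohi : vlo <= vhi) (M40 : 0 <= M4) (hlambda0 : 0 < lambda0)
    (hpsi : poly_basis (ell bb) psi) (hce : 0 < ce) (hce' : 0 < ce').

Lemma cube_sub (u : 'rV[R]_d) : cube u -> U u.
Proof.
move=> cu; have -> : u = row_of [tuple u 0 j | j < d].
  by apply/rowP => j; rewrite mxE tnth_mktuple.
by apply: hcube => j; rewrite tnth_mktuple.
Qed.

(** With cell sides of order n^(-1/d), the bias term is of order
   n^(-4 bb / d) eps^4 and the stochastic term of order 1 / (n eps^d); the
   bandwidth balances the two. *)
Lemma risk_bound_rate (H kappa c0 B eps cH Cg : R) n : (0 < n)%N -> 0 <= cH -> 0 < eps ->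
  0 < c0 ->
  ce * n%:R `^ (- a_star d bb) <= eps <= ce' * n%:R `^ (- a_star d bb) ->
  H = cH * n%:R `^ (- d%:R^-1) ->
  Cg = ((2 + 2 * (B / kappa) ^+ 2) / 1 * (L * d%:R ^+ (ell bb).+1) ^+ 2) ^+ 2
            * (cH `^ bb * ce') ^+ 4 ->
  contrast_bias (d := d) bb L H kappa 1 eps B ^+ 2
    + (8 * vhi * contrast_bias (d := d) bb L H kappa 1 eps B + (2 * M4 + 4 * vhi ^+ 2))
      / (c0 * (n%:R * eps ^+ d))
  <= (Cg + (8 * vhi * (1 + Cg) + (2 * M4 + 4 * vhi ^+ 2)) / (c0 * ce ^+ d))
     * n%:R `^ (- lr_exponent d bb).
Proof.
move=> n0 cH0 e0 c00 /andP[he he'] HE CgE.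
have vhi0 : 0 <= vhi by apply: le_trans vlohi.
have n1 : 1 <= n%:R :> R by rewrite ler1n.
have d0 : 0 < d%:R :> R by move: hbb hd => ? ?; lra.
have lr0 : 0 <= lr_exponent d bb :> R.
  by rewrite /lr_exponent divr_ge0 ?addr_ge0 ?mulr_ge0// ?(ltW d0)//; move: hbb => ?; lra.
set r := n%:R `^ (- lr_exponent d bb).
have r0 : 0 <= r by exact: powR_ge0.
have r1 : r <= 1 by rewrite /r -[leRHS](powRr0 n%:R) ler_powR// oppr_le0.
have hb := bandwidth_bias hbb hd n0 cH0 (ltW e0) he' HE; rewrite -/r in hb.
have hv := bandwidth_variance hbb hd n0 hce he.
set b := contrast_bias _ _ _ _ _ _ _.
have b2 : b ^+ 2 <= Cg * r.
  rewrite (_ : b ^+ 2 = ((2 + 2 * (B / kappa) ^+ 2) / 1 * (L * d%:R ^+ (ell bb).+1) ^+ 2) ^+ 2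
     * (H `^ bb * eps) ^+ 4); last first.
    rewrite /b /contrast_bias /holder_scale.
    by move: (_ / 1) (L * _) (H `^ _) => ? ? ?; ring.
  by rewrite CgE -[leRHS]mulrA ler_wpM2l// sqr_ge0.
have Cg0 : 0 <= Cg by rewrite CgE mulr_ge0// ?sqr_ge0// exprn_even_ge0.
have b1 : b <= 1 + Cg.
  have h1 : b ^+ 2 <= Cg by apply: le_trans b2 _; rewrite ler_piMr.
  have : b <= 1 + b ^+ 2 by have := sqr_ge0 (b - 2^-1); lra.
  by move=> /le_trans; apply; rewrite lerD2l.
have K0 : 0 <= 2 * M4 + 4 * vhi ^+ 2 by rewrite addr_ge0 ?mulr_ge0// sqr_ge0.
rewrite [leRHS]mulrDl lerD// -[leRHS]mulrA [_^-1 * r](_ : _ = (c0 * (ce ^+ d * n%:R `^ lr_exponent d bb))^-1); last first.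
  by rewrite /r powRN !invfM mulrA.
have ne0 : 0 < ce ^+ d * n%:R `^ lr_exponent d bb.
  by rewrite mulr_gt0 ?exprn_gt0// powR_gt0 ?ltr0n.
apply: ler_pM.
- have b0 : 0 <= b by exact: contrast_bias_ge0.
  by rewrite addr_ge0// mulr_ge0// mulr_ge0.
- by rewrite invr_ge0 mulr_ge0 ?(ltW c00)// mulr_ge0 ?exprn_ge0 ?(ltW e0).
- by rewrite lerD2r ler_wpM2l// mulr_ge0.
- rewrite lef_pV2 ?posrE ?mulr_gt0 ?exprn_gt0 ?powR_gt0 ?ltr0n//.
  by rewrite ler_pM2l.
Qed.

(** For large [n] the occupied cells are selected, so fewer than c0 n eps^d
   cells are selected with probability O(1 / (n eps^d)) only, and the squared error
   is bounded on this event.  For the finitely many other [n] the boundedness of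
   the conditional risk suffices. *)
Lemma witness_risk : exists kappa v0 c0 : R, [/\ 0 < kappa, 0 < v0, 0 < c0 &
  exists C : R, forall (s : nat -> 'I_d -> nat) (eps : nat -> R),
    balanced_splits lambda0 s -> asymp_pow ce ce' (a_star d bb) eps ->
    forall n, (0 < n)%N -> forall th, Theta U L plo phi vlo vhi M4 bb bg th ->
    (mse (fun z : sample n => lr_estimator psi (s n) kappa v0 (eps n) z c0 vlo vhi) th
      <= (C * n%:R `^ (- lr_exponent d bb))%:E)%E].
Proof.
have d0R : 0 < d%:R :> R by move: hbb hd => ? ?; lra.
have d0 : (0 < d)%N by move: d0R; rewrite ltr0n.
have q0 : (0 < num_poly d bb)%N by exact: num_poly_gt0.
have [w [delta [kap [wc /andP[delta0 delta1] kap0 wP]]]] := unisolvent hpsi.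
have [B B0 [Bbd Blip]] := basis_bound psi.
have [n0 [c0 [C1 [n00 c00 C10 occ]]]] := occupied_cells plo0 phi1 hlambda0 wc delta0 delta1.
pose kappa := kap / (num_poly d bb).+2%:R.
have kappa0 : 0 < kappa by rewrite divr_gt0.
have a0 : 0 < a_star d bb :> R.
  by rewrite /a_star divr_gt0 ?subr_gt0// mulr_gt0// addr_gt0.
pose eta := Num.min 2^-1 (kap / (1 + B)).
have eta0 : 0 < eta by rewrite /eta lt_min invr_gt0 ltr0n/= divr_gt0// ltr_wpDr.
have [n1 [n10 epsmall]] := powR_small (ltW hce') a0 eta0.
pose n2 := Num.max 1 (Num.max n0 n1).
have vhi0 : 0 <= vhi by apply: le_trans vlohi.
pose cH : R := 2 * (2 * lambda0) `^ d%:R^-1.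
have l2 : 0 < 2 * lambda0 by rewrite mulr_gt0.
have cH0 : 0 < cH by rewrite mulr_gt0// powR_gt0.
pose Cg := ((2 + 2 * (B / kappa) ^+ 2) / 1 * (L * d%:R ^+ (ell bb).+1) ^+ 2) ^+ 2
            * (cH `^ bb * ce') ^+ 4.
pose CA := Cg + (8 * vhi * (1 + Cg) + (2 * M4 + 4 * vhi ^+ 2)) / (c0 * ce ^+ d).
pose D := (vhi - vlo) ^+ 2.
have D0 : 0 <= D by exact: sqr_ge0.
pose rho := lr_exponent d bb : R.
have rho0 : 0 <= rho.
  by rewrite /rho /lr_exponent divr_ge0 ?addr_ge0 ?mulr_ge0// ?(ltW d0R)//; move: hbb => ?; lra.
exists kappa, 1, c0; split => //.
exists (CA + D * (C1 / ce ^+ d + n2 `^ rho)) => s eps hs heps n n_gt0 th hth.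
have [_ hdens [g gb regE] hv hae] := hth.
have [e0 /andP[he he']] := heps n n_gt0.
have [sE sij] := hs n n_gt0.
have n0R : 0 < n%:R :> R by rewrite ltr0n.
have [ok [mok ok_mom ok_ae]] := ae_measurable_pred hae.
pose H := cH * n%:R `^ (- d%:R^-1).
have H0 : 0 < H by rewrite mulr_gt0// powR_gt0.
have sH j : cell_side (s n) j <= H.
  apply: cell_side_le => //; first exact: ltW.
  have /andP[h1 _] := log_cells_bounds hlambda0 n_gt0.
  rewrite sE /H /cH !exprMn -!powR_mulrn ?powR_ge0// -!powRrM mulVf ?gt_eqF//.
  rewrite mulNr mulVf ?gt_eqF// powRr1 ?(ltW l2)// powRN powRr1// -mulrA.
  rewrite powR_mulrn// ler_wpM2l ?exprn_ge0//.
  rewrite -[leRHS]invrK lef_pV2 ?posrE ?invr_gt0 ?divr_gt0// ?ltr0n ?expn_gt0//.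
  by rewrite invfM invrK mulrC.
have rb := @risk_bound_rate H kappa c0 B (eps n) cH Cg n n_gt0 (ltW cH0) e0 c00 (introT andP (conj he he')) erefl erefl.
rewrite -/CA -/H -/rho in rb.
have := lr_mse_le d0 hbb L0 hU cube_sub gb regE hpsi H0 sH kappa0 ltr01 e0 c00 B0 Bbd Blip
  vlo0 hv M40 ok_mom mok ok_ae n_gt0.
move=> /le_trans; apply.
set A := contrast_bias _ _ _ _ _ _ _ ^+ 2 + _ in rb.
set r := n%:R `^ - rho in rb *.
have r0 : 0 < r by rewrite powR_gt0.
have A0 : 0 <= A.
  have b0 : 0 <= contrast_bias (d := d) bb L H kappa 1 (eps n) B.
    exact: contrast_bias_ge0.
  rewrite /A addr_ge0 ?sqr_ge0// divr_ge0//.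
    have K0 : 0 <= 2 * M4 + 4 * vhi ^+ 2 by rewrite addr_ge0 ?mulr_ge0// sqr_ge0.
    by rewrite addr_ge0// mulr_ge0// mulr_ge0.
  by rewrite mulr_ge0 ?(ltW c00)// mulr_ge0// exprn_ge0// ltW.
have [hn|hn] := leP n2 n%:R; last first.
  apply: (@le_trans _ _ (\int[iid (design_law th) n]_xs (A + D)%:E)%E).
    apply: ge0_integral_le => xs; rewrite lee_fin /risk_bound.
      by case: ifP => _; [exact: A0|exact: sqr_ge0].
    by case: ifP => _; rewrite ?lerDl// -/D lerDr.
  rewrite integral_cst// [X in (_ * X)%E]probability_setT mule1 lee_fin.
  rewrite mulrDl lerD// -mulrA ler_peMr//.
  rewrite mulrDl ler_wpDl ?mulr_ge0 ?invr_ge0 ?exprn_ge0 ?(ltW hce) ?(ltW r0)//.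
  rewrite /r powRN ler_pdivlMr ?powR_gt0// mul1r.
  have n20 : 0 < n2 by rewrite /n2 lt_max ltr01.
  by apply: ge0_ler_powR; rewrite ?nnegrE//; exact: ltW.
have /andP[nn0 nn1] : (n0 <= n%:R) && (n1 <= n%:R).
  by move: hn; rewrite /n2 !ge_max => /andP[_].
have he2 : eps n <= eta by apply: le_trans he' (epsmall n nn1).
have e_half : eps n <= 2^-1 by move: he2; rewrite /eta le_min => /andP[].
have Be : B * eps n ^+ 2 <= kap.
  move: he2; rewrite /eta le_min => /andP[_]; rewrite ler_pdivlMr ?ltr_wpDr// => h.
  apply: le_trans h; rewrite expr2 mulrCA ler_pM2l//.
  apply: (@le_trans _ _ (B * 1)); last by rewrite mulr1 lerDr.
  by rewrite ler_wpM2l// (le_trans e_half)// invf_le1// ler1n.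
pose cnt (xs : n.-tuple (d.-tuple R)) : R :=
  occ_count (fun Q : cell (s n) => in_cell Q) (goodseq w delta (eps n)) xs.
pose few xs := cnt xs < c0 * n%:R * eps n ^+ d.
have mcnt : measurable_fun setT cnt.
  apply: measurable_occ_count => Q; first exact: measurable_in_cell.
  by apply: measurable_goodseq; exact: ltW.
have mfew : measurable_fun setT few by apply: measurable_fun_ltr.
have cnt_le (xs : n.-tuple (d.-tuple R)) :
    cnt xs <= #|selected_at kappa 1 (eps n) psi (s n) xs|%:R.
  rewrite /cnt /occ_count -sum1_card natr_sum [leRHS]big_mkcond/=.
  apply: ler_sum => Q _; case hQ : (goodseq _ _ _ _ _) => //; last by case: ifP.
  by rewrite inE (goodseq_selected q0 kap0 B0 Bbd Blip wP Be hQ).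
have occ' := occ n (s n) (eps n) th nn0 sE e0 e_half hdens.
apply: (@le_trans _ _ (\int[iid (design_law th) n]_xs (A + D * (few xs)%:R)%:E)%E).
  apply: ge0_integral_le => xs; rewrite lee_fin /risk_bound.
    by case: ifP => _; [exact: A0|exact: sqr_ge0].
  case: ifPn => hsel.
  - by rewrite lerDl mulr_ge0.
  - have -> : few xs.
      by rewrite /few (le_lt_trans (cnt_le xs))// ltNge.
    by rewrite mulr1 -/D lerDr.
apply: (le_trans (integral_add_indic mfew A0 D0 occ')).
rewrite lee_fin mulrDl lerD// -mulrA ler_wpM2l//.
apply: (@le_trans _ _ (C1 / ce ^+ d * r)); last first.
  by rewrite ler_wpM2r ?(ltW r0)// lerDl powR_ge0.
rewrite -mulrA ler_wpM2l// /r powRN -invfM lef_pV2 ?posrE ?mulr_gt0 ?exprn_gt0 ?powR_gt0//.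
exact: bandwidth_variance.
Qed.

End witness_risk.

(** * Conditional expectation and clipping *)

Lemma clip_contraction (R : realType) (a b x v : R) : a <= v <= b ->
  (clip a b x - v) ^+ 2 <= (x - v) ^+ 2.
Proof.
move=> /andP[av vb]; rewrite /clip.
have [ax|xa] := leP a x; last first.
  have [ba|ab] := leP b a.
    by have -> : b = v; [lra|rewrite subrr expr0n sqr_ge0].
  have := mulr_ge0 (ltW (_ : 0 < a - x)) (_ : 0 <= (v - a) + (v - x)).
  by rewrite subr_gt0 => /(_ xa); rewrite addr_ge0 ?subr_ge0// ?(le_trans (ltW xa))// => /(_ erefl); nra.
have [bx|xb] := leP b x => //.
have := mulr_ge0 (_ : 0 <= x - b) (_ : 0 <= (b - v) + (x - v)).
by rewrite subr_ge0 => /(_ bx); rewrite addr_ge0 ?subr_ge0// ?(le_trans vb)// => /(_ erefl); nra.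
Qed.

Section conditional_expectation.
Context {dT : measure_display} {T : measurableType dT} {R : realType}.
Variables (P : probability T R) (C : set (set T)).
Local Notation G := <<s C >>.
Variable h : T -> R.

Let sigmaI (A B : set T) : G A -> G B -> G (A `&` B).
Proof. exact: (@measurableI _ (g_sigma_algebraType C) A B). Qed.

(** On an event {m' <= r < m} both versions have the same integral, so such an
    event is null; these events cover {m' < m}. *)
Lemma condexp_le_ae (m m' : T -> R) : is_condexp P G h m -> is_condexp P G h m' ->
  P.-negligible [set x | m' x < m x].
Proof.
move=> [_ im Gm mE] [_ im' Gm' mE'].
pose A (r : R) := m @^-1` `]r, +oo[ `&` m' @^-1` `]-oo, r].
have mm : measurable_fun setT m by have /measurable_int/measurable_EFinP := im.
have mm' : measurable_fun setT m' by have /measurable_int/measurable_EFinP := im'.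
have mA r : measurable (A r).
  by apply: measurableI; rewrite -[X in measurable X]setTI; [exact: mm|exact: mm'].
have GA r : G (A r) by apply: sigmaI; [exact: Gm|exact: Gm'].
have nA r : P.-negligible (A r).
  have iA : P.-integrable (A r) (EFin \o m) by exact: integrableS im.
  have iA' : P.-integrable (A r) (EFin \o m') by exact: integrableS im'.
  have mD : measurable_fun (A r) (fun x => (m x - m' x)%:E).
    by apply/measurable_EFinP; apply: measurable_funTS; exact: measurable_funB.
  have E : (\int[P]_(x in A r) (m x - m' x)%:E = 0)%E.
    under eq_integral do rewrite EFinB.
    rewrite integralB//= mE// mE'// subee// -mE//.
    exact: (integrable_fin_num (mA r) iA).
  have pos x : A r x -> 0 < m x - m' x.
    by move=> [/=]; rewrite !in_itv/= andbT => rm m'r; rewrite subr_gt0 (le_lt_trans m'r).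
  have : (\int[P]_(x in A r) `|(m x - m' x)%:E| = 0)%E.
    by rewrite -[RHS]E; apply: eq_integral => x /[!inE] /pos/ltW p0; rewrite gee0_abs.
  move=> /(ae_eq_integral_abs P (mA r) mD); apply: negligibleS => x Ax /= /(_ Ax)[].
  by apply/eqP; rewrite gt_eqF// pos.
apply: (@negligibleS _ _ _ _ (\bigcup_k A (if unpickle k is Some q then ratr (q : rat) else 0))).
  move=> x /= /rat_in_itvoo[q]; rewrite in_itv/= => /andP[h1 h2].
  exists (pickle q) => //; rewrite pickleK; split; rewrite /= in_itv/= ?andbT//; exact: ltW.
by apply: negligible_bigcup => k; exact: nA.
Qed.

Lemma condexp_ae_unique (m m' : T -> R) : is_condexp P G h m -> is_condexp P G h m' ->
  {ae P, forall x, m x = m' x}.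
Proof.
move=> c c'; apply: negligibleS (negligibleU (condexp_le_ae c c') (condexp_le_ae c' c)).
by move=> x /= /eqP; rewrite neq_lt => /orP[]; [right|left].
Qed.

(** h - sg is the sum of h - m' and m' - sg, where m' is the version of the
   conditional expectation that [v] refers to, and agrees with [m] almost
   everywhere. *)
Lemma condvar_mse (sg c : R) (m v : T -> R) :
  is_condexp P G h m -> is_condvar P G h v ->
  (\int[P]_x ((m x - sg) ^+ 2)%:E <= c%:E)%E -> (\int[P]_x (v x)%:E <= c%:E)%E ->
  (\int[P]_x ((h x - sg) ^+ 2)%:E <= (4 * c)%:E)%E.
Proof.
move=> cm [m' cm' [_ _ _ vE]] hm hv.
have mfun (f : T -> R) : P.-integrable setT (EFin \o f) -> measurable_fun setT f.
  by move=> /measurable_int/measurable_EFinP.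
have mh : measurable_fun setT h by case: cm => /mfun.
have mm : measurable_fun setT m by case: cm => _ /mfun.
have mm' : measurable_fun setT m' by case: cm' => _ /mfun.
have msq (f g : T -> R) : measurable_fun setT f -> measurable_fun setT g ->
    measurable_fun setT (fun x => ((f x - g x) ^+ 2)%:E).
  by move=> mf mg; apply/measurable_EFinP; apply: measurable_funX; exact: measurable_funB.
have GT : G setT by exact: (@measurableT _ (g_sigma_algebraType C)).
have h1 : (\int[P]_x ((h x - m' x) ^+ 2)%:E <= c%:E)%E by rewrite -vE.
have h2 : (\int[P]_x ((m' x - sg) ^+ 2)%:E <= c%:E)%E.
  apply: le_trans hm; apply: le_of_eq.
  apply: ge0_ae_eq_integral => //; [exact: (msq m' (cst sg))|exact: (msq m (cst sg))|by move=> x _; rewrite lee_fin sqr_ge0|by move=> x _; rewrite lee_fin sqr_ge0|].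
  by apply: filterS (condexp_ae_unique cm cm') => x -> _.
apply: (@le_trans _ _ (\int[P]_x (2%:E * ((h x - m' x) ^+ 2)%:E + 2%:E * ((m' x - sg) ^+ 2)%:E))%E).
  apply: ge0_le_integral => //.
  - by move=> x _; rewrite lee_fin sqr_ge0.
  - exact: (msq h (cst sg)).
  - by apply: emeasurable_funD; apply: measurable_funeM; [exact: msq|exact: (msq m' (cst sg))].
  - move=> x _; rewrite -!EFinM -EFinD lee_fin.
    by have := sqr_ge0 (h x - m' x - (m' x - sg)); lra.
rewrite ge0_integralD//; last 4 first.
- by move=> x _; rewrite mule_ge0// lee_fin sqr_ge0.
- by apply: measurable_funeM; exact: msq.
- by move=> x _; rewrite mule_ge0// lee_fin sqr_ge0.
- by apply: measurable_funeM; exact: (msq m' (cst sg)).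
rewrite !ge0_integralZl//; try (by move=> x _; rewrite lee_fin sqr_ge0); [|exact: (msq m' (cst sg))|exact: msq].
have -> : ((4 * c)%:E = 2%:E * c%:E + 2%:E * c%:E)%E.
  by rewrite -!EFinM -EFinD; congr (_%:E); ring.
by rewrite leeD// lee_wpmul2l.
Qed.

End conditional_expectation.

(** * Rates of convergence *)

Theorem theorem2p1 (R : realType) (d : nat) (bb bg : R)
    (U : set 'rV[R]_d) (L plo phi vlo vhi M4 lambda0 : R)
    (psi : 'I_(num_poly d bb) -> mpoly.mpoly d R) (ce ce' : R)
    (hbb : 1 < bb) (hbg : 0 < bg) (hd : 4 * bb < d%:R)
    (hU : open U) (hcube : forall x : d.-tuple R, unit_cube x -> U (row_of x))
    (hp : [/\ 0 < plo, plo < 1 & 1 < phi]) (hL : 1 <= L)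
    (hv : [/\ 0 < vlo, vlo <= vhi & vhi ^+ 2 < M4]) (hlambda0 : 0 < lambda0)
    (hpsi : poly_basis (ell bb) psi) (hce : 0 < ce) (hce' : 0 < ce') :
  let Th := Theta U L plo phi vlo vhi M4 bb bg in
  let LR (kappa v0 c0 : R) (s : nat -> 'I_d -> nat) (eps : nat -> R) n :=
    fun z : sample n =>
      lr_estimator psi (s n) kappa v0 (eps n) z c0 vlo vhi in
  let hoif_rate n := n%:R `^ (- (8 * bb / (d%:R + 4 * bb))) in
  let LR_rate n := n%:R `^ (- (4 * (bb + 1) / (d%:R + 4))) in
  let LR_bound (kappa v0 c0 : R) :=
    exists C : R, forall (s : nat -> 'I_d -> nat) (eps : nat -> R),
      balanced_splits lambda0 s ->
      asymp_pow ce ce' (a_star d bb) eps ->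
      forall n, (0 < n)%N ->
        (ereal_sup [set mse (LR kappa v0 c0 s eps n) th | th in Th]
           <= (C * LR_rate n)%:E)%E in
  (exists kappa v0 c0 : R,
     [/\ 0 < kappa, 0 < v0, 0 < c0 & LR_bound kappa v0 c0]) /\
  (forall kappa v0 c0 : R,
     0 < kappa -> 0 < v0 -> 0 < c0 -> LR_bound kappa v0 c0 ->
   forall C0 : R, exists C : R,
   forall (s : nat -> 'I_d -> nat) (eps : nat -> R)
     (train est : forall n, {set 'I_n})
     (hoif : forall n, sample (R := R) (d := d) n -> R),
     balanced_splits lambda0 s ->
     asymp_pow ce ce' (a_star d bb) eps ->
     sample_split R train est ->
     (forall n, measurable_fun [set: n.-tuple (d.-tuple R * R)] (hoif n)) ->
     (beta_star d bb < bg -> forall n, (0 < n)%N -> forall th, Th th ->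
        (exists2 m,
           is_condexp (sample_law th n) (subsample_sigma (train n)) (hoif n) m &
           (mse m th <= (C0 * hoif_rate n)%:E)%E) /\
        (exists2 v,
           is_condvar (sample_law th n) (subsample_sigma (train n)) (hoif n) v &
           (\int[sample_law th n]_z (v z)%:E <= (C0 * hoif_rate n)%:E)%E)) ->
     \forall n \near \oo,
       (ereal_sup [set mse (sharp_estimator d bb bg vlo vhi (hoif n)
                              (LR kappa v0 c0 s eps n)) th | th in Th]
          <= (C * (if beta_star d bb < bg then hoif_rate n
                   else LR_rate n))%:E)%E).
Proof.
move=> Th LR hoif_rate LR_rate LR_bound; split.
  have [plo0 _ phi1] := hp; have [vlo0 vlohi vhiM] := hv.
  have L0 : 0 <= L by apply: le_trans hL.
  have M40 : 0 <= M4 by apply: le_trans (ltW vhiM); exact: sqr_ge0.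
  have [kappa [v0 [c0 [k0 v00 c00 [C HC]]]]] := witness_risk bg hbb hd hU hcube
    plo0 (ltW phi1) L0 (ltW vlo0) vlohi M40 hlambda0 hpsi hce hce'.
  exists kappa, v0, c0; split => //; exists C => s eps hs heps n n0.
  by apply: ge_ereal_sup => _ [th hth <-]; exact: HC.
move=> kappa v0 c0 _ _ _ [C1 hC1] C0.
exists (if beta_star d bb < bg then 4 * C0 else C1).
move=> s eps train est hoif hs heps _ _ hyp; exists 1%N => // n n0.
have [hb|hb] := boolP (beta_star d bb < bg); last first.
  have := hC1 s eps hs heps n n0.
  by rewrite /sharp_estimator (negbTE hb).
apply: ge_ereal_sup => _ [th hth <-].
have [[m cm hm] [v cv hv']] := hyp hb n n0 th hth.
rewrite -mulrA; apply: le_trans (condvar_mse cm cv hm hv').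
apply: ge0_integral_le => z; first by rewrite lee_fin sqr_ge0.
rewrite lee_fin /sharp_estimator hb; apply: clip_contraction.
by case: hth.
Qed.
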